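(* Let $A$ and $M$ be integers with $0<A\le M$, let $r$ be a nonnegative integer and let $s$ be a positive integer. Then, as $n\to\infty$, $$\sigma_{M,A}^{[s]}(r;n)\sim\begin{cases}2^{-2}\,3^{-\frac12}\,M^{-1}\,n^{-1}\,e^{\pi\sqrt{\frac{2n}{3}}}, & \text{if } r=0,\\[6pt] 2^{\frac{3r-12}{4}}\,3^{\frac{r-2}{4}}\,\pi^{-\frac r2}\,M^{-1}\,s^{-\frac r2}\,r\,\Gamma\!\left(\tfrac r2\right)\,n^{\frac{r-4}{4}}\,e^{\pi\sqrt{\frac{2n}{3}}}, & \text{if } r\ge 1,\end{cases}$$ where $\Gamma(z)$ is Euler's gamma function.
   Context: A partition $\pi$ of $n$ (written $\pi\vdash n$) is a weakly decreasing finite sequence of positive integers, called parts, with sum $n$. The frequency of a positive integer $k$ in $\pi$ is the number of times $k$ occurs as a part of $\pi$ (possibly $0$). For a positive integer $s$, $\operatorname{mex}^{[s]}(\pi)$ denotes the smallest positive integer whose frequency in $\pi$ is less than $s$. For integers $A,M$ with $0<A\le M$, a nonnegative integer $r$ and a positive integer $s$, define $$\sigma_{M,A}^{[s]}(r;n):=\sum_{\substack{\pi\vdash n\\ \operatorname{mex}^{[s]}(\pi)\equiv A \bmod M}}\big(\operatorname{mex}^{[s]}(\pi)\big)^r.$$ The notation $f(n)\sim g(n)$ as $n\to\infty$ means $f(n)/g(n)\to 1$. *)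

(* Defs.v *)
From mathcomp Require Import all_boot all_order all_algebra.
From mathcomp Require Import all_classical all_reals all_analysis.

Set Implicit Arguments.
Unset Strict Implicit.
Unset Printing Implicit Defensive.

Import Order.TTheory GRing.Theory Num.Theory.
Import numFieldNormedType.Exports.

Local Open Scope classical_set_scope.
Local Open Scope nat_scope.

Definition is_partition (n : nat) (p : seq nat) : bool :=
  [&& sorted geq p, all (leq 1) p & sumn p == n].

Lemma leq_sumn (p : seq nat) : {in p, forall x, x <= sumn p}.
Proof.
move=> x; elim: p => //= y p IH; rewrite inE => /orP[/eqP->|/IH].
  exact: leq_addr.
by move=> /leq_trans; apply; exact: leq_addl.
Qed.

Lemma mex_exists (s : nat) (s_gt0 : 0 < s) (p : seq nat) :
  exists k, (0 < k) && (count_mem k p < s).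
Proof.
exists (sumn p).+1; rewrite /=.
suff /count_memPn -> : (sumn p).+1 \notin p by [].
by apply/negP => /leq_sumn; rewrite ltnn.
Qed.

Definition mex (s : nat) (s_gt0 : 0 < s) (p : seq nat) : nat :=
  ex_minn (mex_exists s_gt0 p).

(* [\big[_/_]_(p \in _)] over a classical set is the unit when the set of
   indices is infinite; [finite_partitions] rules this out for [sigma]. *)
Lemma finite_partitions (n : nat) : finite_set [set p | is_partition n p].
Proof.
apply: (@sub_finite_set _ _
  [set (map val (val t)) | t in [set: n.-bseq 'I_n.+1]]); last first.
  by apply: finite_image; exact: finite_finset.
move=> p /= /and3P[_ pos /eqP sum_p].
have size_p : size p <= n.
  rewrite -sum_p; elim: p pos {sum_p} => //= x p IH /andP[x0 pos].
  by rewrite -add1n leq_add ?IH.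
have lt_p x : x \in p -> x < n.+1 by rewrite -sum_p ltnS; exact: leq_sumn.
have size_q : size (map (@inord n) p) <= n by rewrite size_map.
exists (Bseq size_q) => //=; rewrite -map_comp -[RHS]map_id.
by apply/eq_in_map => x /lt_p xn; rewrite /= inordK.
Qed.

Definition sigma (s : nat) (s_gt0 : 0 < s) (M A r n : nat) : nat :=
  \big[addn/0]_(p \in [set p | is_partition n p
                             /\ mex s_gt0 p = A %[mod M]]) mex s_gt0 p ^ r.

Local Open Scope ring_scope.

(* Euler's integral, convergent for [0 < z]. *)
Definition Gamma (R : realType) (z : R) : R :=
  \int[lebesgue_measure]_(t in `]0, +oo[) (t `^ (z - 1) * expR (- t)).

Definition asymp_equiv (R : realType) (f g : nat -> R) : Prop :=
  f n / g n @[n --> \oo] --> (1 : R).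

(* Main.v *)
Require Import Defs.
From mathcomp Require Import all_boot all_order all_algebra finmap.
From mathcomp Require Import all_classical all_reals all_analysis.
From mathcomp Require Import measurable_realfun ring lra zify.

(** Let p(n) be the number of partitions of n and T(k) = s k (k + 1) / 2.
    Removing s copies of each of 1, ..., k shows that p(n - T(k)) partitions of
    n have a mex greater than k ([card_mex_gt]). Hence [sigmaE]: sigma is the
    sum, over the m = A mod M, of m^r (p(n - T(m - 1)) - p(n - T(m))), and what
    matters is the growth of p and of its first difference.

    Growth of p. Put t = pi / sqrt (6 n) and give each partition with parts at
    most n the weight e^(- t size). The multiplicities of the parts then become
    independent geometric variables, and p(n) is, up to an explicit factor, the
    probability that the size is n. The inversion integral for this probability
    is written in polar form, so that only real functions occur, and is proved
    by a recursion on the largest part ([fourier_coefE]). The factor comes from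
    an Euler-Maclaurin expansion ([sum_nlog_asymp]): the main term is the Basel
    sum, and the trapezoid errors add up to Stirling's constant. Applied at t
    and at distance O(1 / sigma) from t, the same expansion gives by convexity
    the mean and the variance of the size ([tilt_mean_asymp],
    [tilt_var_asymp]), so that the rescaled integrand tends to a Gaussian. The
    cosine sums of [sum_one_sub_cos_ge] provide an integrable majorant
    ([tilt_mod_le_cauchy]), and dominated convergence gives the Hardy-Ramanujan
    formula [npart_asymp]. The majorant does not depend on the frequency, which
    gives the uniform bound [npart_tilted_le] on p(n - i).

    First difference. The number p(n) - p(n - 1) counts the partitions without
    part 1. Adding a part h >= 2 to them shows that it is almost monotone, and
    therefore comparable with its averages over short intervals, which are
    known from p ([no1_shift_cvg]).

    The sum. The difference p(n - T(m - 1)) - p(n - T(m)) consists of s m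
    consecutive values of the first difference, and the m that matter are of
    order n^(1/4). In the variable x = c m^2 / sqrt n, where c = pi s / (2 sqrt
    6), the sum over the residue class is a Riemann sum for
    x^(r/2) e^(-x) / (M c^(r/2)); the factor 1 / M is the density of the class.
    Dominated convergence ([step_sum_cvg]) gives the limit
    Gamma (r / 2 + 1) / (M c^(r/2)) in [sigma_asymp]. The two cases of the
    theorem are Gamma 1 = 1 and Gamma (z + 1) = z Gamma z. *)

Set Implicit Arguments.
Unset Strict Implicit.
Unset Printing Implicit Defensive.
Import Order.TTheory GRing.Theory Num.Theory.
Import numFieldNormedType.Exports.

Local Open Scope classical_set_scope.
Local Open Scope ring_scope.

(** * Counting partitions by their mex *)

Section Partition_counting.
Local Open Scope nat_scope.

Definition partitions n : {fset (seq nat)} := fset_set [set p | is_partition n p].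

Lemma partitionsE n p : (p \in partitions n) = is_partition n p.
Proof.
rewrite in_fset_set; last exact: finite_partitions.
by apply/idP/idP; rewrite inE.
Qed.

(** Inclusion of multisets given as sequences; a value outside D has
    multiplicity 0 in D and needs no test. *)
Definition dominates (D p : seq nat) := all (fun i => count_mem i D <= count_mem i p) D.

Lemma dominatesP (D p : seq nat) :
  reflect (forall i, count_mem i D <= count_mem i p) (dominates D p).
Proof.
apply: (iffP allP) => [h i|h i _]; last exact: h.
have [/h//|/count_memPn->//] := boolP (i \in D).
Qed.

Definition parts_in (Q : pred nat) n : {fset (seq nat)} :=
  [fset p in partitions n | all Q p]%fset.

Lemma parts_inE Q n p :
  (p \in parts_in Q n) = [&& is_partition n p & all Q p].
Proof. by rewrite !inE partitionsE. Qed.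

Lemma geq_total : total geq. Proof. by move=> x y; rewrite /geq orbC leq_total. Qed.
Lemma geq_trans : transitive geq.
Proof. by move=> y x z /= xy yz; rewrite (leq_trans yz). Qed.
Lemma geq_anti : antisymmetric geq.
Proof. by move=> x y; rewrite /geq andbC -eqn_leq => /eqP. Qed.

Lemma perm_sumn (p q : seq nat) : perm_eq p q -> sumn p = sumn q.
Proof. by move=> pq; rewrite !sumnE; exact: perm_big. Qed.

Lemma in_fset_sep (T : choiceType) (A : {fset T}) (P : pred T) x :
  (x \in [fset x in A | P x]%fset) = (x \in A) && P x.
Proof. by rewrite !inE. Qed.

Lemma parts_inP Q n p : reflect
  [/\ sorted geq p, all (leq 1) p, sumn p = n & all Q p] (p \in parts_in Q n).
Proof.
rewrite parts_inE /is_partition; apply: (iffP idP).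
  by move=> /andP[/and3P[-> -> /eqP->] ->].
by move=> [-> -> -> ->]; rewrite eqxx.
Qed.

Lemma sorted_perm_eq (p q : seq nat) :
  sorted geq p -> sorted geq q -> perm_eq p q -> p = q.
Proof. exact: (sorted_eq geq_trans geq_anti). Qed.

(** Adding the multiset D to a partition of n - sumn D, and sorting, is a
    bijection onto the partitions that contain D: the inverse takes D out. *)
Lemma card_parts_dominating (Q : pred nat) (D : seq nat) n :
    all (leq 1) D -> all Q D ->
  #|` [fset p in parts_in Q n | dominates D p]%fset | =
  if sumn D <= n then #|` parts_in Q (n - sumn D) | else 0.
Proof.
move=> D1 QD.
(* D is a submultiset of p, so the rest of p is obtained by taking D out *)
have split_off p : dominates D p -> exists r, perm_eq p (D ++ r).
  move=> /dominatesP dom.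
  have /count_subseqP[q qp Dq] : forall x, count_mem x D <= count_mem x p by [].
  have [r pr] := perm_to_subseq qp.
  by exists r; rewrite (perm_trans pr)// perm_cat2r perm_sym.
case: leqP => Dn; last first.
  apply/eqP; rewrite cardfs_eq0; apply/eqP/fsetP => p; rewrite in_fset_sep in_fset0.
  apply/negbTE/negP => /andP[/parts_inP[_ _ pn _] /split_off[r /perm_sumn]].
  by rewrite sumn_cat; lia.
pose F (p : seq nat) := sort geq (D ++ p).
have permF p : perm_eq (F p) (D ++ p) by rewrite perm_sort.
have <- : #|` [fset F p | p in parts_in Q (n - sumn D)]%fset| =
    #|` parts_in Q (n - sumn D) |.
  rewrite card_in_imfset//=.
  move=> p q /parts_inP[ps _ _ _] /parts_inP[qs _ _ _] FE.
  apply: sorted_perm_eq => //; rewrite -(perm_cat2l D).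
  by apply: (perm_trans _ (permF q)); rewrite -FE perm_sym permF.
congr #|` _ |; apply/fsetP => p; apply/idP/imfsetP.
  rewrite in_fset_sep => /andP[/parts_inP[ps p1 pn Qp] /split_off[r pr]].
  have := perm_sumn pr; rewrite sumn_cat => sr.
  have sortr : perm_eq (sort geq r) r by rewrite perm_sort.
  exists (sort geq r).
    apply/parts_inP; split; first exact: (sort_sorted geq_total).
    - move: p1; rewrite (perm_all _ pr) all_cat => /andP[_].
      by rewrite (perm_all _ sortr).
    - by rewrite (perm_sumn sortr); lia.
    - by move: Qp; rewrite (perm_all _ pr) all_cat (perm_all _ sortr) => /andP[].
  apply: sorted_perm_eq => //; first exact: (sort_sorted geq_total).
  rewrite (perm_trans pr)// perm_sym (perm_trans (permF _))//.
  by rewrite perm_cat2l.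
move=> [q /parts_inP[qs q1 qn Qq] ->].
rewrite in_fset_sep; apply/andP; split.
  apply/parts_inP; split; first exact: (sort_sorted geq_total).
  - by rewrite (perm_all _ (permF _)) all_cat D1.
  - by rewrite (perm_sumn (permF _)) sumn_cat; lia.
  - by rewrite (perm_all _ (permF _)) all_cat QD.
apply/dominatesP => i; have /permP -> := permF q.
by rewrite count_cat leq_addr.
Qed.

Definition npart_le K n := #|` parts_in (geq K) n |.
Definition npart n := #|` partitions n |.

Lemma npart_leE K n : n <= K -> npart_le K n = npart n.
Proof.
move=> nK; congr #|` _ |; apply/fsetP => p.
rewrite parts_inE partitionsE andb_idr // => /and3P[_ _ /eqP pn].
by apply/allP => x /leq_sumn; rewrite pn /=; lia.
Qed.

Lemma npart_le0 n : npart_le 0 n = (n == 0).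
Proof.
have [->|n0] := eqVneq n 0.
  apply/eqP/cardfs1P; exists [::]; apply/fsetP => p; rewrite inE.
  apply/parts_inP/eqP => [[_ p1 _ p0]|->//].
  by case: p p1 p0 => //= x p /andP[x1 _] /andP[x0 _]; lia.
apply/eqP; rewrite cardfs_eq0; apply/eqP/fsetP => p; rewrite inE.
apply/parts_inP => -[_ p1 pn p0]; move: n0; rewrite -pn.
by case: p p1 p0 {pn} => //= x p /andP[x1 _] /andP[x0 _]; lia.
Qed.

Lemma card_fset_sepC (T : choiceType) (A : {fset T}) (P : pred T) :
  #|` [fset x in A | P x]%fset| + #|` [fset x in A | ~~ P x]%fset| = #|` A|.
Proof.
by rewrite !card_fset_sum1 -big_fsetID.
Qed.

Lemma dominates1 K p : dominates [:: K] p = (K \in p).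
Proof. by rewrite /dominates /= eqxx andbT addn0 -has_count has_pred1. Qed.

(** Either K.+1 is not a part, or one copy of it can be removed. *)
Lemma npart_leS K n :
  npart_le K.+1 n =
  npart_le K n + (if K.+1 <= n then npart_le K.+1 (n - K.+1) else 0).
Proof.
have := @card_parts_dominating (geq K.+1) [:: K.+1] n.
rewrite /= addn0 leqnn => /(_ isT isT) <-.
rewrite [LHS](esym (card_fset_sepC _ (dominates [:: K.+1]))) addnC; congr (_ + _).
congr #|` _ |; apply/fsetP => p; rewrite in_fset_sep dominates1 !parts_inE -andbA.
congr (_ && _); apply/andP/allP => [[/allP pK Kp] x xp|pK].
  have := pK _ xp; rewrite /= leq_eqVlt => /predU1P[xK|//].
  by move: Kp; rewrite -xK xp.
split; first by apply/allP => x /pK /= /leqW.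
by apply/negP => /pK /=; rewrite ltnn.
Qed.

Definition npart_no1 n := #|` [fset p in partitions n | 1 \notin p]%fset|.

Lemma parts_inT n : parts_in predT n = partitions n.
Proof. by apply/fsetP => p; rewrite parts_inE partitionsE all_predT andbT. Qed.

(** Removing one part 1 when there is one: npart_no1 is the backward
    difference of npart. *)
Lemma npartS n : npart n.+1 = npart n + npart_no1 n.+1.
Proof.
have := @card_parts_dominating predT [:: 1] n.+1 isT isT.
rewrite /= addn0 subSS subn0 /npart -[partitions n]parts_inT => <-.
rewrite parts_inT -(card_fset_sepC (partitions n.+1) (dominates [:: 1])).
by congr addn; congr #|` _ |; apply/fsetP => p; rewrite !in_fset_sep dominates1.
Qed.

(** Adding a part h is injective, and creates no part 1 because h >= 2. With
    h = 1 excluded, monotonicity only holds between indices at distance at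
    least 2. *)
Lemma npart_no1_leD n h : 2 <= h -> npart_no1 n <= npart_no1 (n + h).
Proof.
move=> h2; pose F (p : seq nat) := sort geq (h :: p).
have permF p : perm_eq (F p) (h :: p) by rewrite perm_sort.
rewrite /npart_no1; set A := [fset p in partitions n | _]%fset.
have <- : #|` [fset F p | p in A]%fset| = #|` A |.
  rewrite card_in_imfset//= /A.
  move=> p q; rewrite !in_fset_sep !partitionsE /=.
  move=> /andP[/and3P[ps _ _] _] /andP[/and3P[qs _ _] _] FE.
  apply: sorted_perm_eq => //; rewrite -(perm_cons h).
  by apply: (perm_trans _ (permF q)); rewrite -FE perm_sym permF.
apply: fsubset_leq_card; apply/fsubsetP => _ /imfsetP[p /= + ->].
rewrite !in_fset_sep !partitionsE => /andP[/and3P[ps p1 /eqP pn] p1'].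
rewrite (perm_mem (permF p)) inE negb_or p1' andbT.
apply/andP; split; last by lia.
apply/and3P; split; first exact: (sort_sorted geq_total).
- by rewrite (perm_all _ (permF _)) /= p1 andbT; lia.
- by rewrite (perm_sumn (permF _)) /= pn addnC.
Qed.

Section Mex.
Variables (s : nat) (s_gt0 : 0 < s).

Definition tri k := s * 'C(k.+1, 2).

Lemma triS k : tri k.+1 = tri k + s * k.+1.
Proof. by rewrite /tri binS bin1 mulnDr. Qed.

(** The number of partitions of n that contain s copies of each of 1, ..., k:
    taking these copies out leaves a partition of n - tri k. *)
Definition npart_mex k n := if tri k <= n then npart (n - tri k) else 0.

(** A condition on the mex becomes the inclusion of a fixed multiset, which
    [card_parts_dominating] counts. *)
Lemma mex_gtE k p : (k < mex s_gt0 p) =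
  dominates (flatten [seq nseq s i | i <- iota 1 k]) p.
Proof.
have cnt i : count_mem i (flatten [seq nseq s j | j <- iota 1 k]) =
    if 0 < i <= k then s else 0.
  rewrite count_flatten -map_comp.
  rewrite (eq_map (g := fun j => (j == i) * s)); last first.
    by move=> j /=; rewrite count_nseq.
  have -> : sumn [seq (j == i) * s | j <- iota 1 k] =
            count_mem i (iota 1 k) * s.
    by elim: (iota 1 k) => //= j l ->; rewrite mulnDl.
  rewrite count_uniq_mem ?iota_uniq// mem_iota add1n ltnS.
  by case: ifP; rewrite ?mul1n.
rewrite /mex; case: ex_minnP => m /andP[m0 ms] mmin.
apply/idP/dominatesP => [km i|dom].
  rewrite cnt; case: ifP => // /andP[i0 ik].
  rewrite leqNgt; apply/negP => lt_s.
  by have := mmin i; rewrite i0 lt_s => /(_ isT); lia.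
rewrite ltnNge; apply/negP => mk.
by have := dom m; rewrite cnt m0 mk leqNgt ms.
Qed.

Lemma card_mex_gt k n :
  #|` [fset p in partitions n | k < mex s_gt0 p]%fset| = npart_mex k n.
Proof.
set D := flatten [seq nseq s i | i <- iota 1 k].
have sumD : sumn D = tri k.
  rewrite /D; elim: k {D} => [|k IH]; first by rewrite /tri muln0.
  rewrite -(addn1 k) iotaD map_cat flatten_cat sumn_cat IH /= cats0 add1n.
  by rewrite sumn_nseq addn1 triS mulnC.
have D1 : all (leq 1) D.
  apply/allP => x /flattenP[q /mapP[i]]; rewrite mem_iota => /andP[i1 _] -> xi.
  by move: xi; rewrite mem_nseq => /andP[_ /eqP->].
have := @card_parts_dominating predT D n D1 (all_predT _).
rewrite !parts_inT sumD /npart_mex /npart => <-.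
by congr #|` _ |; apply/fsetP => p; rewrite !in_fset_sep mex_gtE.
Qed.

Lemma tri_geq k : k <= tri k.
Proof. by elim: k => // k IH; rewrite triS; nia. Qed.

(** The partitions are grouped by the value m of their mex, and those of mex
    m are the ones of mex greater than m - 1 but not greater than m. *)
Lemma sigmaE M A r n :
  sigma s_gt0 M A r n =
  \sum_(1 <= m < n.+2 | m == A %[mod M])
     m ^ r * (npart_mex m.-1 n - npart_mex m n).
Proof.
rewrite /sigma; pose G p := mex s_gt0 p == A %[mod M].
have -> : [set p | is_partition n p /\ mex s_gt0 p = A %[mod M]] =
    [set` [seq p <- partitions n | G p]].
  apply/seteqP; split => p; rewrite /= mem_filter partitionsE /G.
    by move=> [-> ->]; rewrite eqxx.
  by move=> /andP[/eqP ? ?]; split.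
rewrite -fsbig_seq ?filter_uniq ?fset_uniq// big_filter big_mkcond /=.
rewrite big_seq_cond (eq_bigr (fun p => \sum_(1 <= m < n.+2 | m == A %[mod M])
   (m == mex s_gt0 p) * m ^ r)); last first.
  move=> p /andP[pn _].
  have mexn : mex s_gt0 p <= n.+1.
    rewrite leqNgt mex_gtE; apply/negP => dom.
    have : p \in [fset p in partitions n | n.+1 < mex s_gt0 p]%fset.
      by rewrite !in_fset_sep pn mex_gtE.
    have := card_mex_gt n.+1 n; rewrite /npart_mex leqNgt tri_geq /=.
    by move=> /eqP; rewrite cardfs_eq0 => /eqP ->; rewrite inE.
  have mex0 : 0 < mex s_gt0 p by rewrite mex_gtE.
  rewrite big_mkcond (bigD1_seq (mex s_gt0 p)) ?iota_uniq//=; last first.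
    by rewrite mem_index_iota mex0.
  rewrite eqxx mul1n big1 ?addn0; last first.
    by move=> i /negbTE ->; case: ifP.
  by rewrite /G; case: ifP.
rewrite -big_seq_cond exchange_big /=.
rewrite big_nat_cond [RHS]big_nat_cond; apply: eq_bigr => m /andP[/andP[m1 mn] mA].
rewrite -big_distrl /= mulnC; congr (_ * _).
rewrite -!card_mex_gt.
have eqn p : (m == mex s_gt0 p) = (m.-1 < mex s_gt0 p) && ~~ (m < mex s_gt0 p).
  by rewrite prednK// -leqNgt eqn_leq.
have -> : #|` [fset p in partitions n | m.-1 < mex s_gt0 p]%fset| =
    #|` [fset p in partitions n | m < mex s_gt0 p]%fset| +
    \sum_(p <- partitions n) (m == mex s_gt0 p).
  rewrite !card_fset_sum1 -!big_fset_condE ![in LHS]big_mkcond /=.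
  rewrite [X in X + _]big_mkcond /= -big_split; apply: eq_bigr => p _ /=.
  rewrite eqn; case: ifP; case: ifP => //= h1 h2.
  by rewrite (leq_ltn_trans (leq_pred m) h1) in h2.
by rewrite addKn.
Qed.
End Mex.

End Partition_counting.

(** * Elementary inequalities and integration on the line *)

(* Turns the derivative found by instance resolution into an identity that
   the tactic for rings, or for fields, decides. *)
Ltac is_derive_ring := apply: is_derive_eq; rewrite /GRing.scale /=; ring.
Ltac is_derive_field := apply: is_derive_eq; rewrite /GRing.scale /=; field.

Section Calculus.
Context {R : realType}.
Implicit Types (f df : R -> R) (a b x y : R).

Lemma mean_value f df a b : a <= b ->
    (forall x, a <= x <= b -> is_derive x 1 f (df x)) ->
  exists2 c, a <= c <= b & f b - f a = df c * (b - a).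
Proof.
move=> ab fdf; have [||c cab ->] := @MVT_segment R f df a b ab.
- by move=> x /[!in_itv]/= /andP[ax xb]; apply: fdf; rewrite !ltW.
- apply: derivable_within_continuous => x; rewrite in_itv/= => xab.
  by have [] := fdf _ xab.
- by exists c => //; move: cab; rewrite in_itv.
Qed.

Lemma ge0_derive_le f df a b : a <= b ->
    (forall x, a <= x <= b -> is_derive x 1 f (df x)) ->
    (forall x, a <= x <= b -> 0 <= df x) ->
  f a <= f b.
Proof.
move=> ab fdf df0; have [c cab fE] := mean_value ab fdf.
by rewrite -subr_ge0 fE mulr_ge0 ?subr_ge0 ?df0.
Qed.

Lemma sin_le x : 0 <= x -> sin x <= x.
Proof.
move=> x0; rewrite -subr_ge0.
have /(_ x0) := @ge0_derive_le (fun x => x - sin x) (fun x => 1 - cos x) 0 x.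
by rewrite sin0 subr0; apply=> y _; rewrite subr_ge0 cos_le1.
Qed.

(** The Taylor bounds of sin and cos are obtained from each other by
    comparing derivatives. *)
Lemma cos_ge x : 1 - x ^+ 2 / 2 <= cos x.
Proof.
wlog x0 : x / 0 <= x.
  move=> h; have [/h//|/ltW x0] := leP 0 x.
  by rewrite -cosN -sqrrN h// oppr_ge0.
rewrite -subr_ge0.
have /(_ x0) := @ge0_derive_le (fun x => cos x - (1 - x ^+ 2 / 2))
  (fun x => x - sin x) 0 x.
rewrite cos0 expr0n mul0r subr0 subrr; apply=> y.
  by move=> _; is_derive_field.
by case/andP => y0 _; rewrite subr_ge0 sin_le.
Qed.

Lemma sin_ge x : 0 <= x -> x - x ^+ 3 / 6 <= sin x.
Proof.
move=> x0; rewrite -subr_ge0.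
have /(_ x0) := @ge0_derive_le (fun x => sin x - (x - x ^+ 3 / 6))
  (fun x => cos x - (1 - x ^+ 2 / 2)) 0 x.
rewrite sin0 expr0n mul0r !subr0; apply=> y _; last by rewrite subr_ge0 cos_ge.
by is_derive_field.
Qed.

Lemma cos_le x : cos x <= 1 - x ^+ 2 / 2 + x ^+ 4 / 24.
Proof.
wlog x0 : x / 0 <= x.
  move=> h; have [/h//|/ltW x0] := leP 0 x.
  rewrite -cosN -(sqrrN x) (_ : x ^+ 4 = (- x) ^+ 4); last by ring.
  by rewrite h// oppr_ge0.
rewrite -subr_ge0.
have /(_ x0) := @ge0_derive_le (fun x => 1 - x ^+ 2 / 2 + x ^+ 4 / 24 - cos x)
  (fun x => sin x - (x - x ^+ 3 / 6)) 0 x.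
rewrite cos0 !expr0n !mul0r addr0 subr0 subrr; apply=> y.
  by move=> _; is_derive_field.
by case/andP => y0 _; rewrite subr_ge0 sin_ge.
Qed.

Lemma norm_sin_sub x : `|sin x - x| <= `|x| ^+ 3.
Proof.
wlog x0 : x / 0 <= x.
  move=> h; have [/h//|/ltW x0] := leP 0 x.
  have := h (- x); rewrite oppr_ge0 sinN normrN => /(_ x0).
  by rewrite -opprD normrN.
rewrite ler0_norm ?subr_le0 ?sin_le// ger0_norm// opprB.
have := sin_ge x0; have : 0 <= x ^+ 3 by rewrite exprn_ge0.
lra.
Qed.

Lemma norm_cos_sub x : `|2 * (1 - cos x) - x ^+ 2| <= x ^+ 4.
Proof.
have := cos_le x; have := cos_ge x; have : 0 <= x ^+ 4 by rewrite exprn_even_ge0.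
by rewrite ler_norml => *; apply/andP; split; lra.
Qed.

Lemma norm_atan_sub x : `|atan x - x| <= `|x| ^+ 3.
Proof.
wlog x0 : x / 0 <= x.
  move=> h; have [/h//|/ltW x0] := leP 0 x.
  have := h (- x); rewrite oppr_ge0 atanN normrN => /(_ x0).
  by rewrite -opprD normrN.
have V y : 0 < 1 + y ^+ 2 by rewrite ltr_wpDr ?sqr_ge0.
have le1 : atan x <= x.
  rewrite -subr_ge0.
  have /(_ x0) := @ge0_derive_le (fun x => x - atan x) (fun x => 1 - (1 + x ^+ 2)^-1) 0 x.
  rewrite atan0 subr0; apply=> y _.
  by rewrite subr_ge0 invf_le1 ?V// lerDl sqr_ge0.
have le2 : x - x ^+ 3 <= atan x.
  rewrite -subr_ge0.
  have /(_ x0) := @ge0_derive_le (fun x => atan x - (x - x ^+ 3))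
    (fun x => (1 + x ^+ 2)^-1 - (1 - 3 * x ^+ 2)) 0 x.
  rewrite atan0 expr0n !subr0; apply=> y _; first by is_derive_ring.
  rewrite subr_ge0 -[leRHS]mul1r ler_pdivlMr ?V//.
  by have := sqr_ge0 y; have := sqr_ge0 (y ^+ 2); rewrite -exprM; nra.
rewrite ler0_norm ?subr_le0// ger0_norm// opprB; lra.
Qed.

Lemma ln_ge x : 0 <= x -> x - x ^+ 2 / 2 <= ln (1 + x).
Proof.
move=> x0; rewrite -subr_ge0.
have /(_ x0) := @ge0_derive_le (fun x => ln (1 + x) - (x - x ^+ 2 / 2))
  (fun x => (1 + x)^-1 - (1 - x)) 0 x.
rewrite expr0n mul0r addr0 ln1 !subr0; apply=> y /andP[y0 _].
  have D := @is_derive1_ln R (1 + y) (ltr_pwDl ltr01 y0).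
  by is_derive_field; rewrite gt_eqF// ltr_pwDl.
rewrite subr_ge0 -[leRHS]mul1r ler_pdivlMr ?ltr_pwDl//.
by have := sqr_ge0 y; nra.
Qed.

Lemma ln_le x : 0 < x -> ln x <= x - 1.
Proof.
by move=> x0; rewrite -[in leLHS](subrKC 1 x) le_ln1Dx//; lra.
Qed.

Lemma ln_geV x : 0 < x -> 1 - x^-1 <= ln x.
Proof.
move=> x0; have := @ln_le x^-1; rewrite invr_gt0 lnV// => /(_ x0); lra.
Qed.

Lemma expRN_le1B x : 0 <= x -> expR (- x) <= 1 - x + x ^+ 2 / 2.
Proof.
move=> x0; rewrite -subr_ge0.
have /(_ x0) := @ge0_derive_le (fun x => 1 - x + x ^+ 2 / 2 - expR (- x))
  (fun x => expR (- x) - (1 - x)) 0 x.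
rewrite expr0n mul0r oppr0 expR0 !addr0 subrr; apply=> y _.
  by is_derive_field.
by rewrite subr_ge0 expR_ge1Dx.
Qed.

Lemma expR_ge_pow x n : 0 <= x -> x ^+ n / n`!%:R <= expR x.
Proof.
case: n => [|n] x0; first by rewrite expr0 fact0 divr1 -expR0 ler_expR.
by apply: le_trans (expR_ge1Dxn n x0); rewrite lerDr.
Qed.

Lemma pow_expRN_le x n : 0 <= x -> x ^+ n * expR (- x) <= n`!%:R.
Proof.
move=> x0; rewrite expRN ler_pdivrMr ?expR_gt0//.
by have := expR_ge_pow n x0; rewrite ler_pdivrMr ?ltr0n ?fact_gt0// mulrC.
Qed.

(** Jordan's inequality, with a constant that makes it hold up to 2 > pi / 2. *)
Lemma sin_geD3 x : 0 <= x <= 2 -> x / 3 <= sin x.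
Proof.
move=> /andP[x0 x2]; apply: le_trans (sin_ge x0).
have : x ^+ 2 <= 4 by nra.
rewrite exprS; nra.
Qed.

Lemma is_derive_continuous f df : (forall x, is_derive x 1 f (df x)) -> continuous f.
Proof.
move=> fdf x; apply: differentiable_continuous; apply/derivable1_diffP.
by have [] := fdf x.
Qed.

Local Notation mu := (@lebesgue_measure R).
Local Notation mR := (measurableTypeR R).

Lemma integrable_continuous_itv f a b : continuous f ->
  mu.-integrable `[a, b] (EFin \o f).
Proof.
move=> cf; apply: continuous_compact_integrable; first exact: segment_compact.
exact: continuous_subspaceT.
Qed.

Lemma Rintegral_derive_in f df a b : a <= b ->
    (forall x, a <= x <= b -> {for x, continuous df}) ->
    (forall x, a <= x <= b -> is_derive x 1 f (df x)) ->
  \int[mu]_(x in `[a, b]) df x = f b - f a.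
Proof.
rewrite le_eqVlt => /predU1P[->|ab] cdf fdf.
  by rewrite set_itv1 Rintegral_set1 subrr.
have cf x : a <= x <= b -> {for x, continuous f}.
  move=> xab; apply: differentiable_continuous; apply/derivable1_diffP.
  by have [] := fdf x xab.
rewrite /Rintegral (@continuous_FTC2 _ df f)//.
- by apply: continuous_in_subspaceT => x; rewrite inE/= in_itv/=; exact: cdf.
- split.
  + by move=> x; rewrite in_itv/= => /andP[/ltW ax /ltW xb]; have [] := fdf x; rewrite ?ax.
  + by apply: cvg_at_right_filter; apply: cf; rewrite lexx ltW.
  + by apply: cvg_at_left_filter; apply: cf; rewrite lexx ltW.
- move=> x; rewrite in_itv/= => /andP[/ltW ax /ltW xb]; rewrite derive1E.
  by have [] := fdf x; rewrite ?ax.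
Qed.

Lemma Rintegral_derive f df a b : a <= b -> continuous df ->
    (forall x, is_derive x 1 f (df x)) ->
  \int[mu]_(x in `[a, b]) df x = f b - f a.
Proof. by move=> ab cdf fdf; apply: Rintegral_derive_in => // x _; exact: cdf. Qed.

(** The domains vary with n: the functions are extended by 0 outside them. *)
Lemma dominated_convergence_moving (A : nat -> set mR) (h : nat -> mR -> R)
    (f g : mR -> R) :
    (forall n, measurable (A n)) -> (forall n, measurable_fun [set: mR] (h n)) ->
    mu.-integrable [set: mR] (EFin \o g) -> (forall x, 0 <= g x) ->
    (forall x, (h n \_ (A n)) x @[n --> \oo] --> f x) ->
    (\forall n \near \oo, forall x, A n x -> `|h n x| <= g x) ->
  \int[mu]_(x in A n) h n x @[n --> \oo] --> \int[mu]_x f x.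
Proof.
move=> mA mh ig g0 hf [N _ hg].
rewrite -(cvg_shiftn N) /=.
pose F n := h (n + N)%N \_ (A (n + N)%N).
have mF n : measurable_fun [set: mR] (F n).
  by apply/measurable_restrict => //; exact: measurable_funTS.
have cF x : F n x @[n --> \oo] --> f x.
  by have := hf x; rewrite -(cvg_shiftn N).
have mf : measurable_fun [set: mR] f by exact: (measurable_fun_cvg mF).
have Fg n x : `|F n x| <= g x.
  rewrite /F patchE; case: ifPn => [|_]; last by rewrite normr0.
  by rewrite inE => xA; apply: hg => //=; exact: leq_addl.
have [| | | | |intf _ cvgF] := @dominated_convergence _ _ R mu setT measurableT
  (fun n => EFin \o F n) (EFin \o f) (EFin \o g).
- by move=> n; exact/measurable_EFinP.
- exact/measurable_EFinP.
- apply: aeW => x _; apply/fine_cvgP; split; first exact: nearW.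
  exact: cF.
- exact: ig.
- by apply: aeW => x n _; rewrite lee_fin.
have finf := integrable_fin_num measurableT intf.
have /= := cvgF; rewrite -(fineK finf) => /fine_cvgP[_].
rewrite /= [X in X -> _](_ : _ = (\int[mu]_x F n x @[n --> \oo] --> \int[mu]_x f x))//.
apply: cvg_trans; apply: near_eq_cvg; apply: nearW => n.
by rewrite /F -Rintegral_mkcond.
Qed.

Lemma integrable_cauchy (C : R) :
  mu.-integrable [set: mR] (EFin \o (fun x : mR => C * (1 + x ^+ 2)^-1)).
Proof.
have m1 : measurable_fun [set: mR] (fun x : mR => (1 + x ^+ 2)^-1 : R).
  apply: continuous_measurable_fun; exact: continuous_oneDsqrV.
have i1 : mu.-integrable [set: mR] (EFin \o (fun x : mR => (1 + x ^+ 2)^-1)).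
  apply/integrableP; split; first exact/measurable_EFinP.
  under eq_integral => x _ do rewrite /= ger0_norm ?invr_ge0 ?addr_ge0 ?sqr_ge0//.
  rewrite ge0_symfun_integralT//=.
  - have /= := @integral0y_oneDsqr R; rewrite /oneDsqr.
    rewrite (_ : [set` `[0, +oo[] = [set x : R | 0 <= x]); last first.
      by apply/seteqP; split => x /=; rewrite in_itv/= andbT.
    by move=> ->; rewrite -EFinM ltry.
  - by move=> x; rewrite invr_ge0 addr_ge0 ?sqr_ge0.
  - exact: continuous_oneDsqrV.
  - by move=> x /=; rewrite sqrrN.
have := @integrableZl _ _ R mu setT measurableT C _ i1.
by apply: eq_integrable => // x _ /=; rewrite EFinM.
Qed.

Lemma Rintegral_gauss : \int[mu]_x expR (- x ^+ 2) = Num.sqrt pi.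
Proof. by rewrite /Rintegral integralT_gauss. Qed.

Lemma cvg_eventually (u v : nat -> R) (l : R) :
    v n @[n --> \oo] --> l -> (\forall n \near \oo, u n = v n) ->
  u n @[n --> \oo] --> l.
Proof.
move=> + uv; apply: cvg_trans; apply: near_eq_cvg.
by apply: filterS uv => n ->.
Qed.

Lemma cvg_inv_natr : n%:R^-1 @[n --> \oo] --> (0 : R).
Proof.
apply/gtr0_cvgV0; last exact: cvgr_idn.
by near=> n; rewrite ltr0n; near: n; exists 1%N.
Unshelve. all: by end_near. Qed.

Lemma cvg_expR_seq (u : nat -> R) (l : R) :
  u n @[n --> \oo] --> l -> expR (u n) @[n --> \oo] --> expR l.
Proof. by move=> ul; apply: continuous_cvg ul; exact: continuous_expR. Qed.

Lemma cvg_ln_seq (u : nat -> R) (l : R) : 0 < l ->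
  u n @[n --> \oo] --> l -> ln (u n) @[n --> \oo] --> ln l.
Proof. by move=> l0 ul; apply: continuous_cvg ul; exact: continuous_ln. Qed.

Lemma cvgM_seq (u v : nat -> R) (a b : R) :
  u n @[n --> \oo] --> a -> v n @[n --> \oo] --> b -> u n * v n @[n --> \oo] --> a * b.
Proof. by move=> ua vb; exact: cvgM. Qed.

Lemma cvgD_seq (u v : nat -> R) (a b : R) :
  u n @[n --> \oo] --> a -> v n @[n --> \oo] --> b -> u n + v n @[n --> \oo] --> a + b.
Proof. by move=> ua vb; exact: cvgD. Qed.

Lemma cvgB_seq (u v : nat -> R) (a b : R) :
  u n @[n --> \oo] --> a -> v n @[n --> \oo] --> b -> u n - v n @[n --> \oo] --> a - b.
Proof. by move=> ua vb; exact: cvgB. Qed.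

Lemma cvgMl_seq (k : R) (u : nat -> R) (a : R) :
  u n @[n --> \oo] --> a -> k * u n @[n --> \oo] --> k * a.
Proof. by move=> ua; exact: cvgMl_tmp. Qed.

Lemma nbhs_infty_gt0 : \forall n \near \oo, 0 < n%:R :> R.
Proof. by exists 1%N => // n /=; rewrite ltr0n. Qed.

Lemma squeeze_cvg0 (u v : nat -> R) :
    (\forall n \near \oo, `|u n| <= v n) -> v n @[n --> \oo] --> (0 : R) ->
  u n @[n --> \oo] --> (0 : R).
Proof.
move=> uv v0; apply: norm_cvg0; apply: (squeeze_cvgr _ (cvg_cst 0) v0).
by apply: filterS uv => n ->; rewrite normr_ge0.
Qed.

End Calculus.

(** * The Basel sum *)

Section Basel.
Context {R : realType}.
Implicit Types (x : R).

Lemma sin_ge_cosM x : 0 <= x <= pi -> x * cos x <= sin x.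
Proof.
move=> /andP[x0 xpi]; rewrite -subr_ge0.
have /(_ x0) := @ge0_derive_le R (fun x => sin x - x * cos x) (fun x => x * sin x) 0 x.
rewrite sin0 mul0r subr0; apply=> y.
  by move=> _; is_derive_ring.
by move=> /andP[y0 yx]; rewrite mulr_ge0// sin_ge0_pi// y0 (le_trans yx).
Qed.

(** The first term is the square of the cotangent, and sin x <= x <= tan x. *)
Lemma inv_sin2_bounds x : 0 < x < pi / 2 ->
  (sin x ^+ 2)^-1 - 1 <= (x ^+ 2)^-1 <= (sin x ^+ 2)^-1.
Proof.
move=> /andP[x0 xpi]; have pi0 := @pi_gt0 R.
have s0 : 0 < sin x by rewrite sin_gt0_pihalf// x0.
have c0 : 0 < cos x by rewrite cos_gt0_pihalf// xpi andbT; lra.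
have s1 := sin_le (ltW x0).
have s2 : x * cos x <= sin x by apply: sin_ge_cosM; apply/andP; split; lra.
apply/andP; split; last first.
  by rewrite lef_pV2 ?posrE ?exprn_gt0// ler_pXn2r// nnegrE ltW.
rewrite -[1](@divff _ (sin x ^+ 2)) ?gt_eqF ?exprn_gt0//.
rewrite -[X in X - _]mul1r -mulrBl -cos2sin2 ler_pdivrMr ?exprn_gt0//.
rewrite mulrC ler_pdivlMr ?exprn_gt0// mulrC -exprMn.
by rewrite ler_pXn2r// nnegrE ?mulr_ge0 ?(ltW s0) ?(ltW x0) ?(ltW c0).
Qed.

Definition inv_sin2_sum N : R :=
  \sum_(1 <= k < N) (sin (k%:R * pi / N%:R) ^+ 2)^-1.

(** The index k and 2 N - k give the same sine, and k = N gives 1. *)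
Lemma inv_sin2_half N : (0 < N)%N ->
  inv_sin2_sum (2 * N) = 1 + 2 * \sum_(1 <= k < N) (sin (k%:R * pi / (2 * N)%:R) ^+ 2)^-1.
Proof.
move=> N0; pose s k : R := (sin (k%:R * pi / (2 * N)%:R) ^+ 2)^-1.
have N20 : (2 * N)%:R != 0 :> R by rewrite pnatr_eq0; lia.
rewrite /inv_sin2_sum (@big_cat_nat _ _ _ N)//=; last by lia.
rewrite (big_ltn (m := N)); last by lia.
have -> : (sin (N%:R * pi / (2 * N)%:R) ^+ 2)^-1 = 1 :> R.
  rewrite (_ : N%:R * pi / _ = pi / 2); last first.
    by rewrite natrM; field; rewrite pnatr_eq0; lia.
  by rewrite sin_pihalf expr1n invr1.
have -> : \sum_(N.+1 <= i < 2 * N) s i = \sum_(1 <= i < N) s i.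
  rewrite (big_addn 1 _ N)/= (_ : 2 * N - N = N)%N; last by lia.
  rewrite [LHS]big_nat_rev/= !big_nat; apply: eq_bigr => i /andP[i1 iN].
  rewrite /s (_ : _ * pi / _ = pi - i%:R * pi / (2 * N)%:R); last first.
    have -> : (1 + N - i.+1 + N = 2 * N - i)%N by lia.
    rewrite natrB; last by lia.
    by rewrite !mulrBl mulrAC divff// mul1r.
  by rewrite sinB sinpi cospi mul0r sub0r mulN1r opprK.
rewrite -/(s _); ring.
Qed.

(** Pairing k with N - k turns the sum into one over sin^-2 + cos^-2, which is
    4 sin^-2 at the double angle. *)
Lemma inv_sin2_sum_double N : (0 < N)%N ->
  inv_sin2_sum (2 * N) = 1 + 4 * inv_sin2_sum N.
Proof.
move=> N0; have N20 : (2 * N)%:R != 0 :> R by rewrite pnatr_eq0; lia.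
have NR : N%:R != 0 :> R by rewrite pnatr_eq0; lia.
pose s k : R := (sin (k%:R * pi / (2 * N)%:R) ^+ 2)^-1.
rewrite inv_sin2_half//; congr (1 + _).
have -> : 2 * \sum_(1 <= k < N) s k = \sum_(1 <= k < N) (s k + s (N - k)%N).
  rewrite big_split/= [X in _ + X](_ : _ = \sum_(1 <= k < N) s k).
    by rewrite mulr_natl mulr2n.
  rewrite [LHS]big_nat_rev/= !big_nat; apply: eq_bigr => i /andP[i1 iN].
  by congr s; lia.
rewrite /inv_sin2_sum mulr_sumr !big_nat; apply: eq_bigr => k /andP[k1 kN].
(* x and pi / 2 - x are the points of index k and N - k *)
set x : R := k%:R * pi / (2 * N)%:R.
have pi0 := @pi_gt0 R.
have kR : 0 < k%:R :> R by rewrite ltr0n.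
have xpi : 0 < x < pi / 2.
  rewrite divr_gt0 ?mulr_gt0 ?ltr0n//=; last by lia.
  rewrite ltr_pdivrMr ?ltr0n; last by lia.
  have : k%:R < N%:R :> R by rewrite ltr_nat.
  rewrite natrM; nra.
have s0 : sin x != 0 by rewrite gt_eqF// sin_gt0_pihalf.
have c0 : cos x != 0.
  by rewrite gt_eqF// cos_gt0_pihalf//; case/andP: xpi => *; apply/andP; split; lra.
have -> : s (N - k)%N = (cos x ^+ 2)^-1.
  rewrite /s (_ : _ * pi / _ = pi / 2 - x); last first.
    rewrite /x natrB; last by lia.
    by rewrite natrM; field.
  by rewrite sinB sin_pihalf cos_pihalf mul0r mul1r subr0.
rewrite /s -/x (_ : k%:R * pi / N%:R = x *+ 2); last first.
  by rewrite /x natrM mulr2n; field.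
rewrite sin_mulr2n mulr2n.
have := cos2Dsin2 x => cs.
apply: (@mulIf _ (cos x ^+ 2 * sin x ^+ 2)); first by rewrite mulf_neq0 ?expf_neq0.
move: (cos x) (sin x) s0 c0 cs => c s' s0 c0 cs.
transitivity (c ^+ 2 + s' ^+ 2); first by field; rewrite s0 c0.
rewrite cs (_ : c * s' + c * s' = 2 * (c * s')); last by ring.
by field; rewrite ?s0 ?c0.
Qed.

Lemma inv_sin2_sum_pow n : inv_sin2_sum (2 ^ n) = ((2 ^ n)%:R ^+ 2 - 1) / 3.
Proof.
elim: n => [|n IH]; first by rewrite /inv_sin2_sum expn0 big_geq// expr1n subrr mul0r.
rewrite expnS inv_sin2_sum_double ?expn_gt0// IH natrM; by field.
Qed.

(** Summing [inv_sin2_bounds] at the points k pi / (2 M), where the sum of the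
    sin^-2 has the closed form of [inv_sin2_sum_pow]. *)
Lemma basel_pow_bounds n (M := (2 ^ n)%N) (B : R := \sum_(1 <= k < M) (k%:R ^+ 2)^-1) :
  `|B - pi ^+ 2 / 6| <= pi ^+ 2 / M%:R.
Proof.
have M0 : (0 < M)%N by rewrite expn_gt0.
have MR : 0 < M%:R :> R by rewrite ltr0n.
have M1 : 1 <= M%:R :> R by rewrite ler1n.
have pi0 := @pi_gt0 R.
pose s k : R := (sin (k%:R * pi / (2 * M)%:R) ^+ 2)^-1.
(* the points k pi / (2 M) with k < M lie below pi / 2, where the bounds hold *)
have sE : \sum_(1 <= k < M) s k = 2 * (M%:R ^+ 2 - 1) / 3.
  have := inv_sin2_half M0; rewrite inv_sin2_sum_double// -/s inv_sin2_sum_pow -/M.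
  by rewrite -/(s _) => ?; lra.
pose x k : R := k%:R * pi / (2 * M)%:R.
have xs k : (1 <= k < M)%N -> s k - 1 <= (x k ^+ 2)^-1 <= s k.
  move=> /andP[k1 kM]; apply: inv_sin2_bounds.
  rewrite /x divr_gt0 ?mulr_gt0 ?ltr0n//=; last by lia.
  rewrite ltr_pdivrMr ?ltr0n; last by lia.
  have : k%:R < M%:R :> R by rewrite ltr_nat.
  have : 0 < k%:R :> R by rewrite ltr0n.
  rewrite natrM; nra.
have BE : B = pi ^+ 2 / (4 * M%:R ^+ 2) * \sum_(1 <= k < M) (x k ^+ 2)^-1.
  rewrite mulr_sumr /B !big_nat; apply: eq_bigr => k /andP[k1 kM].
  have p0 : pi != 0 :> R by rewrite gt_eqF.
  have k0 : k%:R != 0 :> R by rewrite pnatr_eq0; lia.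
  have m0 : M%:R != 0 :> R by rewrite gt_eqF.
  by rewrite /x natrM; move: (@pi R) p0 => p p0; field; rewrite ?p0 ?k0 ?m0.
have up : \sum_(1 <= k < M) (x k ^+ 2)^-1 <= 2 * (M%:R ^+ 2 - 1) / 3.
  by rewrite -sE big_nat [leRHS]big_nat ler_sum// => k /xs/andP[].
have lo : 2 * (M%:R ^+ 2 - 1) / 3 - (M%:R - 1) <= \sum_(1 <= k < M) (x k ^+ 2)^-1.
  have <- : \sum_(1 <= k < M) (s k - 1) = 2 * (M%:R ^+ 2 - 1) / 3 - (M%:R - 1).
    by rewrite sumrB sE sumr_const_nat natrB.
  by rewrite big_nat [leRHS]big_nat ler_sum// => k /xs/andP[].
set X := \sum_(_ <= _ < _) _ in BE up lo.
have MM : M%:R != 0 :> R by rewrite gt_eqF.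
rewrite BE (_ : _ - _ = pi ^+ 2 / M%:R * ((X - 2 * M%:R ^+ 2 / 3) / (4 * M%:R))); last by field.
rewrite normrM ger0_norm ?divr_ge0 ?sqr_ge0 ?ler0n//.
rewrite ler_piMr ?divr_ge0 ?sqr_ge0 ?ler0n//.
rewrite normrM (ger0_norm (x := _^-1)) ?invr_ge0 ?mulr_ge0 ?ler0n//.
rewrite ler_pdivrMr ?mulr_gt0// mul1r ler_norml; apply/andP; split; lra.
Qed.

(** The partial sums increase, so it is enough to follow them along the
    indices 2 ^ n. *)
Lemma basel : series (fun k => (k.+1%:R ^+ 2)^-1 : R) @ \oo --> (pi ^+ 2 / 6 : R).
Proof.
set u := series _.
have u_nd : nondecreasing_seq u.
  by apply/nondecreasing_seqP => n; rewrite /u seriesSr lerDl invr_ge0 sqr_ge0.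
have uE n : u (2 ^ n).-1 = \sum_(1 <= k < 2 ^ n) (k%:R ^+ 2)^-1.
  by rewrite /u /series/= big_add1.
have pow_gt n : (n < 2 ^ n)%N by exact: ltn_expl.
have ub n : u n <= pi ^+ 2 / 6 + pi ^+ 2.
  apply: le_trans (u_nd _ (2 ^ n).-1 _) _; first by have := pow_gt n; lia.
  have := basel_pow_bounds n; rewrite uE => /ler_normlP[_].
  have : pi ^+ 2 / (2 ^ n)%:R <= pi ^+ 2 :> R.
    by rewrite ler_piMr ?sqr_ge0// invf_le1 ?ltr0n ?expn_gt0// ler1n expn_gt0.
  lra.
have cu : cvgn u.
  by apply: nondecreasing_is_cvgn => //; exists (pi ^+ 2 / 6 + pi ^+ 2) => _ [n _ <-].
suff <- : limn u = pi ^+ 2 / 6 by [].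
have c1 : u (2 ^ n).-1 @[n --> \oo] --> limn u.
  apply: (cvg_comp (fun n => (2 ^ n).-1)) cu.
  apply/cvgnyPge => A; exists A => // n /= An; have := pow_gt n; lia.
apply: (cvg_unique _ c1) => //.
apply/cvgrPdist_le => e e0.
have pe : 0 < pi ^+ 2 / e :> R by rewrite divr_gt0// exprn_gt0// pi_gt0.
near=> n; rewrite distrC uE; apply: le_trans (basel_pow_bounds n) _.
rewrite ler_pdivrMr ?ltr0n ?expn_gt0// mulrC -ler_pdivrMr//.
apply: (@le_trans _ _ n%:R); last by rewrite ler_nat ltnW.
near: n; exact: nbhs_infty_ger.
Unshelve. all: by end_near. Qed.

End Basel.

(** * Wallis' product and Stirling's formula *)

Section Stirling.
Context {R : realType}.
Implicit Types (x c : R).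
Local Notation mu := (@lebesgue_measure R).

(** The derivative of x (1 - (x / c)^2)^(n + 1) relates the integrals of
    exponents n and n + 1, and this function vanishes at both ends. *)
Lemma wallis_integral n c : 0 < c ->
  \int[mu]_(x in `[- c, c]) (1 - (x / c) ^+ 2) ^+ n =
  2 * c * \prod_(i < n) ((2 * i + 2)%:R / (2 * i + 3)%:R).
Proof.
move=> c0; have cN0 : c != 0 by rewrite gt_eqF.
have cc : - c <= c by lra.
pose f (x : R) : R := 1 - (x / c) ^+ 2.
have Df x : is_derive x 1 f (- (2 * x / c ^+ 2)) by is_derive_field.
have Cf m : continuous (fun x => f x ^+ m).
  move=> x; apply: (@continuous_comp _ _ _ f (fun y => y ^+ m)).
    exact: (is_derive_continuous Df).
  exact: exprn_continuous.
elim: n => [|n IH].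
  rewrite big_ord0 mulr1.
  have D1 x : is_derive x 1 (fun x : R => x) ((fun=> 1) x) by exact: is_derive_id.
  have C1 : continuous (fun _ : R => 1 : R) by move=> x; exact: cvg_cst.
  have := Rintegral_derive cc C1 D1.
  by rewrite opprK mulr2n mulrDl mul1r => <-; apply: eq_Rintegral => x _; rewrite expr0.
pose I m := \int[mu]_(x in `[- c, c]) f x ^+ m.
rewrite big_ord_recr/= [RHS]mulrA -IH -/(I n) -/(I n.+1).
have DG x : is_derive x 1 (fun x => x * f x ^+ n.+1)
    ((2 * n + 3)%:R * f x ^+ n.+1 - (2 * n + 2)%:R * f x ^+ n).
  have := is_deriveX n.+1 (Df x); rewrite exprfctE => DX.
  apply: (is_derive_eq (is_deriveM (is_derive_id x 1) DX)).
  rewrite /GRing.scale /= mulr1 exprS.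
  have -> : f x = 1 - (x / c) ^+ 2 by [].
  rewrite (natrD _ (2 * n) 3) (natrD _ (2 * n) 2) natrM -(natr1 n).
  rewrite !(exprS (1 - _)); field; exact: cN0.
have mI m : mu.-integrable `[- c, c] (EFin \o (fun x => f x ^+ m)).
  exact: integrable_continuous_itv.
have mZ k m : mu.-integrable `[- c, c] (EFin \o (fun x => k * f x ^+ m)).
  apply: integrable_continuous_itv => x; apply: cvgMl_tmp; exact: Cf.
have C' : continuous (fun x => (2 * n + 3)%:R * f x ^+ n.+1 - (2 * n + 2)%:R * f x ^+ n).
  by move=> x; apply: cvgB; apply: cvgMl_tmp; exact: Cf.
have := Rintegral_derive cc C' DG.
rewrite RintegralB// !RintegralZl// -/(I n) -/(I n.+1).
have f0 : f c = 0 by rewrite /f divff// expr1n subrr.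
have f0' : f (- c) = 0 by rewrite /f mulNr divff// sqrrN expr1n subrr.
rewrite f0 f0' !expr0n/= !mulr0 subrr => /eqP; rewrite subr_eq0 => /eqP E.
apply: (@mulfI _ (2 * n + 3)%:R); first by rewrite pnatr_eq0 addnS.
rewrite E; field; by rewrite -?natrM -?natrD pnatr_eq0 addnS.
Qed.

Lemma cvg_gauss_power x : (1 - x ^+ 2 / n%:R) ^+ n @[n --> \oo] --> expR (- x ^+ 2).
Proof.
set y := x ^+ 2; have y0 : 0 <= y by rewrite sqr_ge0.
have c1 : expR (- y * (1 - y / n%:R)^-1) @[n --> \oo] --> expR (- y).
  apply: continuous_cvg; first exact: continuous_expR.
  rewrite -[X in _ --> X]mulr1; apply: cvgMl_tmp.
  rewrite -[X in _ --> X]invr1; apply: cvgV; first by rewrite oner_neq0.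
  rewrite -[X in _ --> X]subr0; apply: cvgB; first exact: cvg_cst.
  rewrite -[X in _ --> X](mulr0 y); apply: cvgMl_tmp.
  exact: cvg_inv_natr.
apply: (squeeze_cvgr _ c1 (cvg_cst _)); near=> n.
have yn : y < n%:R by near: n; exact: nbhs_infty_gtr.
have n0 : 0 < n%:R :> R by exact: le_lt_trans yn.
have u0 : 0 < 1 - y / n%:R by rewrite subr_gt0 ltr_pdivrMr// mul1r.
rewrite -[(1 - _) ^+ n](@lnK R) ?posrE ?exprn_gt0// lnXn// !ler_expR -[ln _ *+ n]mulr_natl.
apply/andP; split.
  have := ler_wpM2l (ltW n0) (ln_geV u0); apply: le_trans.
  rewrite le_eqVlt; apply/orP; left; apply/eqP.
  have : n%:R - y != 0 by rewrite subr_eq0 gt_eqF.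
  have : n%:R != 0 :> R by rewrite gt_eqF.
  by move: (n%:R) => N N0 Ny; field; rewrite ?N0 ?Ny.
have := ler_wpM2l (ltW n0) (ln_le u0); move/le_trans; apply.
by rewrite addrC addKr mulrN mulrC divfK// gt_eqF.
Unshelve. all: by end_near. Qed.

(** For c = sqrt n the integrand of [wallis_integral] tends to the Gaussian,
    and stays below it, hence below 1 / (1 + x^2). *)
Lemma wallis : 2 * Num.sqrt n%:R * \prod_(i < n) ((2 * i + 2)%:R / (2 * i + 3)%:R)
  @[n --> \oo] --> (Num.sqrt pi : R).
Proof.
rewrite -Rintegral_gauss.
pose A n : set (measurableTypeR R) := [set` `[- Num.sqrt n%:R, Num.sqrt n%:R]].
pose h n (x : R) : R := (1 - x ^+ 2 / n%:R) ^+ n.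
have ch n : continuous (h n).
  have Dg x : is_derive x 1 (fun x => 1 - x ^+ 2 / n%:R) (- (2 * x / n%:R)).
    by is_derive_ring.
  move=> x; apply: (@continuous_comp _ _ _ (fun x => 1 - x ^+ 2 / n%:R) (fun y => y ^+ n)).
    exact: (is_derive_continuous Dg).
  exact: exprn_continuous.
have bnd n x : A n x -> `|h n x| <= 1 * (1 + x ^+ 2)^-1.
  rewrite /A /= in_itv/= -ler_norml mul1r => xn.
  have xn2 : x ^+ 2 <= n%:R.
    rewrite -[n%:R]sqr_sqrtr ?ler0n// -(real_normK (num_real x)).
    by rewrite ler_pXn2r// nnegrE ?sqrtr_ge0.
  have x20 := sqr_ge0 x.
  have [n0|n0] := posnP n.
    have x0 : x ^+ 2 = 0 by apply/le_anti/andP; split=> //; move: xn2; rewrite n0.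
    by rewrite /h x0 n0 expr0 addr0 invr1 normr1.
  have nR : 0 < n%:R :> R by rewrite ltr0n.
  have u0 : 0 <= 1 - x ^+ 2 / n%:R by rewrite subr_ge0 ler_pdivrMr// mul1r.
  rewrite /h ger0_norm ?exprn_ge0//.
  apply: (@le_trans _ _ (expR (- x ^+ 2))); last first.
    by rewrite expRN lef_pV2 ?posrE ?expR_gt0 ?ltr_wpDr ?expR_ge1Dx.
  have -> : - x ^+ 2 = n%:R * (- (x ^+ 2 / n%:R)).
    by rewrite mulrN mulrC divfK// gt_eqF.
  rewrite expRM_natl lerXn2r ?nnegrE ?expR_ge0//.
  exact: expR_ge1Dx.
apply: (@cvg_eventually _ _ (fun n => \int[mu]_(x in A n) h n x)).
  apply: (@dominated_convergence_moving R A h _ (fun x => 1 * (1 + x ^+ 2)^-1)).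
  - by move=> n; exact: measurable_itv.
  - by move=> n; apply: continuous_measurable_fun; exact: ch.
  - exact: integrable_cauchy.
  - by move=> x; rewrite mul1r invr_ge0 addr_ge0 ?sqr_ge0.
  - move=> x; apply: (cvg_eventually (@cvg_gauss_power x)).
    near=> n; rewrite patchE mem_set// /A /= in_itv/= -ler_norml.
    rewrite -[leLHS]sqrtr_sqr ler_sqrt ?ler0n//.
    by near: n; exact: nbhs_infty_ger.
  - by apply: nearW => n x; exact: bnd.
near=> n; rewrite -wallis_integral; last first.
  by rewrite sqrtr_gt0 ltr0n; near: n; exists 1%N.
by apply: eq_Rintegral => x _; rewrite /h expr_div_n sqr_sqrtr.
Unshelve. all: by end_near. Qed.

Lemma prod_wallisE n :
  (2 * n + 1)%:R * \prod_(i < n) ((2 * i + 2)%:R / (2 * i + 3)%:R) * (2 * n)`!%:R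
  = 4 ^+ n * n`!%:R ^+ 2 :> R.
Proof.
elim: n => [|n IH]; first by rewrite big_ord0 muln0 fact0 expr0 expr1n !mulr1.
rewrite big_ord_recr/= (_ : 2 * n.+1 = (2 * n).+2)%N; last by lia.
rewrite !factS !natrM exprS -[in RHS](natr1 n).
have n3 : (2 * n + 3)%:R != 0 :> R by rewrite pnatr_eq0 addnS.
transitivity ((2 * n + 2)%:R ^+ 2 * (4 ^+ n * n`!%:R ^+ 2) : R).
  rewrite -IH (_ : ((2 * n).+2 + 1 = 2 * n + 3)%N); last by lia.
  rewrite (_ : ((2 * n).+2 = 2 * n + 2)%N); last by lia.
  rewrite (_ : ((2 * n).+1 = 2 * n + 1)%N); last by lia.
  move: (\prod_(_ < _) _) ((2 * n)`!%:R : R) => P F.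
  by field.
by rewrite natrD natrM; ring.
Qed.

Lemma prod_wallis_gt0 n : 0 < \prod_(i < n) ((2 * i + 2)%:R / (2 * i + 3)%:R) :> R.
Proof. by apply: prodr_gt0 => i _; rewrite divr_gt0// ltr0n addnS. Qed.

(** Its limit is half the logarithm of 2 pi; the difference of two consecutive
    values is also the error of the trapezoid rule for the logarithm on
    [n, n + 1], which is how it enters [sum_nlog_asymp]. *)
Definition stirling_error n : R := ln n`!%:R - (n%:R + 2^-1) * ln n%:R + n%:R.

Definition stirling_step n : R := (n%:R + 2^-1) * ln (1 + n%:R^-1) - 1.

Lemma stirling_errorS n : (0 < n)%N ->
  stirling_error n - stirling_error n.+1 = stirling_step n.
Proof.
move=> n0; have nR : 0 < n%:R :> R by rewrite ltr0n.
rewrite /stirling_error /stirling_step factS natrM.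
rewrite lnM ?posrE ?ltr0n ?fact_gt0//.
have -> : 1 + n%:R^-1 = n.+1%:R / n%:R :> R.
  by rewrite -natr1 mulrDl divff ?gt_eqF// mul1r addrC.
rewrite ln_div ?posrE ?ltr0n// -[in X in _ - _ = X]natr1 -!(natr1 n).
by move: (ln _) (ln _) (ln _) => a b c; field.
Qed.

Lemma stirling_step_bounds n : (0 < n)%N ->
  0 <= stirling_step n <= n%:R^-1 - n.+1%:R^-1.
Proof.
move=> n0; have nR : 0 < n%:R :> R by rewrite ltr0n.
set x : R := n%:R^-1; have x0 : 0 < x by rewrite invr_gt0.
have x1 : x <= 1 by rewrite invf_le1// ler1n.
have nE : n%:R = x^-1 by rewrite invrK.
(* the lower Pade bound gives the sign of the step *)
have lo : 2 * x / (2 + x) <= ln (1 + x).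
  rewrite -subr_ge0.
  have /(_ (ltW x0)) := @ge0_derive_le R (fun x => ln (1 + x) - 2 * x / (2 + x))
    (fun x => x ^+ 2 / ((1 + x) * (2 + x) ^+ 2)) 0 x.
  rewrite mulr0 mul0r addr0 ln1 subr0; apply=> y /andP[y0 _].
    have D := @is_derive1_ln R (1 + y) (ltr_pwDl ltr01 y0).
    have y2 : 2 + y != 0 by rewrite gt_eqF// ltr_pwDl.
    have y1 : 1 + y != 0 by rewrite gt_eqF// ltr_pwDl.
    have D2 : is_derive y 1 (fun y : R => 2 + y) 1 by is_derive_ring.
    have D3 := @is_deriveV R (fun y => 2 + y) y 1 1 y2 D2.
    by is_derive_field; rewrite ?y1 ?y2.
  by rewrite divr_ge0 ?sqr_ge0// mulr_ge0 ?sqr_ge0 ?addr_ge0.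
have up : ln (1 + x) <= x - x ^+ 2 / 2 + x ^+ 3 / 3.
  rewrite -subr_ge0.
  have /(_ (ltW x0)) := @ge0_derive_le R
    (fun x => x - x ^+ 2 / 2 + x ^+ 3 / 3 - ln (1 + x)) (fun x => x ^+ 3 / (1 + x)) 0 x.
  rewrite !expr0n !mul0r !addr0 ln1 !subr0; apply=> y /andP[y0 _].
    have D := @is_derive1_ln R (1 + y) (ltr_pwDl ltr01 y0).
    have y1 : 1 + y != 0 by rewrite gt_eqF// ltr_pwDl.
    by is_derive_field; rewrite ?y1.
  by rewrite divr_ge0 ?exprn_ge0 ?addr_ge0.
have xN0 : x != 0 by rewrite gt_eqF.
have x2 : x ^+ 2 <= x by rewrite expr2 ler_piMr// ltW.
have -> : n.+1%:R^-1 = x / (1 + x) :> R.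
  by rewrite -natr1 nE; field; rewrite xN0/= ?gt_eqF ?ltr_pwDl// ltW.
have c0 : 0 <= x^-1 + 2^-1 by rewrite addr_ge0 ?invr_ge0// ltW.
rewrite /stirling_step -/x nE; apply/andP; split.
  rewrite subr_ge0; have := ler_wpM2l c0 lo; apply: le_trans.
  rewrite le_eqVlt; apply/orP; left; apply/eqP; field.
  by rewrite xN0 gt_eqF// ltr_pwDl// ltW.
have := ler_wpM2l c0 up; rewrite -(lerD2r (- 1)) => /le_trans; apply.
have -> : (x^-1 + 2^-1) * (x - x ^+ 2 / 2 + x ^+ 3 / 3) - 1 =
    x ^+ 2 * (1 / 12 + x / 6) by field.
have -> : x - x / (1 + x) = x ^+ 2 * (1 + x)^-1.
  by field; rewrite gt_eqF// ltr_pwDl// ltW.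
rewrite ler_wpM2l ?sqr_ge0//.
rewrite -[leRHS]mul1r ler_pdivlMr ?ltr_pwDl ?(ltW x0)//; nra.
Qed.

(** The errors decrease and are bounded below, hence converge; the limit is
    the one of 2 stirling_error n - stirling_error (2 n), in which everything
    cancels but Wallis' product. *)
Lemma stirling : stirling_error n @[n --> \oo] --> ln (2 * pi) / 2.
Proof.
have cd : cvgn stirling_error.
  have step n : stirling_error n.+1 - stirling_error n.+2 = stirling_step n.+1.
    exact: stirling_errorS.
  have : cvgn (fun n => stirling_error n.+1).
    apply: nonincreasing_is_cvgn.
      apply/nonincreasing_seqP => n; rewrite -subr_ge0 step.
      by have /andP[] := @stirling_step_bounds n.+1 isT.
    exists (stirling_error 1 - 1) => _ [n _ <-].
    have : stirling_error 1 - 1 + n.+1%:R^-1 <= stirling_error n.+1.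
      elim: n => [|n IH]; first by rewrite invr1 subrK.
      have /andP[_] := @stirling_step_bounds n.+1 isT; rewrite -step; move: IH.
      by move: n.+1%:R^-1 n.+2%:R^-1 (stirling_error _) (stirling_error _) => *; lra.
    by apply: le_trans; rewrite lerDl invr_ge0.
  by move=> /cvg_ex[L]; rewrite cvg_shiftS => dL; apply/cvg_ex; exists L.
have [L dL] : exists L : R, stirling_error n @[n --> \oo] --> L by exists (limn stirling_error).
have w1 : (2 * n + 1)%:R * \prod_(i < n) ((2 * i + 2)%:R / (2 * i + 3)%:R) / Num.sqrt n%:R
    @[n --> \oo] --> (Num.sqrt pi : R).
  have c2 : 1 + (2 * n%:R)^-1 @[n --> \oo] --> (1 : R).
    rewrite -[X in _ --> X]addr0; apply: cvgD; first exact: cvg_cst.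
    rewrite (_ : (fun n => _) = (fun n => 2^-1 * n%:R^-1)); last first.
      by apply/funext => n; rewrite invfM.
    by rewrite -[X in _ --> X](mulr0 2^-1); apply: cvgMl_tmp; exact: cvg_inv_natr.
  rewrite -[X in _ --> X]mul1r; apply: (cvg_eventually (cvgM_seq c2 wallis)).
  near=> n; have n0 : 0 < n%:R :> R by rewrite ltr0n; near: n; exists 1%N.
  have s0 : Num.sqrt n%:R != 0 :> R by rewrite gt_eqF// sqrtr_gt0.
  have := sqr_sqrtr (ltW n0); rewrite /= natrD natrM.
  move: (\prod_(_ < _) _) (Num.sqrt _) s0 => P q q0 <-.
  by field.
have e1 : 2 * stirling_error n - stirling_error (2 * n) @[n --> \oo] --> L.
  rewrite [X in _ --> X](_ : L = 2 * L - L); last by ring.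
  apply: cvgB; first exact: cvgMl_tmp.
  apply: (cvg_comp (fun n => 2 * n)%N) dL.
  by apply/cvgnyPge => A; exists A => // n /=; lia.
have e2 : 2 * stirling_error n - stirling_error (2 * n) @[n --> \oo] -->
    (ln (Num.sqrt pi) + ln 2 / 2 : R).
  have pi0 := @pi_gt0 R.
  have s0 : 0 < Num.sqrt pi :> R by rewrite sqrtr_gt0.
  apply: (cvg_eventually (cvgD_seq (cvg_ln_seq s0 w1) (cvg_cst (ln 2 / 2)))).
  near=> n; have n0 : 0 < n%:R :> R by rewrite ltr0n; near: n; exists 1%N.
  have nN : (0 < n)%N by rewrite -(@ltr0n R).
  have s1 : 0 < Num.sqrt n%:R :> R by rewrite sqrtr_gt0.
  have P0 : 0 < (2 * n + 1)%:R * \prod_(i < n) ((2 * i + 2)%:R / (2 * i + 3)%:R) :> R.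
    by rewrite mulr_gt0 ?prod_wallis_gt0// ltr0n addnS.
  have F0 : 0 < (2 * n)`!%:R :> R by rewrite ltr0n fact_gt0.
  have f0 : 0 < n`!%:R :> R by rewrite ltr0n fact_gt0.
  move: (prod_wallisE n) P0; move: (_ * \prod_(_ < _) _) => W /(congr1 (@ln R)) + P0.
  rewrite (lnM (x := W)) ?posrE// lnM ?posrE ?exprn_gt0// !lnXn ?exprn_gt0//.
  rewrite (_ : ln (4 : R) = 2 * ln 2); last first.
    by rewrite (_ : 4 = 2 ^+ 2 :> R) ?lnXn ?mulr_natl//; ring.
  rewrite /= ln_div ?posrE// /stirling_error natrM lnM ?posrE//.
  have -> : ln (Num.sqrt n%:R) = ln n%:R / 2 :> R.
    by rewrite -[in RHS](sqr_sqrtr (ltW n0)) lnXn// -[_ *+ 2]mulr_natl; field.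
  rewrite -[2 * ln 2 *+ n]mulr_natl -[ln _ *+ 2]mulr_natl.
  by move: (ln W) (ln n%:R) (ln n`!%:R) (ln (2 * n)`!%:R) => p l a b; lra.
have := cvg_unique _ e1 e2 => /(_ _) LE.
rewrite (_ : ln (2 * pi) / 2 = L)// LE//.
rewrite lnM ?posrE ?pi_gt0// (_ : ln (Num.sqrt pi) = ln pi / 2).
  by field.
rewrite -[in RHS](sqr_sqrtr (pi_ge0 R)) lnXn ?sqrtr_gt0 ?pi_gt0// -[_ *+ 2]mulr_natl; field.
Unshelve. all: by end_near. Qed.

End Stirling.

(** * The generating product near its singularity *)

Section Polylog.
Context {R : realType}.
Implicit Types (x y a b t : R) (p : nat).

Lemma cvg_cst_seq (c : R) : (c : R) @[_ --> \oo] --> c.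
Proof. exact: cvg_cst. Qed.

Lemma cvg_norm_seq (u : nat -> R) (l : R) :
  u n @[n --> \oo] --> l -> `|u n| @[n --> \oo] --> `|l|.
Proof. by move=> ul; exact: cvg_norm. Qed.

Lemma cvg_of_dist (C : R) (u v : nat -> R) (l : R) :
    v n @[n --> \oo] --> (0 : R) -> (\forall n \near \oo, `|u n - l| <= C * v n) ->
  u n @[n --> \oo] --> l.
Proof.
move=> v0 uv; have := cvgMl_seq (k := C) v0; rewrite mulr0 => Cv.
have h : u n - l @[n --> \oo] --> (0 : R) by exact: squeeze_cvg0 uv Cv.
have := cvgD_seq h (@cvg_cst_seq l); rewrite add0r; move=> /cvg_eventually; apply.
by apply: nearW => n; rewrite subrK.
Qed.

Lemma nbhs_gt0 x : 0 < x -> \forall y \near nbhs x, 0 < y.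
Proof.
move=> x0; apply/nbhs_ballP; exists x => //= y.
by rewrite /ball/= => /ltr_normlP[]; lra.
Qed.

Lemma ler_cvg_seq (u v : nat -> R) (l l' : R) :
    u n @[n --> \oo] --> l -> v n @[n --> \oo] --> l' ->
    (\forall n \near \oo, u n <= v n) -> l <= l'.
Proof. by move=> ul vl' uv; apply: ler_cvg_to uv; [exact: ul|exact: vl']. Qed.

(** The mean of the geometric law of ratio e^-x. *)
Definition bose x : R := (expR x - 1)^-1.

Lemma expR_sub1_gt0 x : 0 < x -> 0 < expR x - 1.
Proof. by move=> x0; rewrite subr_gt0 expR_gt1. Qed.

Lemma bose_gt0 x : 0 < x -> 0 < bose x.
Proof. by move=> x0; rewrite invr_gt0 expR_sub1_gt0. Qed.

Lemma bose_le a b : 0 < a -> a <= b -> bose b <= bose a.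
Proof.
move=> a0 ab; rewrite /bose lef_pV2 ?posrE ?expR_sub1_gt0 ?(lt_le_trans a0)//.
by rewrite lerD2r ler_expR.
Qed.

Lemma one_sub_expRN_gt0 x : 0 < x -> 0 < 1 - expR (- x).
Proof. by move=> x0; rewrite subr_gt0 expR_lt1 oppr_lt0. Qed.

Lemma boseE x : 0 < x -> bose x = expR (- x) / (1 - expR (- x)).
Proof.
move=> x0; rewrite /bose expRN.
have := expR_sub1_gt0 x0; have := expR_gt0 x; move: (expR x) => E E0 E1.
by field; rewrite !gt_eqF// subr_gt0 invf_lt1// -subr_gt0.
Qed.

Lemma bose_pow_le x n : 0 < x -> x ^+ n.+1 * bose x <= n.+1`!%:R.
Proof.
move=> x0; rewrite /bose ler_pdivrMr ?expR_sub1_gt0//.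
have := expR_ge1Dxn n (ltW x0).
have F : 0 < n.+1`!%:R :> R by rewrite ltr0n fact_gt0.
rewrite -lerBrDl ler_pdivrMr//; lra.
Qed.

Lemma bose_le_inv x : 0 < x -> bose x <= x^-1.
Proof.
move=> x0; have := @bose_pow_le x 0 x0; rewrite expr1 -ler_pdivlMl//.
by rewrite (_ : 1`! = 1)%N// mulr1.
Qed.

Lemma bose_var_le x : 0 < x -> x ^+ 2 * (bose x * (1 + bose x)) <= 3.
Proof.
move=> x0; have b0 := bose_gt0 x0.
have h1 := @bose_pow_le x 0 x0; have h2 := @bose_pow_le x 1 x0.
rewrite expr1 in h1; have b1 : 0 <= x * bose x by rewrite mulr_ge0 ?ltW.
have -> : x ^+ 2 * (bose x * (1 + bose x)) = x ^+ 2 * bose x + (x * bose x) ^+ 2 by ring.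
have : (x * bose x) ^+ 2 <= 1 by rewrite expr_le1.
have -> : (3 : R) = 2`!%:R + 1 by rewrite (_ : 2`! = 2)%N//; ring.
by move=> h3; rewrite lerD.
Qed.

(** The hypothesis puts the difference quotients of F between two values of
    - G, so the derivative comes without differentiating a series. *)
Lemma squeeze_is_derive (F G : R -> R) x : 0 < x ->
    (forall a b, 0 < a -> a <= b -> (b - a) * G b <= F a - F b <= (b - a) * G a) ->
    {for x, continuous G} ->
  is_derive x 1 F (- G x).
Proof.
move=> x0 FG cG; apply/is_derive1_caratheodory.
exists (fun z => if z == x then - G x else (F z - F x) / (z - x)); split.
- move=> z; case: eqP => [->|/eqP zx]; first by rewrite !subrr mulr0.
  by rewrite divfK// subr_eq0.
- rewrite /prop_for /continuous_at eqxx.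
  apply/cvgrPdist_le => e e0.
  move/cvgrPdist_le: cG => /(_ e e0) cG.
  near=> z; have z0 : 0 < z by near: z; exact: nbhs_gt0.
  have Gz : `|G x - G z| <= e by near: z.
  case: eqP => [_|/eqP zx]; first by rewrite subrr normr0 ltW.
  apply: le_trans Gz; case: (ltgtP z x) zx => // zx _.
    have := FG _ _ z0 (ltW zx); move: (zx); rewrite -subr_gt0 => xz0.
    rewrite -ler_pdivlMl// -[X in _ && X]ler_pdivrMl//.
    rewrite (_ : (F z - F x) / (z - x) = - ((x - z)^-1 * (F z - F x))); last first.
      by rewrite -(opprB x z) invrN mulrN mulrC.
    move: (_ * (F z - F x)) => D /andP[D1 D2].
    by rewrite opprK addrC ger0_norm ?subr_ge0// ler0_norm ?subr_le0 ?(le_trans D1)//; lra.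
  have := FG _ _ x0 (ltW zx); move: (zx); rewrite -subr_gt0 => xz0.
  rewrite -ler_pdivlMl// -[X in _ && X]ler_pdivrMl//.
  rewrite (_ : (F z - F x) / (z - x) = - ((z - x)^-1 * (F x - F z))); last first.
    by rewrite -(opprB (F x)) mulNr mulrC.
  move: (_ * (F x - F z)) => D /andP[D1 D2].
  by rewrite opprK addrC ler0_norm ?subr_le0// ger0_norm ?subr_ge0 ?(le_trans D1)//; lra.
- by rewrite eqxx.
Unshelve. all: by end_near. Qed.

Definition polylog_term p x k : R := expR (- (k.+1%:R * x)) / k.+1%:R ^+ p.

(** The value of the polylogarithm of order p at e^-x. *)
Definition polylog p x : R := limn (series (polylog_term p x)).

Lemma polylog_term_ge0 p x k : 0 <= polylog_term p x k.
Proof. by rewrite divr_ge0 ?expR_ge0 ?exprn_ge0. Qed.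

Lemma polylog_termS p x k : polylog_term p.+1 x k <= polylog_term p x k.
Proof.
rewrite ler_wpM2l ?expR_ge0// lef_pV2 ?posrE ?exprn_gt0 ?ltr0n//.
by rewrite exprS ler_peMl ?exprn_ge0// ler1n.
Qed.

Lemma polylog0_cvg x : 0 < x -> series (polylog_term 0 x) @ \oo --> bose x.
Proof.
move=> x0; rewrite boseE//.
have := @cvg_geometric_series R (expR (- x)) (expR (- x)).
rewrite ger0_norm ?expR_ge0// expR_lt1 oppr_lt0 => /(_ x0).
rewrite (_ : geometric _ _ = polylog_term 0 x)//; apply/funext => k /=.
by rewrite /polylog_term expr0 divr1 -exprS -mulrN expRM_natl.
Qed.

Lemma is_cvg_polylog p x : 0 < x -> cvgn (series (polylog_term p x)).
Proof.
move=> x0; elim: p => [|p IH]; first by apply/cvg_ex; exists (bose x); exact: polylog0_cvg.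
by apply: series_le_cvg IH => k; [exact: polylog_term_ge0|exact: polylog_term_ge0|exact: polylog_termS].
Qed.

Lemma polylogS_le p x : 0 < x -> polylog p.+1 x <= polylog p x.
Proof.
by move=> x0; apply: lim_series_le; [exact: is_cvg_polylog..|exact: polylog_termS].
Qed.

Lemma polylog_ge0 p x : 0 < x -> 0 <= polylog p x.
Proof.
move=> x0; apply: limr_ge; first exact: is_cvg_polylog.
by apply: nearW => n; apply: sumr_ge0 => k _; exact: polylog_term_ge0.
Qed.

Lemma polylog0E x : 0 < x -> polylog 0 x = bose x.
Proof. by move=> x0; apply/cvg_lim => //; exact: polylog0_cvg. Qed.

Lemma polylog_le_bose p x : 0 < x -> polylog p x <= bose x.
Proof.
move=> x0; rewrite -polylog0E//; elim: p => // p; apply: le_trans.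
exact: polylogS_le.
Qed.

(** Termwise, this is the tangent line inequality for the exponential at
    both ends. *)
Lemma polylog_squeeze p a b : 0 < a -> a <= b ->
  (b - a) * polylog p b <= polylog p.+1 a - polylog p.+1 b <= (b - a) * polylog p a.
Proof.
move=> a0 ab; have b0 := lt_le_trans a0 ab.
pose T q x n := series (polylog_term q x) n.
have TB q x : 0 < x -> T q x n @[n --> \oo] --> polylog q x.
  by move=> x0; exact: is_cvg_polylog.
have D : T p.+1 a n - T p.+1 b n @[n --> \oo] --> polylog p.+1 a - polylog p.+1 b.
  by apply: cvgB_seq; exact: TB.
have ineq n : (b - a) * T p b n <= T p.+1 a n - T p.+1 b n <= (b - a) * T p a n.
  rewrite /T /series/= -sumrB !mulr_sumr.
  have term k : (b - a) * polylog_term p b k <=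
      polylog_term p.+1 a k - polylog_term p.+1 b k <= (b - a) * polylog_term p a k.
    rewrite /polylog_term exprS; set c : R := k.+1%:R.
    have c0 : 0 < c by rewrite ltr0n.
    have cp : 0 < c ^+ p by rewrite exprn_gt0.
    rewrite invfM !mulrA -mulrBl -mulrBl !ler_pM2r ?invr_gt0//.
    rewrite ler_pdivlMr// ler_pdivrMr//.
    have e1 : expR (- (c * a)) = expR (- (c * b)) * expR (c * (b - a)).
      by rewrite -expRD; congr expR; ring.
    have e2 : expR (- (c * b)) = expR (- (c * a)) * expR (- (c * (b - a))).
      by rewrite -expRD; congr expR; ring.
    apply/andP; split.
      rewrite e1; have := expR_ge1Dx (c * (b - a)).
      have := expR_gt0 (- (c * b)); nra.
    rewrite [X in _ - X]e2; have := expR_ge1Dx (- (c * (b - a))).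
    have := expR_gt0 (- (c * a)); nra.
  by apply/andP; split; apply: ler_sum => k _; have /andP[] := term k.
apply/andP; split.
- apply: (ler_cvg_seq (cvgMl_seq (TB p b b0)) D).
  by apply: nearW => n; have /andP[] := ineq n.
- apply: (ler_cvg_seq D (cvgMl_seq (TB p a a0))).
  by apply: nearW => n; have /andP[] := ineq n.
Qed.

(** Minus the logarithm of 1 - e^-x: the contribution of one part to the
    logarithm of the generating product. *)
Definition nlog x : R := - ln (1 - expR (- x)).

Lemma nlog_is_derive x : 0 < x -> is_derive x 1 nlog (- bose x).
Proof.
move=> x0; have o0 := one_sub_expRN_gt0 x0.
have D := @is_derive1_ln R (1 - expR (- x)) o0.
rewrite boseE// /nlog; is_derive_field; exact: lt0r_neq0.
Qed.

Lemma bose_continuous x : 0 < x -> {for x, continuous bose}.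
Proof.
move=> x0; apply: cvgV; first by rewrite gt_eqF// expR_sub1_gt0.
by apply: cvgB; [exact: continuous_expR|exact: cvg_cst].
Qed.

Lemma nlog_ge0 x : 0 < x -> 0 <= nlog x.
Proof.
move=> x0; rewrite oppr_ge0 ln_le0// lerBlDr lerDl expR_ge0//.
Qed.

Lemma nlog_le_bose x : 0 < x -> nlog x <= bose x.
Proof.
move=> x0; have o0 := one_sub_expRN_gt0 x0.
rewrite /nlog lerNl; apply: le_trans (ln_geV o0).
rewrite boseE//; move: o0; move: (expR _) => q q0.
rewrite le_eqVlt; apply/orP; left; apply/eqP; field; exact: lt0r_neq0.
Qed.

Lemma continuous_for_eq_gt0 (F G : R -> R) x : 0 < x ->
  (forall y, 0 < y -> F y = G y) -> {for x, continuous G} -> {for x, continuous F}.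
Proof.
move=> x0 FG cG; rewrite /prop_for /continuous_at FG//.
apply: cvg_trans cG; apply: near_eq_cvg.
by near=> z; rewrite FG//; near: z; exact: nbhs_gt0.
Unshelve. all: by end_near. Qed.

(** Both sides have derivative - bose, by [polylog_squeeze] for the series,
    and both tend to 0 at infinity. *)
Lemma polylog1E x : 0 < x -> polylog 1 x = nlog x.
Proof.
move=> x0.
have D1 y : 0 < y -> is_derive y 1 (polylog 1) (- bose y).
  move=> y0; rewrite -polylog0E//; apply: squeeze_is_derive => //.
    by move=> a b a0 ab; exact: polylog_squeeze.
  by apply: (continuous_for_eq_gt0 y0 polylog0E); exact: bose_continuous.
(* h is constant, and both functions vanish at infinity *)
pose h y := polylog 1 y - nlog y.
have hb y : 0 < y -> `|h y| <= y^-1.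
  move=> y0; have := polylog_ge0 1 y0; have := polylog_le_bose 1 y0.
  have := nlog_ge0 y0; have := nlog_le_bose y0; have := bose_le_inv y0.
  by rewrite ler_norml /h => *; apply/andP; split; lra.
have hc y : x <= y -> h y = h x.
  move=> xy; have [z xzy|c _] := @mean_value R h (fun=> 0) x y xy; last first.
    by rewrite mul0r => /eqP; rewrite subr_eq0 => /eqP.
  have z0 : 0 < z by case/andP: xzy => xz _; exact: lt_le_trans xz.
  have := @is_deriveB R R R (polylog 1) nlog z 1 _ _ (D1 z z0) (nlog_is_derive z0).
  by rewrite subrr.
apply/eqP; rewrite -subr_eq0 -normr_le0 -/(h x); apply/ler_addgt0Pr => e e0.
rewrite add0r; pose y := Num.max x e^-1.
rewrite -(hc y) ?le_max ?lexx//; apply: le_trans (hb y _) _.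
  by rewrite lt_max x0.
by rewrite -[e]invrK lef_pV2 ?posrE ?invr_gt0 ?lt_max ?x0// le_max lexx orbT.
Qed.

Lemma nlog_squeeze a b : 0 < a -> a <= b ->
  (b - a) * bose b <= nlog a - nlog b <= (b - a) * bose a.
Proof.
move=> a0 ab; have b0 := lt_le_trans a0 ab.
by rewrite -!polylog1E// -!polylog0E// polylog_squeeze.
Qed.

Definition dilog x := polylog 2 x.

Lemma dilog_squeeze a b : 0 < a -> a <= b ->
  (b - a) * nlog b <= dilog a - dilog b <= (b - a) * nlog a.
Proof.
move=> a0 ab; have b0 := lt_le_trans a0 ab.
by rewrite -!polylog1E// polylog_squeeze.
Qed.

Lemma nlog_continuous x : 0 < x -> {for x, continuous nlog}.
Proof.
move=> x0; have [D _] := nlog_is_derive x0.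
by apply: differentiable_continuous; exact/derivable1_diffP.
Qed.

Lemma dilog_is_derive x : 0 < x -> is_derive x 1 dilog (- nlog x).
Proof.
move=> x0; apply: squeeze_is_derive => //; last exact: nlog_continuous.
exact: dilog_squeeze.
Qed.

Lemma dilog_le x : 0 < x -> dilog x <= pi ^+ 2 / 6.
Proof.
move=> x0; have cb := @basel R.
apply: (ler_cvg_seq (is_cvg_polylog x0 (p := 2)) cb).
apply: nearW => n; apply: ler_sum => k _; rewrite ler_piMl ?invr_ge0 ?exprn_ge0//.
by rewrite expR_le1 oppr_le0 mulr_ge0// ltW.
Qed.

(** Finitely many terms of the Basel sum suffice up to e / 2, and each of
    them is continuous at 0. *)
Lemma dilog_ge_near0 (e : R) : 0 < e ->
  exists2 d : R, 0 < d & forall x, 0 < x <= d -> pi ^+ 2 / 6 - e <= dilog x.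
Proof.
move=> e0; have := @basel R => /cvgrPdist_le/(_ (e / 2)).
rewrite divr_gt0// => /(_ isT)[N _ /(_ N (leqnn N))/=].
move=> /ler_normlP[_]; set B := series _ N => BN.
exists (e / 2 / N.+1%:R); first by rewrite !divr_gt0.
move=> x /andP[x0 xd].
have le1 : series (polylog_term 2 x) N <= dilog x.
  apply: nondecreasing_cvgn_le; last exact: is_cvg_polylog.
  apply/nondecreasing_seqP => n; rewrite seriesSr lerDl; exact: polylog_term_ge0.
apply: le_trans le1.
have le2 : B - N%:R * x <= series (polylog_term 2 x) N.
  have -> : N%:R * x = \sum_(0 <= k < N) x by rewrite sumr_const_nat subn0 mulr_natl.
  rewrite /B /series/= -sumrB; apply: ler_sum => k _.
  rewrite /polylog_term; have c1 : 1 <= k.+1%:R :> R by rewrite ler1n.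
  have c2 : 0 < k.+1%:R ^+ 2 :> R by rewrite exprn_gt0.
  rewrite ler_pdivlMr// mulrBl mulVf ?gt_eqF//.
  have := expR_ge1Dx (- (k.+1%:R * x)); move: (k.+1%:R : R) c1 c2 => c c1 c2.
  have : c * x <= x * c ^+ 2.
    by rewrite (mulrC c) ler_pM2l// expr2 ler_peMl//; lra.
  lra.
have : N%:R * x <= e / 2.
  move: xd; rewrite ler_pdivlMr// -natr1; have : 0 <= N%:R :> R by []; nra.
lra.
Qed.

(** nlog x + ln x is minus the logarithm of (1 - e^-x) / x, which lies
    between 1 - x / 2 and 1. *)
Lemma nlog_ln_bounds x : 0 < x <= 1 -> 0 <= nlog x + ln x <= x.
Proof.
move=> /andP[x0 x1]; have o0 := one_sub_expRN_gt0 x0.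
have -> : nlog x + ln x = - ln ((1 - expR (- x)) / x).
  by rewrite ln_div ?posrE// /nlog; ring.
rewrite oppr_ge0 lerNl; apply/andP; split.
  by apply: ln_le0; rewrite ler_pdivrMr// mul1r; have := expR_ge1Dx (- x); lra.
have q0 : 0 < (1 - expR (- x)) / x by rewrite divr_gt0.
have x2 : 0 < 1 - x / 2 by lra.
have le1 : 1 - x / 2 <= (1 - expR (- x)) / x.
  by rewrite ler_pdivlMr//; have := expRN_le1B (ltW x0); lra.
apply: (@le_trans _ _ (ln (1 - x / 2))); last by rewrite ler_ln ?posrE.
apply: le_trans (ln_geV x2).
rewrite -subr_ge0 (_ : _ - _ = x * (1 - x) / (2 * (1 - x / 2))).
  by rewrite divr_ge0 ?mulr_ge0 ?(ltW x0) ?(ltW x2)// subr_ge0.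
field; lra.
Qed.

(** The middle term has derivative - (nlog + ln), of size at most x by
    [nlog_ln_bounds], and tends to pi^2 / 6 at 0. *)
Lemma dilog_near0 x : 0 < x <= 1 ->
  pi ^+ 2 / 6 - x ^+ 2 <= dilog x - x * ln x + x <= pi ^+ 2 / 6.
Proof.
move=> /andP[x0 x1]; pose q y := dilog y - y * ln y + y.
have Dq y : 0 < y -> is_derive y 1 q (- (nlog y + ln y)).
  move=> y0; have D1 := dilog_is_derive y0; have D2 := is_derive1_ln y0.
  by is_derive_field; rewrite gt_eqF.
have dq y : 0 < y -> y <= x -> - x ^+ 2 <= q x - q y <= 0.
  move=> y0 yx; have [|c /andP[yc cx] ->] := @mean_value R q (fun y => - (nlog y + ln y)) y x yx.
    by move=> z /andP[yz _]; apply: Dq; exact: lt_le_trans yz.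
  have /nlog_ln_bounds/andP[n0 nc] : 0 < c <= 1 by rewrite (lt_le_trans y0)// (le_trans cx).
  by apply/andP; split; nra.
(* evaluated at d^2, so that ln d <= 1 / d is enough to see the limit *)
have small (d : R) : 0 < d <= 1 -> 0 <= - (d ^+ 2 * ln (d ^+ 2)) + d ^+ 2 <= 3 * d.
  move=> /andP[d0 d1]; rewrite lnXn// -[ln d *+ 2]mulr_natl.
  have := @ln_le R d^-1; rewrite invr_gt0 lnV ?posrE// => /(_ d0) h1.
  have h2 := ln_le0 d1.
  have h3 : d * d^-1 = 1 by rewrite divff ?gt_eqF.
  by apply/andP; split; nra.
have pick (e : R) : 0 < e -> exists2 d : R, 0 < d <= 1 & d <= x /\ d <= e.
  move=> e0; exists (Num.min x e).
    by rewrite lt_min x0 e0 ge_min x1.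
  by rewrite !ge_min !lexx orbT.
rewrite -/(q x); apply/andP; split; apply/ler_addgt0Pr => e e0.
  have [d d0 dil] := dilog_ge_near0 e0.
  have [c /andP[c0 c1] [cx cd]] := pick _ d0.
  have c20 : 0 < c ^+ 2 by rewrite exprn_gt0.
  have c2c : c ^+ 2 <= c by rewrite expr2 ler_piMr// ltW.
  have /andP[h1 _] := dq _ c20 (le_trans c2c cx).
  have := dil (c ^+ 2); rewrite c20 (le_trans c2c cd) => /(_ isT).
  have /andP[h2 _] : 0 <= - (c ^+ 2 * ln (c ^+ 2)) + c ^+ 2 <= 3 * c by apply: small; rewrite c0.
  move: h1; rewrite {2}/q; lra.
have e3 : 0 < e / 3 by rewrite divr_gt0.
have [c /andP[c0 c1] [cx ce]] := pick _ e3.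
have c20 : 0 < c ^+ 2 by rewrite exprn_gt0.
have c2c : c ^+ 2 <= c by rewrite expr2 ler_piMr// ltW.
have /andP[_ h1] := dq _ c20 (le_trans c2c cx).
have /andP[_ h2] : 0 <= - (c ^+ 2 * ln (c ^+ 2)) + c ^+ 2 <= 3 * c by apply: small; rewrite c0.
have := dilog_le c20; move: h1; rewrite {2}/q; lra.
Qed.

Lemma bose_sub_le a b : 0 < a -> a <= b -> bose a - bose b <= (b - a) * (3 / a ^+ 2).
Proof.
move=> a0 ab; have b0 := lt_le_trans a0 ab.
have ba := bose_le a0 ab; have ba0 := bose_gt0 a0; have bb0 := bose_gt0 b0.
have eb : expR b * bose b = 1 + bose b.
  by rewrite /bose; field; rewrite gt_eqF// expR_sub1_gt0.
have -> : bose a - bose b = (expR b - expR a) * bose b * bose a.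
  by rewrite /bose; field; rewrite !gt_eqF// expR_sub1_gt0.
have e1 : expR b - expR a <= (b - a) * expR b.
  have -> : expR a = expR b * expR (- (b - a)) by rewrite -expRD; congr expR; ring.
  by have := expR_ge1Dx (- (b - a)); have := expR_gt0 b; nra.
apply: (@le_trans _ _ ((b - a) * (bose a * (1 + bose a)))).
  apply: (@le_trans _ _ ((b - a) * expR b * bose b * bose a)).
    by rewrite !ler_wpM2r// ltW.
  rewrite -mulrA -mulrA ler_wpM2l ?subr_ge0// mulrA eb mulrC ler_wpM2l ?(ltW ba0)//.
  by rewrite lerD2l.
rewrite ler_wpM2l ?subr_ge0// ler_pdivlMr ?exprn_gt0// mulrC; exact: bose_var_le.
Qed.

(** The middle term is the error of the trapezoid rule for nlog on [a, b],
    dilog being minus a primitive of nlog. It is at most the variation of the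
    derivative bose, times the square of the length. *)
Lemma dilog_trapezoid a b : 0 < a -> a <= b ->
  0 <= (b - a) / 2 * (nlog a + nlog b) - (dilog a - dilog b)
    <= 3 / 2 * (b - a) ^+ 3 / a ^+ 2.
Proof.
move=> a0 ab.
pose T y := (y - a) / 2 * (nlog a + nlog y) - (dilog a - dilog y).
pose dT y := 2^-1 * (nlog a - nlog y) - 2^-1 * ((y - a) * bose y).
have DT y : a <= y <= b -> is_derive y 1 T (dT y).
  move=> /andP[ay _]; have y0 := lt_le_trans a0 ay.
  have D1 := dilog_is_derive y0; have D2 := nlog_is_derive y0.
  by rewrite /dT; is_derive_field.
have [c /andP[ac cb]] := mean_value ab DT.
rewrite {2}/T !subrr !mul0r subrr subr0 -/(T b) => ->.
have /andP[s1 s2] := nlog_squeeze a0 ac.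
have s3 := bose_sub_le a0 ac.
have i0 : 0 < 3 / a ^+ 2 by rewrite divr_gt0 ?exprn_gt0.
have d0 : 0 <= dT c by rewrite /dT; lra.
rewrite (mulr_ge0 d0) ?subr_ge0//=.
have d1 : dT c <= 2^-1 * ((b - a) ^+ 2 * (3 / a ^+ 2)).
  apply: (@le_trans _ _ (2^-1 * ((c - a) * (bose a - bose c)))); first by rewrite /dT; lra.
  rewrite ler_pM2l// expr2 -mulrA; apply: ler_pM; rewrite ?subr_ge0 ?bose_le//.
    by rewrite lerD2r.
  by apply: (le_trans s3); rewrite ler_pM2r// lerD2r.
rewrite (_ : 3 / 2 * _ / _ = 2^-1 * ((b - a) ^+ 2 * (3 / a ^+ 2)) * (b - a)).
  by rewrite ler_wpM2r// subr_ge0.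
by field; rewrite gt_eqF.
Qed.

(** Beyond a fixed index N both sums are below a tail of the series of g; up
    to N there are finitely many limits. *)
Lemma tannery (D : nat -> nat -> R) (e g : nat -> R) (l : R) :
    (forall k, D n k @[n --> \oo] --> e k) ->
    (\forall n \near \oo, forall k, `|D n k| <= g k) ->
    cvgn (series g) -> series e @ \oo --> l ->
  \sum_(0 <= k < n) D n k @[n --> \oo] --> l.
Proof.
move=> De Dg cg el.
have eg k : `|e k| <= g k.
  have ce := cvg_norm_seq (De k).
  by apply: (ler_cvg_seq ce (@cvg_cst_seq (g k))); apply: filterS Dg => n; exact.
suff d0 : \sum_(0 <= k < n) (D n k - e k) @[n --> \oo] --> (0 : R).
  have := cvgD_seq d0 el; rewrite add0r; move=> /cvg_eventually; apply.
  by apply: nearW => n /=; rewrite /series/= sumrB subrK.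
have g0 k : 0 <= g k by apply: le_trans (eg k); exact: normr_ge0.
apply/cvgr0Pnorm_le => eps eps0.
have e3 : 0 < eps / 3 by rewrite divr_gt0.
have [N _ gN] : exists2 N, True & forall n, (N <= n)%N -> \sum_(N <= k < n) g k <= eps / 3.
  move/cvgrPdist_le: (cg) => /(_ _ e3)[N _ hN]; exists N => // n Nn.
  have := hN N (leqnn N); rewrite -sub_series_geq//.
  have : series g n <= limn (series g).
    apply: nondecreasing_cvgn_le cg _.
    by apply/nondecreasing_seqP => m; rewrite seriesSr lerDl.
  move=> h /ler_normlP[_]; move: h.
  by move: (series g n) (series g N) (limn _) => *; lra.
have fin : \sum_(0 <= k < N) `|D n k - e k| @[n --> \oo] --> (0 : R).
  elim: (N) => [|M IH].
    by apply: (cvg_eventually (@cvg_cst_seq 0)); apply: nearW => n; rewrite big_geq.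
  have h := cvg_norm_seq (cvgB_seq (De M) (@cvg_cst_seq (e M))).
  rewrite subrr normr0 in h; have := cvgD_seq IH h; rewrite addr0.
  by move=> /cvg_eventually; apply; apply: nearW => n; rewrite big_nat_recr.
move/cvgr0Pnorm_le: fin => /(_ _ e3) fin.
near=> n; have Nn : (N <= n)%N by near: n; exists N.
have Dn : forall k, `|D n k| <= g k by near: n.
have fn : `|\sum_(0 <= k < N) `|D n k - e k| | <= eps / 3 by near: n.
rewrite (@big_cat_nat _ _ _ N)//=; apply: le_trans (ler_normD _ _) _.
apply: (@le_trans _ _ (eps / 3 + (eps / 3 + eps / 3))); last by lra.
apply: lerD.
  by apply: le_trans fn; apply: le_trans (ler_norm _); exact: ler_norm_sum.
apply: le_trans (ler_norm_sum _ _ _) _.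
apply: (@le_trans _ _ (\sum_(N <= k < n) (g k + g k))).
  by apply: ler_sum => k _; apply: le_trans (ler_normB _ _) _; rewrite lerD.
by rewrite big_split lerD// gN.
Unshelve. all: by end_near. Qed.

(** The error of the trapezoid rule for nlog on the cell number k of mesh t,
    divided by t. *)
Definition trap_error t k : R :=
  2^-1 * (nlog (k.+1%:R * t) + nlog (k.+2%:R * t))
  - (dilog (k.+1%:R * t) - dilog (k.+2%:R * t)) / t.

Lemma trap_error_bounds t k : 0 < t -> 0 <= trap_error t k <= 3 / 2 * (k.+1%:R ^+ 2)^-1.
Proof.
move=> t0; have k0 : 0 < k.+1%:R :> R by rewrite ltr0n.
have a0 : 0 < k.+1%:R * t by rewrite mulr_gt0.
have ab : k.+1%:R * t <= k.+2%:R * t by rewrite ler_pM2r// ler_nat.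
have := dilog_trapezoid a0 ab.
have -> : k.+2%:R * t - k.+1%:R * t = t by rewrite -mulrBl -natrB// subSnn mul1r.
have -> : t / 2 * (nlog (k.+1%:R * t) + nlog (k.+2%:R * t)) -
    (dilog (k.+1%:R * t) - dilog (k.+2%:R * t)) = t * trap_error t k.
  by rewrite /trap_error; field; rewrite gt_eqF.
have -> : 3 / 2 * t ^+ 3 / (k.+1%:R * t) ^+ 2 = t * (3 / 2 * (k.+1%:R ^+ 2)^-1).
  by field; rewrite !gt_eqF.
by rewrite pmulr_rge0// ler_pM2l.
Qed.

(** The trapezoid rule over t, 2 t, ..., (n + 1) t: the integrals telescope and
    the end points carry half a term. *)
Lemma sum_nlogE t n : 0 < t ->
  \sum_(0 <= k < n.+1) nlog (k.+1%:R * t) =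
  dilog t / t - dilog (n.+1%:R * t) / t + 2^-1 * nlog t + 2^-1 * nlog (n.+1%:R * t)
  + \sum_(0 <= k < n) trap_error t k.
Proof.
move=> t0; elim: n => [|n IH].
  by rewrite big_nat1 big_geq// !mul1r; field; rewrite gt_eqF.
rewrite big_nat_recr// IH/= [in RHS]big_nat_recr//= /trap_error.
by field; rewrite gt_eqF.
Qed.

(** Near 0 the function nlog is - ln up to O(x). For - ln the error on the
    cell k does not depend on the mesh, because the rule is exact on constants
    and a dilation adds a constant to ln: it is stirling_step. *)
Lemma trap_error_near0 t k : 0 < t -> k.+2%:R * t <= 1 ->
  `|trap_error t k - (stirling_step k.+1 : R)| <= 2 * k.+2%:R ^+ 2 * t.
Proof.
move=> t0; set a : R := k.+1%:R; have a1 : 1 <= a by rewrite ler1n.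
have -> : k.+2%:R = a + 1 by rewrite natr1.
move=> t1; have a0 : 0 < a by lra.
have at0 : 0 < a * t by rewrite mulr_gt0.
have at1 : a * t <= 1 by nra.
have bt0 : 0 < (a + 1) * t by rewrite mulr_gt0//; lra.
have /nlog_ln_bounds : 0 < a * t <= 1 by rewrite at0.
have /nlog_ln_bounds : 0 < (a + 1) * t <= 1 by rewrite bt0.
have /dilog_near0 : 0 < a * t <= 1 by rewrite at0.
have /dilog_near0 : 0 < (a + 1) * t <= 1 by rewrite bt0.
rewrite /trap_error -/a -[k.+2%:R]natr1 -/a.
have -> : stirling_step k.+1 = (a + 2^-1) * (ln (a + 1) - ln a) - 1.
  rewrite /stirling_step -/a -ln_div ?posrE//; last by lra.
  by rewrite [(a + 1) / a]mulrDl divff ?gt_eqF// mul1r.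
have la : ln (a * t) = ln a + ln t by rewrite lnM ?posrE.
have lb : ln ((a + 1) * t) = ln (a + 1) + ln t by rewrite lnM ?posrE//; lra.
rewrite la lb; set da := dilog (a * t); set db := dilog _.
move: (nlog _) (nlog _) => na nb.
set qa := da - _ + _; set qb := db - _ + _ => /andP[b1 b2] /andP[a2 a3] /andP[b4 b5] /andP[a4 a5].
have -> : 2^-1 * (na + nb) - (da - db) / t - ((a + 2^-1) * (ln (a + 1) - ln a) - 1) =
    2^-1 * ((na + (ln a + ln t)) + (nb + (ln (a + 1) + ln t))) - (qa - qb) / t.
  by rewrite /qa /qb; field; rewrite gt_eqF.
have q1 : `|(qa - qb) / t| <= (a + 1) ^+ 2 * t.
  rewrite normrM [X in _ * X]gtr0_norm ?invr_gt0// ler_pdivrMr//.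
  have : (a * t) ^+ 2 <= ((a + 1) * t) ^+ 2.
    by rewrite ler_pXn2r ?nnegrE ?ltW// ltr_pM2r// ltrDl.
  rewrite (_ : (a + 1) ^+ 2 * t * t = ((a + 1) * t) ^+ 2); last by ring.
  by rewrite ler_norml => ?; apply/andP; split; lra.
apply: le_trans (ler_normB _ _) _.
have -> : 2 * (a + 1) ^+ 2 * t = (a + 1) ^+ 2 * t + (a + 1) ^+ 2 * t by ring.
apply: lerD => //.
rewrite ger0_norm; last by rewrite mulr_ge0// addr_ge0.
apply: (@le_trans _ _ ((a + 1) * t)); first by nra.
by rewrite ler_pM2r// expr2 ler_peMl; lra.
Qed.

Lemma cvg_series_stirling_step :
  series (fun k => stirling_step k.+1 : R) @ \oo --> 1 - ln (2 * pi) / 2.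
Proof.
have /(_ R) := @stirling; rewrite -cvg_shiftS => st.
have := cvgB_seq (@cvg_cst_seq 1) st; move=> /cvg_eventually; apply; apply: nearW => n.
elim: n => [|n IH].
  by rewrite /series/= big_geq// /stirling_error (_ : 1`! = 1)%N// ln1 mulr0 subr0 add0r subrr.
by rewrite big_nat_recr//= IH -stirling_errorS//; ring.
Qed.

(** Expansion at 0 of the logarithm of the generating product. By
    [sum_nlogE] the main term is the dilogarithm at 0, and the constant comes
    from the trapezoid errors, summed by [tannery] to Stirling's constant. The
    last hypothesis makes the truncation at n harmless. *)
Lemma sum_nlog_asymp (t : nat -> R) :
    (\forall n \near \oo, 0 < t n) -> t n @[n --> \oo] --> (0 : R) ->
    (n%:R ^+ 2 * t n ^+ 3)^-1 @[n --> \oo] --> (0 : R) ->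
  \sum_(0 <= k < n) nlog (k.+1%:R * t n) - pi ^+ 2 / 6 / t n - 2^-1 * ln (t n)
    @[n --> \oo] --> - (ln (2 * pi) / 2).
Proof.
move=> tpos t0 tn.
have tle (c : R) : 0 < c -> \forall n \near \oo, t n <= c.
  by move=> c0; move/cvgr0Pnorm_le: t0 => /(_ _ c0); apply: filterS => n; exact: le_trans (ler_norm _).
rewrite -cvg_shiftS.
have tpos' : \forall n \near \oo, 0 < t n.+1.
  by case: tpos => N _ h; exists N => // n /= Nn; apply: h => /=; exact: leqW.
have tle' (c : R) : 0 < c -> \forall n \near \oo, t n.+1 <= c.
  by move=> /tle[N _ h]; exists N => // n /= Nn; apply: h => /=; exact: leqW.
have E : \sum_(0 <= k < n) trap_error (t n.+1) k @[n --> \oo] --> 1 - ln (2 * pi) / 2.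
  apply: (@tannery _ _ (fun k => 3 / 2 * (k.+1%:R ^+ 2)^-1) _ _ _ _ cvg_series_stirling_step).
  - move=> k; apply: (@cvg_of_dist (2 * k.+2%:R ^+ 2) _ (fun n => t n.+1)).
      by rewrite cvg_shiftS.
    have k0 : 0 < k.+2%:R^-1 :> R by rewrite invr_gt0 ltr0n.
    near=> n; apply: trap_error_near0; first by near: n.
    rewrite -ler_pdivlMl ?ltr0n// mulr1; near: n; exact: tle'.
  - apply: filterS tpos' => n tn0 k; have /andP[b0 b1] := trap_error_bounds k tn0.
    by rewrite ger0_norm.
  - apply/cvg_ex; exists (3 / 2 * (pi ^+ 2 / 6)).
    apply: (cvg_eventually (cvgMl_seq (k := 3 / 2) (@basel R))).
    by apply: nearW => n; rewrite /series/= mulr_sumr.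
(* what is left: the errors of dilog and nlog at t, of order t, and the
   boundary terms at (n + 1) t, of order 1 / (n^2 t^3) *)
pose rem n := \sum_(0 <= k < n.+1) nlog (k.+1%:R * t n.+1) - pi ^+ 2 / 6 / t n.+1
  - 2^-1 * ln (t n.+1) - (\sum_(0 <= k < n) trap_error (t n.+1) k - 1).
have r0 : rem n @[n --> \oo] --> (0 : R).
  pose v n := 2 * t n.+1 + 4 * (n.+1%:R ^+ 2 * t n.+1 ^+ 3)^-1.
  have v0 : v n @[n --> \oo] --> (0 : R).
    rewrite -cvg_shiftS in t0; rewrite -cvg_shiftS in tn.
    by have := cvgD_seq (cvgMl_seq (k := 2) t0) (cvgMl_seq (k := 4) tn); rewrite !mulr0 addr0.
  apply: squeeze_cvg0 v0; near=> n.
  have h0 : 0 < t n.+1 by near: n.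
  have h1 : t n.+1 <= 1 by near: n; exact: tle'.
  rewrite /v /rem sum_nlogE//; move: (\sum_(0 <= k < n) trap_error (t n.+1) k) => S.
  move: (t n.+1) h0 h1 => x h0 h1.
  have n0 : 0 < n.+1%:R :> R by rewrite ltr0n.
  have nx0 : 0 < n.+1%:R * x by rewrite mulr_gt0.
  have x01 : 0 < x <= 1 by rewrite h0.
  have /andP[b1 b2] := nlog_ln_bounds x01.
  have /andP[c1 c2] := dilog_near0 x01.
  have d1 := nlog_ge0 nx0; have d2 := nlog_le_bose nx0.
  have d3 := polylog_ge0 2 nx0; have d4 := polylog_le_bose 2 nx0.
  have d5 := @bose_pow_le _ 1 nx0.
  set B := bose _ in d2 d4 d5; set na := nlog (n.+1%:R * x) in d1 d2 *.
  rewrite -/(dilog _) in d3 d4; set da := dilog (n.+1%:R * x) in d3 d4 *.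
  have -> : dilog x / x - da / x + 2^-1 * nlog x + 2^-1 * na + S - pi ^+ 2 / 6 / x
      - 2^-1 * ln x - (S - 1) =
      (dilog x - x * ln x + x - pi ^+ 2 / 6) / x + 2^-1 * (nlog x + ln x)
      + (2^-1 * na - da / x) by field; rewrite gt_eqF.
  set q := dilog x - _ + _ in c1 c2 *.
  have e1 : `|(q - pi ^+ 2 / 6) / x| <= x.
    rewrite normrM [X in _ * X]gtr0_norm ?invr_gt0// ler_pdivrMr// -expr2.
    by rewrite ler0_norm ?subr_le0//; lra.
  have e2 : `|2^-1 * (nlog x + ln x)| <= x by rewrite ger0_norm ?mulr_ge0//; lra.
  have B0 : 0 <= B by exact: le_trans d2.
  have BB : B / x <= 2 * (n.+1%:R ^+ 2 * x ^+ 3)^-1.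
    rewrite ler_pdivrMr// -mulrA (_ : (n.+1%:R ^+ 2 * x ^+ 3)^-1 * x = ((n.+1%:R * x) ^+ 2)^-1); last first.
      by field; rewrite !gt_eqF.
    by rewrite ler_pdivlMr ?exprn_gt0// mulrC; apply: le_trans d5 _; rewrite (_ : 2`! = 2)%N.
  have Bx : B <= B / x by rewrite ler_peMr// invf_ge1.
  have e3 : `|2^-1 * na - da / x| <= 4 * (n.+1%:R ^+ 2 * x ^+ 3)^-1.
    have dx : da / x <= B / x by rewrite ler_pM2r// invr_gt0.
    have dx0 : 0 <= da / x by rewrite divr_ge0// ltW.
    move: (B / x) (da / x) (_ ^+ 2 * _)^-1 BB Bx dx dx0 => u w I BB Bx dx dx0.
    by rewrite ler_norml; apply/andP; split; lra.
  apply: le_trans (ler_normD _ _) _; apply: lerD => //.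
  by apply: le_trans (ler_normD _ _) _; lra.
have := cvgD_seq r0 (cvgB_seq E (@cvg_cst_seq 1)).
rewrite add0r addrAC subrr add0r; move=> /cvg_eventually; apply; apply: nearW => n.
by rewrite /rem /= subrK.
Unshelve. all: by end_near. Qed.

End Polylog.

(** * The saddle point: mean and variance of the size *)

Section Saddle.
Context {R : realType}.
Implicit Types (x y h t l : R).

(** The t at which n t + pi^2 / (6 t) is least. *)
Definition saddle n : R := Num.sqrt (pi ^+ 2 / 6 / n%:R).

(** The inverse of the standard deviation pi / sqrt (3 t^3) of the size under
    the weights e^(- t size), for t = saddle n. *)
Definition width n : R := Num.sqrt (3 * saddle n ^+ 3 / pi ^+ 2).

Lemma saddle_gt0 n : (0 < n)%N -> 0 < saddle n.
Proof. by move=> n0; rewrite sqrtr_gt0 !divr_gt0 ?exprn_gt0 ?pi_gt0 ?ltr0n. Qed.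

Lemma saddle_sqr n : saddle n ^+ 2 = pi ^+ 2 / 6 / n%:R.
Proof. by rewrite sqr_sqrtr// !divr_ge0 ?sqr_ge0. Qed.

Lemma cvg_sqrt_seq (u : nat -> R) l :
  u n @[n --> \oo] --> l -> Num.sqrt (u n) @[n --> \oo] --> Num.sqrt l.
Proof. by move=> ul; apply: continuous_cvg ul; exact: sqrt_continuous. Qed.

Lemma saddle_cvg0 : saddle n @[n --> \oo] --> (0 : R).
Proof.
have := cvg_sqrt_seq (cvgMl_seq (k := pi ^+ 2 / 6) (@cvg_inv_natr R)).
by rewrite mulr0 sqrtr0.
Qed.

Lemma near_saddle_gt0 : \forall n \near \oo, 0 < saddle n.
Proof. by exists 1%N => // n /= n0; exact: saddle_gt0. Qed.

Lemma width_gt0 n : (0 < n)%N -> 0 < width n.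
Proof.
move=> n0; rewrite sqrtr_gt0 divr_gt0 ?exprn_gt0 ?pi_gt0// mulr_gt0// exprn_gt0//.
exact: saddle_gt0.
Qed.

Lemma width_sqr n : width n ^+ 2 = 3 * saddle n ^+ 3 / pi ^+ 2.
Proof. by rewrite sqr_sqrtr// divr_ge0 ?sqr_ge0// mulr_ge0// exprn_ge0// sqrtr_ge0. Qed.

Lemma width_saddle_cvg0 : width n / saddle n @[n --> \oo] --> (0 : R).
Proof.
have := cvg_sqrt_seq (cvgMl_seq (k := 3 / pi ^+ 2) saddle_cvg0).
rewrite mulr0 sqrtr0 => /cvg_eventually; apply; near=> n.
have t0 : 0 < saddle n by near: n; exact: near_saddle_gt0.
have -> : width n = Num.sqrt (saddle n ^+ 2 * (3 / pi ^+ 2 * saddle n)).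
  by rewrite /width; congr Num.sqrt; ring.
by rewrite sqrtrM ?sqr_ge0// sqrtr_sqr gtr0_norm// mulrC mulKf// gt_eqF.
Unshelve. all: by end_near. Qed.

(** The logarithm of the generating function, at e^-x, of the partitions with
    parts at most n. *)
Definition log_gen n x : R := \sum_(0 <= k < n) nlog (k.+1%:R * x).

(** The points t - l width, written as multiples of t so that they are seen
    to be equivalent to t. *)
Lemma log_gen_saddle_asymp (l : R) :
  log_gen n (saddle n * (1 - l * (width n / saddle n)))
    - pi ^+ 2 / 6 / (saddle n * (1 - l * (width n / saddle n)))
    - 2^-1 * ln (saddle n * (1 - l * (width n / saddle n)))
    @[n --> \oo] --> - (ln (2 * pi) / 2).
Proof.
pose u n := 1 - l * (width n / saddle n).
have u1 : u n @[n --> \oo] --> (1 : R).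
  have := cvgB_seq (@cvg_cst_seq R 1) (cvgMl_seq (k := l) width_saddle_cvg0).
  by rewrite mulr0 subr0.
have uh : \forall n \near \oo, 2^-1 <= u n.
  by apply: (cvgr_ge (1 : R) u1); lra.
apply: (@sum_nlog_asymp R (fun n => saddle n * u n)).
- near=> n; rewrite mulr_gt0//; first by near: n; exact: near_saddle_gt0.
  by apply: (@lt_le_trans _ _ 2^-1) => //; near: n.
- by have := cvgM_seq saddle_cvg0 u1; rewrite mul0r.
- (* n^2 t^3 is pi^4 / (36 t), and the factor u n is at least 1 / 2 *)
  pose C : R := 8 * (36 / pi ^+ 4).
  apply: (@cvg_of_dist R C _ _ 0 saddle_cvg0); near=> n.
  have uh' : 2^-1 <= u n by near: n.
  have n0 : 0 < n%:R :> R by near: n; exact: nbhs_infty_gt0.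
  have t0 : 0 < saddle n by near: n; exact: near_saddle_gt0.
  have u0 : 0 < u n by lra.
  have pi0 := @pi_gt0 R.
  have nE : n%:R = pi ^+ 2 / 6 / saddle n ^+ 2.
    by rewrite saddle_sqr; move: (pi : R) pi0 => p p0; field; rewrite !gt_eqF.
  rewrite subr0 ger0_norm; last first.
    by rewrite invr_ge0 mulr_ge0 ?exprn_ge0// mulr_ge0// ltW.
  rewrite exprMn nE; move: (saddle n) t0 => t t0.
  have -> : (pi ^+ 2 / 6 / t ^+ 2) ^+ 2 * (t ^+ 3 * u n ^+ 3) = (u n ^+ 3) * (pi ^+ 4 / 36 / t).
    by move: (pi : R) pi0 => p p0; field; rewrite !gt_eqF.
  rewrite invfM (_ : (pi ^+ 4 / 36 / t)^-1 = 36 / pi ^+ 4 * t); last first.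
    by move: (pi : R) pi0 => p p0; field; rewrite !gt_eqF.
  rewrite /C -[leRHS]mulrA ler_wpM2r//.
    by rewrite mulr_ge0 ?(ltW t0)// divr_ge0// exprn_ge0// ltW.
  rewrite -[leRHS]invrK lef_pV2 ?posrE ?exprn_gt0//.
  rewrite (_ : 8^-1 = 2^-1 ^+ 3); last by field.
  by rewrite lerXn2r ?nnegrE// ltW.
Unshelve. all: by end_near. Qed.

(** The expansion of pi^2 / (6 x) at the saddle point: the linear term is
    n l width, and width is chosen to make the quadratic term l^2 / 2. *)
Lemma log_gen_shift (l : R) :
  log_gen n (saddle n - l * width n) - log_gen n (saddle n) - n%:R * (l * width n)
    @[n --> \oo] --> l ^+ 2 / 2.
Proof.
have := cvgB_seq (@log_gen_saddle_asymp l) (@log_gen_saddle_asymp 0).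
rewrite subrr => D0.
pose d n := l * (width n / saddle n).
have dc : d n @[n --> \oo] --> (0 : R).
  by have := cvgMl_seq (k := l) width_saddle_cvg0; rewrite mulr0.
have uc : 1 - d n @[n --> \oo] --> (1 : R).
  by have := cvgB_seq (@cvg_cst_seq R 1) dc; rewrite subr0.
have uh : \forall n \near \oo, 2^-1 <= 1 - d n by apply: (cvgr_ge (1 : R) uc); lra.
have vc : (1 - d n)^-1 @[n --> \oo] --> (1 : R).
  by rewrite -[X in _ --> X]invr1; apply: cvgV => //; exact: oner_neq0.
have lc := cvgMl_seq (k := 2^-1) (cvg_ln_seq ltr01 uc).
have := cvgD_seq (cvgD_seq D0 (cvgMl_seq (k := l ^+ 2 / 2) vc)) lc.
rewrite ln1 mulr0 addr0 add0r mulr1 => /cvg_eventually; apply; near=> n.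
have uh' : 2^-1 <= 1 - d n by near: n.
have n0 : 0 < n%:R :> R by near: n; exact: nbhs_infty_gt0.
have t0 : 0 < saddle n by near: n; exact: near_saddle_gt0.
have pi0 := @pi_gt0 R.
have nE : n%:R = pi ^+ 2 / 6 / saddle n ^+ 2.
  by rewrite saddle_sqr; move: (pi : R) pi0 => p p0; field; rewrite !gt_eqF.
rewrite mul0r subr0 mulr1 -/(d n) lnM ?posrE//; last by lra.
have -> : saddle n - l * width n = saddle n * (1 - d n).
  by rewrite /d mulrBr mulr1 mulrCA [saddle n * _]mulrC divfK// gt_eqF.
have -> : l * width n = saddle n * d n.
  by rewrite /d mulrCA [saddle n * _]mulrC divfK// gt_eqF.
have lE : l ^+ 2 / 2 = pi ^+ 2 / 6 / saddle n * d n ^+ 2.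
  rewrite /d exprMn expr_div_n width_sqr.
  by move: (pi : R) pi0 => p p0; field; rewrite !gt_eqF.
rewrite lE nE; move: (log_gen _ _) (log_gen _ _) (ln _) (ln _) => a b c e.
have dn : 1 - d n != 0 by rewrite gt_eqF//; lra.
by move: (pi : R) pi0 => p p0; field; rewrite dn gt_eqF.
Unshelve. all: by end_near. Qed.

(** nlog is convex with derivative - bose. *)
Lemma nlog_tangent x y : 0 < x -> y < x -> y * bose x <= nlog (x - y) - nlog x.
Proof.
move=> x0 yx; have [y0|/ltW y0] := leP 0 y.
  have xy0 : 0 < x - y by rewrite subr_gt0.
  have xyx : x - y <= x by rewrite gerBl.
  by have /andP[+ _] := nlog_squeeze xy0 xyx; rewrite subKr.
have xyx : x <= x - y by rewrite lerDl oppr_ge0.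
have /andP[_] := nlog_squeeze x0 xyx.
by rewrite (_ : x - y - x = - y) ?mulNr 1?lerNr ?opprB//; ring.
Qed.

(** bose is convex with derivative - bose (1 + bose). *)
Lemma bose_tangent x y : 0 < x -> y < x ->
  bose x + y * (bose x * (1 + bose x)) <= bose (x - y).
Proof.
move=> x0 yx; have xy0 : 0 < x - y by rewrite subr_gt0.
rewrite /bose; have E1 := expR_sub1_gt0 x0; have E2 := expR_sub1_gt0 xy0.
move: E2; rewrite expRB; set z := expR y; set E := expR x in E1 *.
rewrite -/E in E1 * => E2.
have z0 : 0 < z := expR_gt0 y; have E0 : 0 < E := expR_gt0 x.
have yz : y <= z - 1 by have := expR_ge1Dx y; rewrite -/z; lra.
have Ez : 0 < E - z by have := mulr_gt0 E2 z0; rewrite mulrBl mul1r divfK// gt_eqF.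
rewrite -subr_ge0.
have -> : (E / z - 1)^-1 - ((E - 1)^-1 + y * ((E - 1)^-1 * (1 + (E - 1)^-1))) =
   E * ((E - 1) * (z - 1) - y * (E - z)) / ((E - z) * (E - 1) ^+ 2).
  by field; rewrite !gt_eqF.
rewrite divr_ge0 ?mulr_ge0 ?exprn_ge0 ?(ltW E0) ?(ltW Ez) ?(ltW E1)//.
have := ler_wpM2r (ltW Ez) yz; have := sqr_ge0 (z - 1); rewrite expr2; lra.
Qed.

(** The Taylor remainder of order 2 of nlog at x. *)
Definition quad_rest x y := nlog (x - y) - nlog x - y * bose x - y ^+ 2 / 2 * (bose x * (1 + bose x)).

Lemma quad_rest_is_derive x y : 0 < x -> y < x ->
  is_derive y 1 (quad_rest x) (bose (x - y) - bose x - y * (bose x * (1 + bose x))).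
Proof.
move=> x0 yx; have xy0 : 0 < x - y by rewrite subr_gt0.
have D := nlog_is_derive xy0; by rewrite /quad_rest; is_derive_field.
Qed.

(** It increases with y by [bose_tangent], and vanishes at 0. *)
Lemma quad_rest_sign x y : 0 < x -> y < x ->
  if 0 <= y then 0 <= quad_rest x y else quad_rest x y <= 0.
Proof.
move=> x0 yx.
have q0 : quad_rest x 0 = 0 by rewrite /quad_rest subr0; ring.
have mono a b : a <= b -> b < x -> quad_rest x a <= quad_rest x b.
  move=> ab bx; apply: (@ge0_derive_le R _
    (fun y => bose (x - y) - bose x - y * (bose x * (1 + bose x)))) => // z /andP[_ zb].
    by apply: quad_rest_is_derive => //; exact: le_lt_trans bx.
  by have := @bose_tangent x z x0 (le_lt_trans zb bx); lra.
case: ifPn => y0; first by rewrite -q0 mono.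
by rewrite -[leRHS]q0 mono// ltW// ltNge.
Qed.

(** Mean and variance of the size when the part k has a multiplicity of
    geometric law of ratio e^(- k t), for k = 1, ..., n, independently. *)
Definition tilt_mean n t := \sum_(0 <= k < n) k.+1%:R * bose (k.+1%:R * t).
Definition tilt_var n t := \sum_(0 <= k < n) k.+1%:R ^+ 2 * (bose (k.+1%:R * t) * (1 + bose (k.+1%:R * t))).

Lemma log_gen_tangent n t h : 0 < t -> h < t ->
  h * tilt_mean n t <= log_gen n (t - h) - log_gen n t.
Proof.
move=> t0 ht; rewrite /log_gen -sumrB mulr_sumr; apply: ler_sum => k _.
have k0 : 0 < k.+1%:R :> R by rewrite ltr0n.
have := @nlog_tangent (k.+1%:R * t) (k.+1%:R * h).
by rewrite mulr_gt0// ltr_pM2l// -mulrBr mulrA (mulrC _ h) => /(_ isT ht); rewrite -mulrA.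
Qed.

Lemma log_gen_quad n t h (r := log_gen n (t - h) - log_gen n t - h * tilt_mean n t
    - h ^+ 2 / 2 * tilt_var n t) : 0 < t -> h < t ->
  if 0 <= h then 0 <= r else r <= 0.
Proof.
move=> t0 ht.
have -> : r = \sum_(0 <= k < n) quad_rest (k.+1%:R * t) (k.+1%:R * h).
  rewrite /r /log_gen /tilt_mean /tilt_var !mulr_sumr -!sumrB; apply: eq_bigr => k _.
  rewrite /quad_rest -mulrBr; ring.
have s k : if 0 <= h then 0 <= quad_rest (k.+1%:R * t) (k.+1%:R * h)
           else quad_rest (k.+1%:R * t) (k.+1%:R * h) <= 0.
  have k0 : 0 < k.+1%:R :> R by rewrite ltr0n.
  have := @quad_rest_sign (k.+1%:R * t) (k.+1%:R * h).
  by rewrite mulr_gt0// ltr_pM2l// (pmulr_rge0 _ k0) => /(_ isT ht).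
by case: ifP s => _ s; [apply: sumr_ge0|apply: sumr_le0] => k _; exact: s.
Qed.

Lemma near_width_lt (l : R) : \forall n \near \oo, l * width n < saddle n.
Proof.
have dc : l * (width n / saddle n) @[n --> \oo] --> (0 : R).
  by have := cvgMl_seq (k := l) width_saddle_cvg0; rewrite mulr0.
near=> n; have t0 : 0 < saddle n by near: n; exact: near_saddle_gt0.
rewrite -[ltRHS]mul1r -ltr_pdivrMr// -mulrA.
by near: n; apply: (cvgr_lt (0 : R) dc).
Unshelve. all: by end_near. Qed.

(** The tangent of the convex function log_gen lies below its graph. At
    t - e width and t + e width, where [log_gen_shift] gives the value, this
    bounds (mean - n) width by e from both sides, up to o(1). *)
Lemma tilt_mean_asymp : (tilt_mean n (saddle n) - n%:R) * width n @[n --> \oo] --> (0 : R).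
Proof.
apply/cvgr0Pnorm_le => e e0; have e2 : 0 < e ^+ 2 / 2 by rewrite divr_gt0 ?exprn_gt0.
have := @log_gen_shift e => /cvgrPdist_le/(_ _ e2) up.
have := @log_gen_shift (- e) => /cvgrPdist_le/(_ _ e2) lo.
near=> n.
have t0 : 0 < saddle n by near: n; exact: near_saddle_gt0.
have h1 : e * width n < saddle n by near: n; exact: near_width_lt.
have h2 : - e * width n < saddle n by near: n; exact: near_width_lt.
have u1 := log_gen_tangent n t0 h1; have u2 := log_gen_tangent n t0 h2.
have /ler_normlP[_ a1] : `|e ^+ 2 / 2 - (log_gen n (saddle n - e * width n) - log_gen n (saddle n)
   - n%:R * (e * width n))| <= e ^+ 2 / 2 by near: n.
have /ler_normlP[a2 _] : `|e ^+ 2 / 2 - (log_gen n (saddle n - e * width n) - log_gen n (saddle n)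
   - n%:R * (e * width n))| <= e ^+ 2 / 2 by near: n.
have /ler_normlP[b2 _] : `|(- e) ^+ 2 / 2 - (log_gen n (saddle n - - e * width n) - log_gen n (saddle n)
   - n%:R * (- e * width n))| <= e ^+ 2 / 2 by near: n.
rewrite sqrrN in b2; rewrite ler_norml.
set X := (_ - _) * _; have XE : e * X = e * width n * tilt_mean n (saddle n) - n%:R * (e * width n).
  by rewrite /X; ring.
rewrite -(ler_pM2l e0) -[X in _ && X](ler_pM2l e0) XE mulrN -expr2.
by move: u1 u2 a1 a2 b2; rewrite !mulNr !mulrN; move: (log_gen _ _) (log_gen _ _) (log_gen _ _) => *; apply/andP; split; lra.
Unshelve. all: by end_near. Qed.

(** The parabola of order 2 of log_gen lies below its graph on one side of t
    and above on the other, so the two points t - width and t + width give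
    bounds from both sides. *)
Lemma tilt_var_asymp : tilt_var n (saddle n) * width n ^+ 2 @[n --> \oo] --> (1 : R).
Proof.
have up := cvgMl_seq (k := 2) (cvgB_seq (@log_gen_shift 1) tilt_mean_asymp).
have lo := cvgMl_seq (k := 2) (cvgD_seq (@log_gen_shift (- 1)) tilt_mean_asymp).
rewrite expr1n subr0 mulrC divfK in up; last by rewrite pnatr_eq0.
rewrite sqrrN expr1n addr0 mulrC divfK in lo; last by rewrite pnatr_eq0.
apply: (squeeze_cvgr _ lo up); near=> n.
have t0 : 0 < saddle n by near: n; exact: near_saddle_gt0.
have w0 : 0 < width n by near: n; exists 1%N => // n; exact: width_gt0.
have h1 : 1 * width n < saddle n by near: n; exact: near_width_lt.
have h2 : - 1 * width n < saddle n by near: n; exact: near_width_lt.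
have /= := log_gen_quad n t0 h1; rewrite mul1r ltW// => q1.
have /= := log_gen_quad n t0 h2; rewrite mulN1r leNgt oppr_lt0 w0/= sqrrN => q2.
move: q1 q2; rewrite opprK mulrN !mulNr.
move: (log_gen n (saddle n - width n)) (log_gen n (saddle n + width n)) => a b.
move: (log_gen n (saddle n)) (tilt_mean n (saddle n)) (tilt_var n (saddle n)) => c m v.
by move=> *; apply/andP; split; lra.
Unshelve. all: by end_near. Qed.

End Saddle.

(** * The inversion integral in polar form *)

Section Fourier.
Context {R : realType}.
Implicit Types (x y t w u : R) (m : R) (a : int) (K n : nat).
Local Notation mu := (@lebesgue_measure R).

(** Square of the modulus of 1 - m (e^(i y) - 1), the inverse of the
    characteristic function of the geometric law of mean m; geo_mod and
    geo_arg are the modulus and the argument of the characteristic function.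
    The real part of 1 - m (e^(i y) - 1) is at least 1, so that the arctangent
    is the argument. *)
Definition geo_den m y := (1 + m * (1 - cos y)) ^+ 2 + (m * sin y) ^+ 2.
Definition geo_mod m y := (Num.sqrt (geo_den m y))^-1.
Definition geo_arg m y := atan (m * sin y / (1 + m * (1 - cos y))).

Lemma geo_re_ge1 m y : 0 <= m -> 1 <= 1 + m * (1 - cos y).
Proof. by move=> m0; rewrite lerDl mulr_ge0// subr_ge0 cos_le1. Qed.

Lemma geo_denE m y : geo_den m y = 1 + 2 * (m * (1 + m)) * (1 - cos y).
Proof. by rewrite /geo_den exprMn sin2cos2; ring. Qed.

Lemma geo_den_ge1 m y : 0 <= m -> 1 <= geo_den m y.
Proof. move=> m0; rewrite geo_denE lerDl mulr_ge0 ?subr_ge0 ?cos_le1//.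
by rewrite mulr_ge0// mulr_ge0// addr_ge0. Qed.

Lemma geo_den_gt0 m y : 0 <= m -> 0 < geo_den m y.
Proof. by move=> m0; apply: lt_le_trans (geo_den_ge1 y m0). Qed.

Lemma geo_mod_gt0 m y : 0 <= m -> 0 < geo_mod m y.
Proof. by move=> m0; rewrite invr_gt0 sqrtr_gt0 geo_den_gt0. Qed.

Lemma geo_mod_le1 m y : 0 <= m -> geo_mod m y <= 1.
Proof.
move=> m0; rewrite invf_le1 ?sqrtr_gt0 ?geo_den_gt0//.
by rewrite -[leLHS]sqrtr1 ler_wsqrtr// geo_den_ge1.
Qed.

Lemma geo_cos m y : 0 <= m -> cos (geo_arg m y) = geo_mod m y * (1 + m * (1 - cos y)).
Proof.
move=> m0; have A1 := geo_re_ge1 y m0; rewrite /geo_arg cos_atan /geo_mod /geo_den.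
set A := 1 + _ in A1 *; set B := m * sin y.
have A0 : 0 < A by exact: lt_le_trans A1.
have -> : 1 + (B / A) ^+ 2 = (A ^+ 2 + B ^+ 2) / A ^+ 2 by field; rewrite gt_eqF.
rewrite sqrtrM ?addr_ge0 ?sqr_ge0// sqrtrV ?sqr_ge0// sqrtr_sqr gtr0_norm//.
by rewrite invfM invrK.
Qed.

Lemma geo_sin m y : 0 <= m -> sin (geo_arg m y) = geo_mod m y * (m * sin y).
Proof.
move=> m0; have A1 := geo_re_ge1 y m0.
have A0 : 0 < 1 + m * (1 - cos y) by exact: lt_le_trans A1.
have c0 : cos (geo_arg m y) != 0.
  by rewrite geo_cos// gt_eqF// mulr_gt0// geo_mod_gt0.
have := atanK (m * sin y / (1 + m * (1 - cos y))); rewrite -/(geo_arg m y) /tan.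
move=> /(congr1 (fun z => z * cos (geo_arg m y))); rewrite divfK// => ->.
by rewrite geo_cos//; field; rewrite gt_eqF.
Qed.

(** The real part of (1 + m - m e^(i y)) phi e^(i x) = e^(i x), for phi the
    characteristic function. *)
Lemma geo_identity m x y : 0 <= m ->
  (1 + m) * (geo_mod m y * cos (geo_arg m y + x))
  - m * (geo_mod m y * cos (geo_arg m y + x + y)) = cos x.
Proof.
move=> m0; rewrite -addrA !cosD !sinD geo_cos// geo_sin//.
have D0 := geo_den_gt0 y m0.
have mm : geo_mod m y ^+ 2 = (geo_den m y)^-1 by rewrite /geo_mod exprVn sqr_sqrtr// ltW.
have DE : geo_den m y = (1 + m * (1 - cos y)) ^+ 2 + (m * sin y) ^+ 2 by [].
set A := 1 + m * (1 - cos y) in DE *; set B := m * sin y in DE *.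
transitivity (geo_mod m y ^+ 2 * (cos x * (A ^+ 2 + B ^+ 2))).
  by rewrite /A /B; ring.
by rewrite mm DE; field; rewrite -DE gt_eqF.
Qed.

Lemma geo_mod_continuous m c : 0 <= m -> continuous (fun u => geo_mod m (c * u)).
Proof.
move=> m0 u; apply: cvgV; first by rewrite gt_eqF// sqrtr_gt0 geo_den_gt0.
apply: (@continuous_comp _ _ _ (fun u => geo_den m (c * u)) Num.sqrt); last exact: sqrt_continuous.
have D (z : R) : is_derive z 1 (fun u : R => geo_den m (c * u)) (2 * (m * (1 + m)) * (c * sin (c * z))).
  rewrite [X in is_derive _ _ X](_ : _ = fun u : R => 1 + 2 * (m * (1 + m)) * (1 - cos (c * u))); last first.
    by apply/funext => z'; rewrite geo_denE.
  by is_derive_ring.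
exact: (is_derive_continuous D).
Qed.

Lemma geo_arg_continuous m c : 0 <= m -> continuous (fun u => geo_arg m (c * u)).
Proof.
move=> m0 u.
apply: (@continuous_comp _ _ _ (fun u => m * sin (c * u) / (1 + m * (1 - cos (c * u)))) atan); last first.
  exact: continuous_atan.
have D1 (z : R) : is_derive z 1 (fun u : R => m * sin (c * u)) (m * (c * cos (c * z))) by is_derive_ring.
have D2 (z : R) : is_derive z 1 (fun u : R => 1 + m * (1 - cos (c * u))) (m * (c * sin (c * z))) by is_derive_ring.
apply: cvgM; first exact: (is_derive_continuous D1).
apply: cvgV; last exact: (is_derive_continuous D2).
by rewrite gt_eqF// (lt_le_trans ltr01)// geo_re_ge1.
Qed.

(** Modulus and argument of the characteristic function of the size under
    the law described at tilt_mean, with parts at most K. *)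
Definition tilt_mod K t y := \prod_(0 <= k < K) geo_mod (bose (k.+1%:R * t)) (k.+1%:R * y).
Definition tilt_arg K t y := \sum_(0 <= k < K) geo_arg (bose (k.+1%:R * t)) (k.+1%:R * y).

Lemma bose_nat_ge0 k t : 0 < t -> 0 <= bose (k.+1%:R * t).
Proof. by move=> t0; rewrite ltW// bose_gt0// mulr_gt0. Qed.

Lemma tilt_mod_bounds K t y : 0 < t -> 0 < tilt_mod K t y <= 1.
Proof.
move=> t0; elim: K => [|K /andP[r0 r1]]; first by rewrite /tilt_mod big_geq// ltr01 lexx.
rewrite /tilt_mod big_nat_recr//= -/(tilt_mod K t y) mulr_gt0 ?geo_mod_gt0 ?bose_nat_ge0//=.
have m0 := bose_nat_ge0 K t0.
by apply: mulr_ile1; rewrite ?geo_mod_le1// ltW// geo_mod_gt0.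
Qed.

Lemma tilt_mod_continuous K t w : 0 < t -> continuous (fun u => tilt_mod K t (w * u)).
Proof.
move=> t0; elim: K => [|K IH] u.
  rewrite [X in continuous_at _ X](_ : _ = fun=> 1); first exact: cvg_cst.
  by apply/funext => z; rewrite /tilt_mod big_geq.
rewrite [X in continuous_at _ X](_ : _ =
    fun u => tilt_mod K t (w * u) * geo_mod (bose (K.+1%:R * t)) (K.+1%:R * w * u)); last first.
  by apply/funext => z; rewrite /tilt_mod big_nat_recr//= mulrA.
by apply: cvgM; [exact: IH|apply: geo_mod_continuous; exact: bose_nat_ge0].
Qed.

Lemma tilt_arg_continuous K t w : 0 < t -> continuous (fun u => tilt_arg K t (w * u)).
Proof.
move=> t0; elim: K => [|K IH] u.
  rewrite [X in continuous_at _ X](_ : _ = fun=> 0); first exact: cvg_cst.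
  by apply/funext => z; rewrite /tilt_arg big_geq.
rewrite [X in continuous_at _ X](_ : _ =
    fun u => tilt_arg K t (w * u) + geo_arg (bose (K.+1%:R * t)) (K.+1%:R * w * u)); last first.
  by apply/funext => z; rewrite /tilt_arg big_nat_recr//= mulrA.
by apply: cvgD; [exact: IH|apply: geo_arg_continuous; exact: bose_nat_ge0].
Qed.

(** The variable is scaled by w, so that for w = width n the integrand has a
    Gaussian limit. *)
Definition fourier_fun K t w a u : R :=
  tilt_mod K t (w * u) * cos (tilt_arg K t (w * u) - a%:~R * (w * u)).

Definition fourier_coef K t w a := \int[mu]_(u in `[- (pi / w), pi / w]) fourier_fun K t w a u.

Lemma fourier_fun_continuous K t w a : 0 < t -> continuous (fourier_fun K t w a).
Proof.
move=> t0 u; apply: cvgM; first exact: tilt_mod_continuous.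
apply: (@continuous_comp _ _ _ (fun u => tilt_arg K t (w * u) - a%:~R * (w * u)) cos); last first.
  exact: continuous_cos.
apply: cvgB; first exact: tilt_arg_continuous.
have D (z : R) : is_derive z 1 (fun u : R => a%:~R * (w * u)) (a%:~R * w) by is_derive_ring.
exact: (is_derive_continuous D).
Qed.

Lemma norm_fourier_fun_le K t w a u : 0 < t ->
  `|fourier_fun K t w a u| <= tilt_mod K t (w * u).
Proof.
move=> t0; have /andP[r0 _] := tilt_mod_bounds K (w * u) t0.
by rewrite normrM gtr0_norm// ler_piMr ?(ltW r0)// cos_max.
Qed.

Lemma sin_int_pi a : sin (a%:~R * pi) = 0 :> R.
Proof.
have h n : sin (n%:R * pi) = 0 :> R.
  by elim: n => [|n IH]; rewrite ?mul0r ?sin0// -natr1 mulrDl mul1r sinDpi IH oppr0.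
case: a => n; first by rewrite -pmulrn h.
by rewrite NegzE mulrNz mulNr sinN -pmulrn h oppr0.
Qed.

Lemma fourier_coef0 t w a : 0 < w ->
  fourier_coef 0 t w a = if a == 0 then 2 * pi / w else 0.
Proof.
move=> w0; have pi0 := @pi_gt0 R.
have pw : - (pi / w) <= pi / w by rewrite ge0_cp// divr_ge0// ltW.
have E u : fourier_fun 0 t w a u = cos (a%:~R * w * u).
  by rewrite /fourier_fun /tilt_mod /tilt_arg !big_geq// mul1r sub0r cosN mulrA.
rewrite /fourier_coef; under eq_Rintegral do rewrite E.
case: eqP => [->|/eqP a0].
  have D1 x : is_derive x 1 (fun x : R => x) ((fun=> 1) x) by exact: is_derive_id.
  have C1 : continuous (fun _ : R => 1 : R) by move=> x; exact: cvg_cst.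
  under eq_Rintegral do rewrite !mul0r cos0.
  by rewrite (Rintegral_derive pw C1 D1); field; rewrite gt_eqF.
have aw0 : a%:~R * w != 0 by rewrite mulf_neq0 ?intr_eq0// gt_eqF.
have D u : is_derive u 1 (fun u => sin (a%:~R * w * u) / (a%:~R * w)) (cos (a%:~R * w * u)).
  move: (a%:~R * w) aw0 => c c0; is_derive_field; exact: c0.
have C : continuous (fun u => cos (a%:~R * w * u)).
  have D' u : is_derive u 1 (fun u => cos (a%:~R * w * u)) (- (a%:~R * w * sin (a%:~R * w * u))).
    by is_derive_ring.
  exact: (is_derive_continuous D').
rewrite (Rintegral_derive pw C D).
have -> : a%:~R * w * (pi / w) = a%:~R * pi by field; rewrite gt_eqF.
have -> : a%:~R * w * - (pi / w) = - (a%:~R * pi) by field; rewrite gt_eqF.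
by rewrite sinN sin_int_pi oppr0 !mul0r subrr.
Qed.

(** [geo_identity] removes the factor of the largest part; on the side of
    partitions this is the recursion [npart_leS]. *)
Lemma fourier_coefS K t w a (m := bose (K.+1%:R * t)) : 0 < t ->
  (1 + m) * fourier_coef K.+1 t w a - m * fourier_coef K.+1 t w (a - K.+1%:Z)
  = fourier_coef K t w a.
Proof.
move=> t0; have m0 : 0 <= m by exact: bose_nat_ge0.
have If b K' : mu.-integrable `[- (pi / w), pi / w] (EFin \o fourier_fun K' t w b).
  by apply: integrable_continuous_itv; exact: fourier_fun_continuous.
have IZ c b K' : mu.-integrable `[- (pi / w), pi / w] (EFin \o (fun u => c * fourier_fun K' t w b u)).
  apply: integrable_continuous_itv => u; apply: cvgMl_tmp; exact: fourier_fun_continuous.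
rewrite /fourier_coef -!RintegralZl// -RintegralB//; apply: eq_Rintegral => u _.
rewrite /fourier_fun; set y := w * u.
have -> : tilt_mod K.+1 t y = tilt_mod K t y * geo_mod m (K.+1%:R * y) by rewrite /tilt_mod big_nat_recr.
have -> : tilt_arg K.+1 t y = tilt_arg K t y + geo_arg m (K.+1%:R * y) by rewrite /tilt_arg big_nat_recr.
have := @geo_identity m (tilt_arg K t y - a%:~R * y) (K.+1%:R * y) m0 => <-.
have -> : tilt_arg K t y + geo_arg m (K.+1%:R * y) - a%:~R * y =
  geo_arg m (K.+1%:R * y) + (tilt_arg K t y - a%:~R * y) by ring.
have -> : tilt_arg K t y + geo_arg m (K.+1%:R * y) - (a - K.+1%:Z)%:~R * y =
  geo_arg m (K.+1%:R * y) + (tilt_arg K t y - a%:~R * y) + K.+1%:R * y.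
  by rewrite intrB -pmulrn; ring.
ring.
Qed.

Lemma norm_fourier_coef_le K t w a : 0 < t -> 0 < w -> `|fourier_coef K t w a| <= 2 * pi / w.
Proof.
move=> t0 w0; have pi0 := @pi_gt0 R.
have pw : - (pi / w) <= pi / w by rewrite ge0_cp// divr_ge0// ltW.
have If b : mu.-integrable `[- (pi / w), pi / w] (EFin \o fourier_fun K t w b).
  by apply: integrable_continuous_itv; exact: fourier_fun_continuous.
have D1 x : is_derive x 1 (fun x : R => x) ((fun=> 1) x) by exact: is_derive_id.
have C1 : continuous (fun _ : R => 1 : R) by move=> x; exact: cvg_cst.
have := Rintegral_derive pw C1 D1.
have -> : pi / w - - (pi / w) = 2 * pi / w by ring.
move=> <-; rewrite /fourier_coef.
apply: le_trans (le_normr_Rintegral _ _) _ => //.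
apply: le_Rintegral => //.
- by apply: integrable_norm; exact: If.
- exact: integrable_continuous_itv.
- move=> u _; apply: le_trans (norm_fourier_fun_le _ _ _ _ t0) _.
  by have /andP[] := tilt_mod_bounds K (w * u) t0.
Qed.

Lemma bose_ratio x : 0 < x -> bose x / (1 + bose x) = expR (- x).
Proof.
move=> x0; rewrite boseE//; have := one_sub_expRN_gt0 x0.
move: (expR (- x)) => q q1; have q0 : 1 - q != 0 by rewrite gt_eqF.
have : 1 + q / (1 - q) = (1 - q)^-1 by field.
by move=> ->; rewrite invrK divfK.
Qed.

(** The recursion multiplies by q < 1 at each step of length K.+1 to the
    left, while the coefficients are bounded. *)
Lemma fourier_coef_neg K t w a : 0 < t -> 0 < w -> (a < 0)%R -> fourier_coef K t w a = 0.
Proof.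
move=> t0 w0; elim: K a => [|K IH] a a0; first by rewrite fourier_coef0// lt_eqF.
have x0 : 0 < K.+1%:R * t by rewrite mulr_gt0.
set m := bose (K.+1%:R * t); have m0 : 0 < m by exact: bose_gt0.
set q := expR (- (K.+1%:R * t)).
have q01 : 0 <= q < 1 by rewrite expR_ge0 expR_lt1 oppr_lt0.
have step b : (b < 0)%R -> fourier_coef K.+1 t w b = q * fourier_coef K.+1 t w (b - K.+1%:Z).
  move=> b0; have := @fourier_coefS K t w b t0; rewrite IH// -/m => /eqP.
  rewrite subr_eq0 => /eqP E.
  have m1 : 1 + m != 0 by rewrite gt_eqF// addr_gt0.
  by rewrite /q -bose_ratio// -/m -mulrA mulrCA mulrA -[LHS](mulKf m1) E; field.
have iter j : `|fourier_coef K.+1 t w a| <= q ^+ j * (2 * pi / w).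
  have [b [b0 ->]] : exists b, (b < 0)%R /\ fourier_coef K.+1 t w a = q ^+ j * fourier_coef K.+1 t w b.
    elim: j => [|j [b [b0 E]]]; first by exists a; rewrite expr0 mul1r.
    exists (b - K.+1%:Z); split; first by lia.
    by rewrite E step// exprSr mulrA.
  case/andP: q01 => q0 q1.
  by rewrite normrM ger0_norm ?exprn_ge0// ler_wpM2l ?exprn_ge0// norm_fourier_coef_le.
have qc : q ^+ j * (2 * pi / w) @[j --> \oo] --> (0 : R).
  rewrite -[X in _ --> X](mul0r (2 * pi / w)); apply: cvgM_seq; last exact: cvg_cst_seq.
  by apply: cvg_expr; case/andP: q01 => q0 q1; rewrite ger0_norm.
apply/eqP; rewrite -normr_le0.
by apply: (ler_cvg_seq (@cvg_cst_seq R `|fourier_coef K.+1 t w a|) qc); exact: nearW.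
Qed.

(** Both sides satisfy the recursion of [fourier_coefS] and vanish at
    negative frequencies. *)
Theorem fourier_coefE K t w n : 0 < t -> 0 < w ->
  fourier_coef K t w n%:Z =
  2 * pi / w * expR (- (n%:R * t)) * (npart_le K n)%:R * expR (- log_gen K t).
Proof.
move=> t0 w0; elim: K n => [|K IHK] n.
  rewrite fourier_coef0// npart_le0 /log_gen big_geq// oppr0 expR0 mulr1.
  by case: n => [|n]; rewrite ?mul0r ?oppr0 ?expR0 ?mulr1// ?mulr0.
have x0 : 0 < K.+1%:R * t by rewrite mulr_gt0.
set m := bose (K.+1%:R * t); have m0 : 0 < m by exact: bose_gt0.
have m1 : 1 + m != 0 by rewrite gt_eqF// addr_gt0.
have LE : expR (- log_gen K.+1 t) = expR (- log_gen K t) / (1 + m).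
  rewrite /log_gen big_nat_recr//= opprD expRD; congr (_ * _).
  rewrite /nlog opprK lnK ?posrE ?one_sub_expRN_gt0//.
  rewrite /m boseE//; have := one_sub_expRN_gt0 x0.
  move: (expR (- _)) => q q1; have q0 : 1 - q != 0 by rewrite gt_eqF.
  have : 1 + q / (1 - q) = (1 - q)^-1 by field.
  by move=> ->; rewrite invrK.
elim/ltn_ind: n => n IHn.
have := @fourier_coefS K t w n%:Z t0; rewrite -/m => /eqP; rewrite subr_eq => /eqP E.
have -> : fourier_coef K.+1 t w n%:Z = (fourier_coef K t w n%:Z + m * fourier_coef K.+1 t w (n%:Z - K.+1%:Z)) / (1 + m).
  by rewrite -E; field.
rewrite IHK npart_leS LE; case: ifP => nK; last first.
  rewrite fourier_coef_neg//; last by move/negbT: nK; lia.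
  by rewrite addn0 mulr0 addr0; move: (pi : R) => p; field; rewrite m1 gt_eqF.
have -> : (n%:Z - K.+1%:Z)%R = (n - K.+1)%N%:Z by rewrite subzn.
rewrite IHn; last by lia.
rewrite LE natrD -/m.
have -> : m * (2 * pi / w * expR (- ((n - K.+1)%:R * t)) * (npart_le K.+1 (n - K.+1))%:R * (expR (- log_gen K t) / (1 + m)))
  = 2 * pi / w * expR (- (n%:R * t)) * (npart_le K.+1 (n - K.+1))%:R * expR (- log_gen K t).
  have -> : n%:R * t = (n - K.+1)%:R * t + K.+1%:R * t by rewrite -mulrDl -natrD subnK.
  rewrite opprD expRD -(bose_ratio x0) -/m; move: (pi : R) => p; field.
  by rewrite m1 gt_eqF.
by move: (pi : R) => p; field; rewrite m1 gt_eqF.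
Qed.

End Fourier.

(** * Pointwise limit of the integrand, and cosine sums *)

Section LocalLimit.
Context {R : realType}.
Implicit Types (x y t w u : R) (m : R) (K n : nat).
Local Notation mu := (@lebesgue_measure R).
Local Notation mR := (measurableTypeR R).

(** 1 / (1 + x^2) is at most 2 / (1 + x)^2, hence at most twice the increment
    over [x - t, x] of - 1 / (1 + x), divided by t. *)
Lemma sum_cauchy_le n t : 0 < t ->
  \sum_(0 <= k < n) (1 + (k.+1%:R * t) ^+ 2)^-1 <= 2 / t.
Proof.
move=> t0; apply: (@le_trans _ _ (2 / t * (1 - (1 + n%:R * t)^-1))); last first.
  rewrite ler_piMr ?divr_ge0 ?(ltW t0)// gerBl invr_ge0 addr_ge0// mulr_ge0// ltW//.
elim: n => [|n IH]; first by rewrite big_geq// mul0r addr0 invr1 subrr mulr0.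
rewrite big_nat_recr//=.
have z0 : 0 <= n%:R * t by rewrite mulr_ge0// ltW.
have -> : n.+1%:R * t = n%:R * t + t by rewrite -natr1 mulrDl mul1r.
move: (n%:R * t) z0 IH => z z0 IH.
suff : (1 + (z + t) ^+ 2)^-1 <= 2 / t * ((1 + z)^-1 - (1 + (z + t))^-1) by move: IH; lra.
have -> : 2 / t * ((1 + z)^-1 - (1 + (z + t))^-1) = ((1 + z) * (1 + (z + t)) / 2)^-1.
  by field; rewrite !gt_eqF//; lra.
rewrite lef_pV2 ?posrE; last 2 first.
- by rewrite addr_gt0// exprn_gt0// ltr_wpDl.
- by rewrite divr_gt0// mulr_gt0//; lra.
have h : (1 + z) * (1 + (z + t)) <= (1 + (z + t)) * (1 + (z + t)) by rewrite ler_wpM2r; lra.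
by have := sqr_ge0 (z + t - 1); move: (z + t) h => s h; lra.
Qed.

(** A Riemann sum of a function with inverse square decay is O(1 / t). *)
Lemma sum_decay_le (f : R -> R) (C : R) n t : 0 < t -> 0 <= C ->
    (forall x, 0 < x -> f x * (1 + x ^+ 2) <= C) ->
  \sum_(0 <= k < n) f (k.+1%:R * t) <= C * (2 / t).
Proof.
move=> t0 C0 fC.
apply: (@le_trans _ _ (C * \sum_(0 <= k < n) (1 + (k.+1%:R * t) ^+ 2)^-1)).
  rewrite mulr_sumr; apply: ler_sum => k _.
  have x0 : 0 < k.+1%:R * t by rewrite mulr_gt0.
  by rewrite ler_pdivlMr ?fC// addr_gt0// exprn_gt0.
by rewrite ler_wpM2l// sum_cauchy_le.
Qed.

Lemma bose_moments x (m := bose x) : 0 < x ->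
  [/\ 0 < m, x * m <= 1, x ^+ 2 * m <= 2, x ^+ 3 * m <= 6 &
   [/\ x ^+ 4 * m <= 24, x ^+ 5 * m <= 120 & x ^+ 6 * m <= 720]].
Proof.
move=> x0; have b n := @bose_pow_le R x n x0.
have := (b 0, b 1, b 2, b 3, b 4, b 5)%N; rewrite expr1 => -[[[[[b0 b1] b2] b3] b4] b5].
by have := bose_gt0 x0.
Qed.

Lemma third_moment_le x (m := bose x) : 0 < x ->
  (x ^+ 3 * (m + m ^+ 3)) * (1 + x ^+ 2) <= 131.
Proof.
move=> x0; have [m0 b1 b2 b3 [b4 b5 b6]] := bose_moments x0; rewrite -/m in m0 b1 b2 b3 b4 b5 b6.
have -> : (x ^+ 3 * (m + m ^+ 3)) * (1 + x ^+ 2) =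
  x ^+ 3 * m + x ^+ 5 * m + (x * m) ^+ 3 + (x * m) * (x ^+ 2 * m) ^+ 2 by ring.
have a0 : 0 <= x * m by rewrite mulr_ge0// ltW.
have c0 : 0 <= x ^+ 2 * m by rewrite mulr_ge0 ?exprn_ge0// ltW.
have h1 : (x * m) ^+ 3 <= 1 by rewrite exprn_ile1.
have h2 : (x ^+ 2 * m) ^+ 2 <= 2 ^+ 2 by rewrite lerXn2r ?nnegrE.
have h3 : (x * m) * (x ^+ 2 * m) ^+ 2 <= 1 * 2 ^+ 2 by rewrite ler_pM ?sqr_ge0.
lra.
Qed.

(** With one more pair of powers of x, the products x^j bose^i with i <= j
    stay bounded. *)
Lemma fourth_moment_le x (q := bose x * (1 + bose x)) : 0 < x ->
  (x ^+ 4 * (q + q ^+ 2)) * (1 + x ^+ 2) <= 877.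
Proof.
move=> x0; have [] := bose_moments x0; rewrite /q.
move: (bose x) => m m0 b1 b2 b3 [b4 b5 b6].
have c0 j : 0 <= x ^+ j * m by rewrite mulr_ge0 ?exprn_ge0// ltW.
have s1 : (x * m) ^+ 2 <= 1 by rewrite exprn_ile1// -[x]expr1.
have s2 : (x ^+ 2 * m) ^+ 2 <= 2 ^+ 2 by rewrite lerXn2r ?nnegrE.
have s3 : (x ^+ 3 * m) ^+ 2 <= 6 ^+ 2 by rewrite lerXn2r ?nnegrE.
set p2 := x ^+ 2 * m + (x * m) ^+ 2.
set p4 := x ^+ 4 * m + (x ^+ 2 * m) ^+ 2.
set p6 := x ^+ 6 * m + (x ^+ 3 * m) ^+ 2.
have -> : x ^+ 4 * (m * (1 + m) + (m * (1 + m)) ^+ 2) * (1 + x ^+ 2) = p4 + p6 + p2 ^+ 2 + p2 * p4.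
  by rewrite /p2 /p4 /p6; ring.
have p20 : 0 <= p2 by rewrite addr_ge0 ?sqr_ge0.
have p40 : 0 <= p4 by rewrite addr_ge0 ?sqr_ge0.
have p23 : p2 <= 3 by rewrite /p2; lra.
have p428 : p4 <= 28 by rewrite /p4; lra.
have p6le : p6 <= 756 by rewrite /p6; lra.
have h2 : p2 ^+ 2 <= 3 ^+ 2 by rewrite lerXn2r ?nnegrE.
have h3 : p2 * p4 <= 3 * 28 by rewrite ler_pM.
lra.
Qed.

(** Twice the quadratic expansion of - ln geo_mod; the variance of the
    geometric law of mean m is m (1 + m). *)
Lemma ln_geo_den m y (q := m * (1 + m)) : 0 <= m ->
  `|ln (geo_den m y) - q * y ^+ 2| <= (q + q ^+ 2) * y ^+ 4.
Proof.
move=> m0; have q0 : 0 <= q by rewrite mulr_ge0// addr_ge0.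
have -> : geo_den m y = 1 + q * (2 * (1 - cos y)) by rewrite geo_denE -/q; ring.
have z0 : 0 <= 2 * (1 - cos y) by rewrite mulr_ge0// subr_ge0 cos_le1.
have z1 : 2 * (1 - cos y) <= y ^+ 2 by have := cos_ge y; lra.
have := norm_cos_sub y; move: (2 * (1 - cos y)) z0 z1 => z z0 z1 /ler_normlP[h1 h2].
have qz0 : 0 <= q * z by rewrite mulr_ge0.
have l1 := ln_ge qz0; have l2 : ln (1 + q * z) <= q * z.
  by have := @ln_le R (1 + q * z); rewrite (addrC 1) addrK; apply; lra.
have y4 : z ^+ 2 <= y ^+ 4 by rewrite (_ : y ^+ 4 = (y ^+ 2) ^+ 2) ?lerXn2r ?nnegrE ?sqr_ge0// -exprM.
have a1 : q * (y ^+ 2 - z) <= q * y ^+ 4 by rewrite ler_wpM2l//; lra.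
have a2 : q ^+ 2 * z ^+ 2 <= q ^+ 2 * y ^+ 4 by rewrite ler_wpM2l// sqr_ge0.
have a3 : 0 <= q * (y ^+ 2 - z) by rewrite mulr_ge0// subr_ge0.
have a4 : 0 <= q ^+ 2 * z ^+ 2 by rewrite mulr_ge0 ?sqr_ge0.
rewrite ler_norml; move: l1 l2; rewrite exprMn.
by move: (ln _) => L l1 l2; apply/andP; split; lra.
Qed.

Lemma norm_sin_le y : `|sin y| <= `|y|.
Proof.
wlog y0 : y / 0 <= y.
  move=> h; have [/h//|/ltW y0] := leP 0 y.
  by rewrite -normrN -(normrN y) -sinN h// oppr_ge0.
rewrite (ger0_norm y0) ler_norml sin_le// andbT.
have /(_ y0) := @ge0_derive_le R (fun x => sin x + x) (fun x => cos x + 1) 0 y.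
rewrite sin0 addr0 => le; have : 0 <= sin y + y; last by lra.
apply: le => x _; last by have := cos_geN1 x; lra.
Qed.

(** The argument of a characteristic function is y times the mean, up to third
    order. *)
Lemma geo_arg_sub m y : 0 <= m -> `|geo_arg m y - m * y| <= 2 * (m + m ^+ 3) * `|y| ^+ 3.
Proof.
move=> m0; rewrite /geo_arg; set a := _ / _.
have A1 := geo_re_ge1 y m0.
have z0 : 0 <= 1 - cos y by rewrite subr_ge0 cos_le1.
have z1 : 1 - cos y <= `|y| ^+ 2 / 2 by have := cos_ge y; rewrite real_normK ?num_real//; lra.
have aE : a - m * sin y = - (a * (m * (1 - cos y))).
  by rewrite /a; field; rewrite gt_eqF// (lt_le_trans ltr01).
have Y0 : 0 <= `|y| by [].
have a1 : `|a| <= m * `|y|.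
  rewrite /a normf_div ler_pdivrMr ?normr_gt0 ?gt_eqF ?(lt_le_trans ltr01)//.
  rewrite normrM (ger0_norm m0) [ `|1 + _|]ger0_norm ?(le_trans ler01)//.
  rewrite -[m * `|sin y|]mulr1 ler_pM ?mulr_ge0//.
  by rewrite ler_wpM2l// norm_sin_le.
have d1 : `|atan a - a| <= m ^+ 3 * `|y| ^+ 3.
  by apply: le_trans (norm_atan_sub a) _; rewrite -exprMn lerXn2r ?nnegrE// mulr_ge0.
have d2 : `|a - m * sin y| <= m ^+ 2 / 2 * `|y| ^+ 3.
  rewrite aE normrN normrM (ger0_norm (mulr_ge0 m0 z0)).
  have -> : m ^+ 2 / 2 * `|y| ^+ 3 = (m * `|y|) * (m * (`|y| ^+ 2 / 2)) by ring.
  by rewrite ler_pM ?mulr_ge0// ler_wpM2l.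
have d3 : `|m * sin y - m * y| <= m * `|y| ^+ 3.
  by rewrite -mulrBr normrM (ger0_norm m0) ler_wpM2l// norm_sin_sub.
have -> : atan a - m * y = (atan a - a) + (a - m * sin y) + (m * sin y - m * y) by ring.
apply: le_trans (ler_normD _ _) _; apply: le_trans (lerD (ler_normD _ _) (lexx _)) _.
apply: le_trans (lerD (lerD d1 d2) d3) _.
rewrite -!mulrDl ler_wpM2r ?exprn_ge0//.
have : 0 <= m * (m - 1) ^+ 2 by rewrite mulr_ge0// sqr_ge0.
have : 0 <= m ^+ 3 by rewrite exprn_ge0.
nra.
Qed.

Lemma tilt_modE K t y : 0 < t -> tilt_mod K t y =
  expR (- (2^-1 * \sum_(0 <= k < K) ln (geo_den (bose (k.+1%:R * t)) (k.+1%:R * y)))).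
Proof.
move=> t0; elim: K => [|K IH]; first by rewrite /tilt_mod !big_geq// mulr0 oppr0 expR0.
rewrite big_nat_recr//= mulrDr opprD expRD -IH /tilt_mod big_nat_recr//=; congr (_ * _).
have d0 : 0 < geo_den (bose (K.+1%:R * t)) (K.+1%:R * y) by rewrite geo_den_gt0// bose_nat_ge0.
rewrite /geo_mod expRN; congr (_^-1).
rewrite -[X in Num.sqrt X](lnK (x := geo_den _ _)) ?posrE//.
move: (ln _) => l; have -> : expR l = expR (2^-1 * l) ^+ 2 by rewrite expr2 -expRD; congr expR; field.
by rewrite sqrtr_sqr ger0_norm ?expR_ge0.
Qed.

(** The fourth order terms add up to O(y^4 / t^5), which is O(t) when y is of
    order t^(3/2). *)
Lemma ln_tilt_mod_le n t y : 0 < t ->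
  `|\sum_(0 <= k < n) ln (geo_den (bose (k.+1%:R * t)) (k.+1%:R * y)) - tilt_var n t * y ^+ 2|
  <= 877 * (2 / t) * (y / t) ^+ 4.
Proof.
move=> t0; pose f x : R := x ^+ 4 * (bose x * (1 + bose x) + (bose x * (1 + bose x)) ^+ 2).
have fC x : 0 < x -> f x * (1 + x ^+ 2) <= 877 by exact: fourth_moment_le.
have C0 : 0 <= 877 :> R by exact: ler0n.
apply: (@le_trans _ _ ((\sum_(0 <= k < n) f (k.+1%:R * t)) * (y / t) ^+ 4)); last first.
  by rewrite ler_wpM2r ?exprn_even_ge0//; exact: sum_decay_le.
rewrite /tilt_var !mulr_suml -sumrB; apply: le_trans (ler_norm_sum _ _ _) _.
apply: ler_sum => k _.
have -> : f (k.+1%:R * t) * (y / t) ^+ 4 = (bose (k.+1%:R * t) * (1 + bose (k.+1%:R * t)) +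
    (bose (k.+1%:R * t) * (1 + bose (k.+1%:R * t))) ^+ 2) * (k.+1%:R * y) ^+ 4.
  by rewrite /f; field; rewrite gt_eqF.
have := @ln_geo_den (bose (k.+1%:R * t)) (k.+1%:R * y) (bose_nat_ge0 k t0).
have E (z c : R) : c ^+ 2 * (z * (1 + z)) * y ^+ 2 = z * (1 + z) * (c * y) ^+ 2 by ring.
by rewrite E; exact.
Qed.

(** The third order terms add up to O(y^3 / t^4), which is O(t^(1/2)) when y
    is of order t^(3/2). *)
Lemma tilt_arg_sub_le n t y : 0 < t ->
  `|tilt_arg n t y - tilt_mean n t * y| <= 131 * (2 / t) * (2 * (`|y| / t) ^+ 3).
Proof.
move=> t0; pose f x : R := x ^+ 3 * (bose x + bose x ^+ 3).
have fC x : 0 < x -> f x * (1 + x ^+ 2) <= 131 by exact: third_moment_le.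
have C0 : 0 <= 131 :> R by exact: ler0n.
apply: (@le_trans _ _ ((\sum_(0 <= k < n) f (k.+1%:R * t)) * (2 * (`|y| / t) ^+ 3))); last first.
  apply: ler_wpM2r; last exact: (sum_decay_le _ t0 C0 fC).
  by rewrite mulr_ge0// exprn_ge0// divr_ge0// ltW.
rewrite /tilt_arg /tilt_mean !mulr_suml -sumrB; apply: le_trans (ler_norm_sum _ _ _) _.
apply: ler_sum => k _.
have -> : f (k.+1%:R * t) * (2 * (`|y| / t) ^+ 3) =
    2 * (bose (k.+1%:R * t) + bose (k.+1%:R * t) ^+ 3) * `|k.+1%:R * y| ^+ 3.
  by rewrite /f normrM gtr0_norm//; field; rewrite gt_eqF.
have := @geo_arg_sub (bose (k.+1%:R * t)) (k.+1%:R * y) (bose_nat_ge0 k t0).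
by rewrite [bose _ * (_ * y)]mulrA (mulrC _ k.+1%:R).
Qed.

Lemma sqr_width_saddle n : (0 < n)%N -> (width n / saddle n) ^+ 2 = 3 / pi ^+ 2 * saddle n :> R.
Proof.
move=> n0; have t0 := @saddle_gt0 R n n0; rewrite expr_div_n width_sqr.
have p0 := @pi_gt0 R; move: (pi : R) p0 => p p0; field.
by rewrite !gt_eqF.
Qed.

Lemma cvg_near_dist (u v e : nat -> R) (l : R) :
    v n @[n --> \oo] --> l -> e n @[n --> \oo] --> (0 : R) ->
    (\forall n \near \oo, `|u n - v n| <= e n) ->
  u n @[n --> \oo] --> l.
Proof.
move=> vl e0 uv; have := cvgD_seq (squeeze_cvg0 uv e0) vl.
rewrite add0r => /cvg_eventually; apply.
by apply: nearW => n; rewrite subrK.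
Qed.

Lemma tilt_mod_cvg u :
  tilt_mod n (saddle n) (width n * u) @[n --> \oo] --> expR (- (u ^+ 2 / 2)).
Proof.
pose S n := \sum_(0 <= k < n) ln (geo_den (bose (k.+1%:R * saddle n)) (k.+1%:R * (width n * u))).
have Sc : S n @[n --> \oo] --> u ^+ 2.
  have v := cvgMl_seq (k := u ^+ 2) (@tilt_var_asymp R); rewrite mulr1 in v.
  have e0 := cvgMl_seq (k := 877 * 2 * (u ^+ 4 * (3 / pi ^+ 2) ^+ 2)) (@saddle_cvg0 R).
  rewrite mulr0 in e0; apply: (cvg_near_dist v e0).
  near=> n; have n0 : (0 < n)%N by near: n; exists 1%N.
  have t0 := @saddle_gt0 R n n0; have wt := sqr_width_saddle n0.
  have := ln_tilt_mod_le n (width n * u) t0; rewrite -/(S n).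
  have -> : tilt_var n (saddle n) * (width n * u) ^+ 2 = u ^+ 2 * (tilt_var n (saddle n) * width n ^+ 2).
    by rewrite exprMn; ring.
  suff -> : 877 * (2 / saddle n) * (width n * u / saddle n) ^+ 4 =
    877 * 2 * (u ^+ 4 * (3 / pi ^+ 2) ^+ 2) * saddle n :> R by [].
  have -> : (width n * u / saddle n) ^+ 4 = ((width n / saddle n) ^+ 2) ^+ 2 * u ^+ 4 :> R by ring.
  rewrite wt; have p0 := @pi_gt0 R; move: (pi : R) p0 => p p0; field.
  by rewrite !gt_eqF.
have h := cvgMl_seq (k := - 2^-1) Sc.
have -> : - (u ^+ 2 / 2) = - 2^-1 * u ^+ 2 by field.
apply: (cvg_eventually (cvg_expR_seq h)); near=> n.
have n0 : (0 < n)%N by near: n; exists 1%N.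
by rewrite tilt_modE ?saddle_gt0// mulNr.
Unshelve. all: by end_near. Qed.

Lemma tilt_arg_cvg u :
  tilt_arg n (saddle n) (width n * u) - n%:R * (width n * u) @[n --> \oo] --> (0 : R).
Proof.
have m0 := cvgMl_seq (k := u) (@tilt_mean_asymp R); rewrite mulr0 in m0.
have e0 := cvgMl_seq (k := 131 * 2 * 2 * (`|u| ^+ 3 * (3 / pi ^+ 2))) (@width_saddle_cvg0 R).
rewrite mulr0 in e0; apply: (cvg_near_dist m0 e0).
near=> n; have n0 : (0 < n)%N by near: n; exists 1%N.
have t0 := @saddle_gt0 R n n0; have w0 := @width_gt0 R n n0; have wt := sqr_width_saddle n0.
have := tilt_arg_sub_le n (width n * u) t0.
have -> : tilt_arg n (saddle n) (width n * u) - n%:R * (width n * u)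
    - u * ((tilt_mean n (saddle n) - n%:R) * width n)
  = tilt_arg n (saddle n) (width n * u) - tilt_mean n (saddle n) * (width n * u) by ring.
suff -> : 131 * (2 / saddle n) * (2 * (`|width n * u| / saddle n) ^+ 3) =
  131 * 2 * 2 * (`|u| ^+ 3 * (3 / pi ^+ 2)) * (width n / saddle n) :> R by [].
have -> : (`|width n * u| / saddle n) ^+ 3 = (width n / saddle n) ^+ 2 * (width n / saddle n) * `|u| ^+ 3 :> R.
  by rewrite normrM (gtr0_norm w0); ring.
rewrite wt; have p0 := @pi_gt0 R; move: (pi : R) p0 => p p0; field.
by rewrite !gt_eqF.
Unshelve. all: by end_near. Qed.

Lemma fourier_fun_cvg u :
  fourier_fun n (saddle n) (width n) n%:Z u @[n --> \oo] --> expR (- (u ^+ 2 / 2)).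
Proof.
rewrite -[X in _ --> X]mulr1 -[X in _ * X]cos0; apply: cvgM_seq; first exact: tilt_mod_cvg.
have h := tilt_arg_cvg u; have c := @continuous_cos R 0.
exact: (continuous_cvg _ c h).
Qed.

(** The Dirichlet kernel. *)
Lemma sum_cos_tele K y :
  2 * sin (y / 2) * \sum_(0 <= k < K) cos (k.+1%:R * y) = sin ((K%:R + 2^-1) * y) - sin (y / 2).
Proof.
elim: K => [|K IH]; first by rewrite big_geq// mulr0 add0r (mulrC 2^-1) subrr.
rewrite big_nat_recr//= mulrDr IH.
have -> : (K.+1%:R + 2^-1) * y = K.+1%:R * y + y / 2 by ring.
have -> : (K%:R + 2^-1) * y = K.+1%:R * y - y / 2 by rewrite -natr1; field.
by rewrite !sinD sinN cosN; ring.
Qed.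

Lemma one_sub_cos_ge y : 0 <= y <= 4 -> y ^+ 2 / 18 <= 1 - cos y.
Proof.
move=> /andP[y0 y4]; have /sin_geD3 : 0 <= y / 2 <= 2 by apply/andP; split; lra.
have -> : cos y = 1 - 2 * sin (y / 2) ^+ 2.
  have {1}-> : y = y / 2 + y / 2 by field.
  by rewrite cosD -!expr2 sin2cos2 ; ring.
have : 0 <= y / 2 / 3 by lra.
move: (sin _) => s; nra.
Qed.

Lemma sum_sqr_ge K : K%:R ^+ 3 / 3 <= \sum_(0 <= k < K) k.+1%:R ^+ 2 :> R.
Proof.
elim: K => [|K IH]; first by rewrite big_geq// expr0n/= mul0r.
rewrite big_nat_recr//=; move: IH; rewrite -[K.+1%:R]natr1.
have : 0 <= K%:R :> R by []. move: (K%:R : R) => k k0; nra.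
Qed.

(** When K y <= 4, the inequality 1 - cos x >= x^2 / 18 applies to each term.
    Otherwise the Dirichlet kernel shows that the cosines add up to at most
    3 K / 4. *)
Lemma sum_one_sub_cos_ge K y : 0 <= y <= pi ->
  \sum_(0 <= k < K) (1 - cos (k.+1%:R * y)) >= Num.min (K%:R ^+ 3 * y ^+ 2 / 54) (K%:R / 4).
Proof.
move=> /andP[y0 yp]; have p4 : pi / 2 < 2 :> R by exact: pihalf_lt2.
have [Ky|Ky] := leP (K%:R * y) 4.
  rewrite ge_min; apply/orP; left.
  apply: (@le_trans _ _ (\sum_(0 <= k < K) k.+1%:R ^+ 2 * (y ^+ 2 / 18))).
    rewrite -mulr_suml; have := sum_sqr_ge K; have := sqr_ge0 y.
    move: (\sum_(0 <= _ < _) _) (K%:R ^+ 3) (y ^+ 2) => *; nra.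
  rewrite !big_nat; apply: ler_sum => k /andP[_ kK].
  have := @one_sub_cos_ge (k.+1%:R * y); rewrite exprMn mulrA; apply.
  rewrite mulr_ge0//= (le_trans _ Ky)// ler_wpM2r// ler_nat//.
rewrite ge_min; apply/orP; right.
have K0 : 0 < K%:R :> R by rewrite lt0r ler0n andbT; apply: contraTneq Ky => ->; rewrite mul0r -leNgt.
have yy0 : 0 < y by rewrite -(pmulr_rgt0 _ K0); lra.
rewrite sumrB sumr_const_nat subn0.
have := sum_cos_tele K y; have /sin_geD3 : 0 <= y / 2 <= 2 by apply/andP; split; lra.
have := sin_le1 ((K%:R + 2^-1) * y).
move: (sin (_ * y)) (sin (y / 2)) (\sum_(0 <= _ < _) _) => s1 s2 S h1 h2 h3.
have : S <= 3 * K%:R / 4; last by lra.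
rewrite leNgt; apply/negP => h4.
have : 2 * s2 * (3 * K%:R / 4) < 2 * s2 * S by rewrite ltr_pM2l//; lra.
have : 4 / 6 < s2 * K%:R by apply: (@lt_le_trans _ _ (K%:R * y / 6)); [lra|nra].
nra.
Qed.

End LocalLimit.

(** * The Hardy-Ramanujan formula *)

Section Partition_asymptotics.
Context {R : realType}.
Implicit Types (x y t w u : R) (m : R) (K n i : nat).
Local Notation mu := (@lebesgue_measure R).
Local Notation mR := (measurableTypeR R).

Lemma bose_ge_third x : 0 < x <= 1 -> 3^-1 <= bose x.
Proof.
move=> /andP[x0 x1]; rewrite /bose lef_pV2 ?posrE ?expR_sub1_gt0//.
have e0 := expR_gt0 (- 2^-1 : R); have := expR_ge1Dx (- 2^-1 : R).
have : expR x <= expR 1 by rewrite ler_expR.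
have : expR 1 * (expR (- 2^-1) * expR (- 2^-1)) = 1 :> R.
  by rewrite -!expRD -[RHS]expR0; congr expR; field.
have := expR_gt0 (1 : R).
move: (expR (- 2^-1)) (expR x) (expR 1) e0 => a b c a0 c0 h bc a2.
have : 4^-1 <= a * a by nra.
by nra.
Qed.

(** Only the parts k with k t <= 1 are kept: their means are at least 1 / 3,
    so each contributes a fixed multiple of 1 - cos. *)
Lemma tilt_mod_le_cos n K t y : 0 < t -> K%:R * t <= 1 -> (K <= n)%N ->
  tilt_mod n t y <= expR (- (8^-1 * \sum_(0 <= k < K) (1 - cos (k.+1%:R * y)))).
Proof.
move=> t0 Kt Kn; rewrite tilt_modE// ler_expR lerN2.
have g0 k : 0 <= ln (geo_den (bose (k.+1%:R * t)) (k.+1%:R * y)).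
  by rewrite ln_ge0// geo_den_ge1// bose_nat_ge0.
rewrite [X in _ <= _ * X](big_cat_nat (n := K))//= mulrDr ler_wpDr ?mulr_ge0 ?sumr_ge0//.
rewrite !mulr_sumr !big_nat; apply: ler_sum => k /andP[_ kK].
have xt : 0 < k.+1%:R * t <= 1.
  by rewrite mulr_gt0//= (le_trans _ Kt)// ler_pM2r// ler_nat.
have /andP[x0 _] := xt; have b3 := bose_ge_third xt.
have c0 : 0 <= 1 - cos (k.+1%:R * y) by rewrite subr_ge0 cos_le1.
have c2 : 1 - cos (k.+1%:R * y) <= 2 by have := cos_geN1 (k.+1%:R * y); lra.
rewrite geo_denE; move: (bose _) (1 - cos _) b3 c0 c2 => m v m3 v0 v2.
have q4 : 8 / 9 <= 2 * (m * (1 + m)) by nra.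
have l1 : 1 + 8 / 9 * v <= 1 + 2 * (m * (1 + m)) * v by rewrite lerD2l ler_wpM2r.
have z0 : 0 < 1 + 8 / 9 * v by rewrite ltr_pwDl// mulr_ge0// divr_ge0.
have l2 : ln (1 + 8 / 9 * v) <= ln (1 + 2 * (m * (1 + m)) * v).
  by rewrite ler_ln ?posrE// (lt_le_trans z0).
have l3 := ln_geV z0.
have l4 : v / 4 <= 1 - (1 + 8 / 9 * v)^-1.
  have -> : 1 - (1 + 8 / 9 * v)^-1 = 8 / 9 * v / (1 + 8 / 9 * v) by field; lra.
  by rewrite ler_pdivlMr//; nra.
lra.
Qed.

(** About 1 / t parts contribute in [tilt_mod_le_cos]. For small arguments
    [sum_one_sub_cos_ge] gives e^(- c u^2); for the others it gives
    e^(- c / t), which beats 1 + u^2 since u^2 is at most of order t^-3. *)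
Lemma tilt_mod_le_cauchy : exists C : R, forall n u, (0 < n)%N -> saddle n <= 2^-1 :> R ->
  `|u| <= pi / width n -> tilt_mod n (saddle n) (width n * u) <= C * (1 + u ^+ 2)^-1.
Proof.
have p0 := @pi_gt0 R; have p2 := @pi_ge2 R.
exists (1152 * pi ^+ 2 + (1 + 2 * 64 ^+ 3 * pi ^+ 4)) => n u n0 t2 uw.
have t0 := @saddle_gt0 R n n0; have w0 := @width_gt0 R n n0.
set t := saddle n in t0 t2 *; set w := width n in w0 uw *.
have w2 : w ^+ 2 = 3 * t ^+ 3 / pi ^+ 2 by exact: width_sqr.
set K := Num.truncn t^-1.
have ti0 : 0 < t^-1 by rewrite invr_gt0.
have /andP[K1 K2] := truncn_itv (ltW ti0); rewrite -/K in K1 K2.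
have Kt : K%:R * t <= 1 by rewrite -ler_pdivlMr// mul1r.
have tK : 2^-1 <= K%:R * t.
  by move: K2; rewrite -natr1 -(ltr_pM2r t0) mulVf ?gt_eqF//; lra.
have Kn : (K <= n)%N.
  rewrite -(ler_nat R) (le_trans K1)//.
  have nR : 0 < n%:R :> R by rewrite ltr0n.
  rewrite -(@ler_pXn2r R 2)// ?nnegrE ?(ltW ti0)//.
  have -> : t^-1 ^+ 2 = 6 * n%:R / pi ^+ 2.
    rewrite exprVn /t saddle_sqr; move: (pi : R) p0 => p pp; field.
    by rewrite !gt_eqF.
  rewrite ler_pdivrMr ?exprn_gt0//.
  have q4 : 4 <= pi ^+ 2 :> R by nra.
  have n2 : pi ^+ 2 / 6 <= n%:R / 4 :> R.
    have -> : pi ^+ 2 / 6 = n%:R * t ^+ 2 by rewrite /t saddle_sqr [n%:R * _]mulrC divfK// gt_eqF.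
    by rewrite ler_pM2l//; nra.
  move: (pi ^+ 2) (n%:R : R) q4 n2 nR => q m *; nra.
set y := `|w * u|.
have yp : 0 <= y <= pi.
  by rewrite normr_ge0/= /y normrM gtr0_norm// mulrC -ler_pdivlMr.
have := sum_one_sub_cos_ge K yp.
have -> : \sum_(0 <= k < K) (1 - cos (k.+1%:R * y)) = \sum_(0 <= k < K) (1 - cos (k.+1%:R * (w * u))).
  apply: eq_bigr => k _; congr (1 - _).
  rewrite /y; have [h|h] := leP 0 (w * u); first by rewrite ger0_norm.
  by rewrite ltr0_norm// mulrN cosN.
have y2 : y ^+ 2 = 3 * t ^+ 3 / pi ^+ 2 * u ^+ 2 by rewrite /y real_normK ?num_real// exprMn w2.
have := tilt_mod_le_cos (w * u) t0 Kt Kn.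
set D := \sum_(0 <= _ < _) _; move: D => D le1 le2.
have u20 := sqr_ge0 u; have u21 : 0 < 1 + u ^+ 2 by lra.
rewrite ler_pdivlMr//; apply: le_trans (ler_wpM2r (ltW u21) le1) _.
have pp : 0 < pi ^+ 2 :> R by rewrite exprn_gt0.
have c1 : 0 <= 1152 * pi ^+ 2 :> R by apply: mulr_ge0; [exact: ler0n|exact: ltW].
have c2 : 0 <= 1 + 2 * 64 ^+ 3 * pi ^+ 4 :> R.
  by rewrite addr_ge0// mulr_ge0 ?mulr_ge0 ?exprn_ge0// ltW.
move: le2; rewrite ge_min => /orP[le2|le2].
  apply: (@le_trans _ _ (1152 * pi ^+ 2)); last by rewrite lerDl.
  have h : (1152 * pi ^+ 2)^-1 * u ^+ 2 <= 8^-1 * D.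
    have : 8^-1 <= (K%:R * t) ^+ 3.
      have : 2^-1 ^+ 3 <= (K%:R * t) ^+ 3 by rewrite lerXn2r ?nnegrE// (le_trans _ tK).
      by have -> : 2^-1 ^+ 3 = 8^-1 :> R by field.
    move: le2; rewrite y2.
    have -> : K%:R ^+ 3 * (3 * t ^+ 3 / pi ^+ 2 * u ^+ 2) / 54 =
       (K%:R * t) ^+ 3 * ((pi ^+ 2)^-1 * u ^+ 2) / 18.
      by move: (pi ^+ 2 : R) pp => P P0; field; rewrite gt_eqF.
    rewrite invfM -mulrA; have : 0 <= (pi ^+ 2)^-1 * u ^+ 2 by rewrite mulr_ge0// invr_ge0 ltW.
    move: (_^-1 * u ^+ 2) ((K%:R * t) ^+ 3) => *; nra.
  have h2 : expR (- (8^-1 * D)) * (1 + (1152 * pi ^+ 2)^-1 * u ^+ 2) <= 1.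
    apply: (@le_trans _ _ (expR (- (8^-1 * D)) * expR (8^-1 * D))).
      by rewrite ler_wpM2l ?expR_ge0// (le_trans _ (expR_ge1Dx _))// lerD2l.
    by rewrite -expRD addNr expR0.
  have c3 : 0 < 1152 * pi ^+ 2 :> R by apply: mulr_gt0 pp; rewrite ltr0n.
  have c4 : 1 <= 1152 * pi ^+ 2 :> R.
    have : 1 <= pi ^+ 2 :> R by rewrite exprn_ege1//; lra.
    by move: (pi ^+ 2 : R) => P; lra.
  have := expR_ge0 (- (8^-1 * D)).
  move: h2; move: (expR _) => e.
  rewrite -(ler_pM2r c3) mul1r -mulrA mulrDl mul1r mulrAC mulVf ?gt_eqF// mul1r.
  move: (1152 * pi ^+ 2) c4 => c c4 h2 e0; have : 0 <= (c - 1) * e by rewrite mulr_ge0// subr_ge0.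
  by lra.
apply: (@le_trans _ _ (1 + 2 * 64 ^+ 3 * pi ^+ 4)); last by rewrite lerDr.
pose X := (64 * t)^-1; have X0 : 0 <= X by rewrite invr_ge0 mulr_ge0// ltW.
have XD : X <= 8^-1 * D.
  have : X <= K%:R / 32; last by lra.
  by rewrite /X ler_pdivlMr// ler_pdivrMl ?mulr_gt0//; lra.
have e1 : expR (- (8^-1 * D)) <= expR (- X) by rewrite ler_expR lerN2.
apply: le_trans (ler_wpM2r (ltW u21) e1) _.
have u2 : u ^+ 2 <= pi ^+ 4 / 3 * 64 ^+ 3 * X ^+ 3.
  have : u ^+ 2 <= (pi / w) ^+ 2.
    by rewrite -[u ^+ 2]real_normK ?num_real// lerXn2r ?nnegrE// divr_ge0// ltW.
  suff -> : (pi / w) ^+ 2 = pi ^+ 4 / 3 * 64 ^+ 3 * X ^+ 3 by [].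
  by rewrite expr_div_n w2 /X; move: (pi : R) p0 => p q0; field; rewrite !gt_eqF.
have eX := @pow_expRN_le R X 3 X0; have eX1 : expR (- X) <= 1 by rewrite expR_le1 oppr_le0.
have e0 := expR_ge0 (- X).
rewrite mulrDr mulr1 lerD//.
apply: le_trans (ler_wpM2l e0 u2) _.
have -> : expR (- X) * (pi ^+ 4 / 3 * 64 ^+ 3 * X ^+ 3) = pi ^+ 4 / 3 * 64 ^+ 3 * (X ^+ 3 * expR (- X)) by ring.
have -> : 2 * 64 ^+ 3 * pi ^+ 4 = pi ^+ 4 / 3 * 64 ^+ 3 * 6 :> R by field.
by rewrite ler_wpM2l// mulr_ge0 ?divr_ge0 ?exprn_ge0// ltW.
Qed.

Lemma integral_gauss_half : \int[mu]_x expR (- (x ^+ 2 / 2)) = Num.sqrt (2 * pi) :> R.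
Proof.
have s0 : 0 < Num.sqrt (2 * pi) :> R by rewrite sqrtr_gt0 mulr_gt0// pi_gt0.
have := @integral_normal_pdf R 0 1; rewrite /normal_pdf oner_eq0.
have E x : (normal_peak 1 * normal_fun 0 1 x : R) = (Num.sqrt (2 * pi))^-1 * expR (- (x ^+ 2 / 2)).
  by rewrite /normal_peak /normal_fun subr0 expr1n mul1r -mulr_natl mulNr.
under eq_integral do rewrite E EFinM.
have mf : measurable_fun [set: mR] (fun x : mR => expR (- (x ^+ 2 / 2)) : R).
  apply: continuous_measurable_fun => x; apply: (@continuous_comp _ _ _ (fun x => - (x ^+ 2 / 2)) expR).
    by apply: cvgN; apply: cvgMr_tmp; exact: exprn_continuous.
  exact: continuous_expR.
rewrite (@ge0_integralZl _ mR R mu _ measurableT); last 3 first.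
- exact/measurable_EFinP.
- by move=> x _; rewrite lee_fin expR_ge0.
- by rewrite lee_fin invr_ge0 ltW.
rewrite /Rintegral; case: (\int[mu]_x _)%E => [r| |] //=.
- by rewrite -EFinM => -[] /(congr1 (fun z => Num.sqrt (2 * pi) * z)); rewrite mulrA divff ?gt_eqF// mul1r mulr1.
- by rewrite gt0_muley ?lte_fin ?invr_gt0.
- by rewrite gt0_muleNy ?lte_fin ?invr_gt0.
Qed.

(** The factor between the integral of frequency n and npart n. *)
Definition fourier_scale n : R :=
  2 * pi / width n * expR (- (n%:R * saddle n)) * expR (- log_gen n (saddle n)).

(** The Hardy-Ramanujan main term: 2 n saddle n is pi sqrt (2 n / 3). *)
Definition growth n : R := expR (2 * (n%:R * saddle n)) / (4 * Num.sqrt 3 * n%:R).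

Lemma growth_gt0 n : (0 < n)%N -> 0 < growth n.
Proof. by move=> n0; rewrite divr_gt0 ?expR_gt0// !mulr_gt0 ?sqrtr_gt0// ltr0n. Qed.

Lemma near_growth_gt0 : \forall n \near \oo, 0 < growth n.
Proof. by exists 1%N => // n; exact: growth_gt0. Qed.

Lemma saddle_natr n : (0 < n)%N -> n%:R * saddle n = pi ^+ 2 / 6 / saddle n :> R.
Proof.
move=> n0; have t0 := @saddle_gt0 R n n0; apply: (@mulIf _ (saddle n)); first by rewrite gt_eqF.
by rewrite divfK ?gt_eqF// -mulrA -expr2 saddle_sqr mulrC divfK// gt_eqF// ltr0n.
Qed.

Lemma sqrt_saddle_width n : (0 < n)%N ->
  width n * Num.sqrt (saddle n) = Num.sqrt 3 * pi / (6 * n%:R) :> R.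
Proof.
move=> n0; have t0 := @saddle_gt0 R n n0; have w0 := @width_gt0 R n n0.
have p0 := @pi_gt0 R; have nR : 0 < n%:R :> R by rewrite ltr0n.
have s3 : 0 < Num.sqrt 3 :> R by rewrite sqrtr_gt0.
apply/eqP; rewrite -(@eqrXn2 _ 2)//; last 2 first.
- by rewrite mulr_ge0 ?sqrtr_ge0// ltW.
- by rewrite divr_ge0 ?mulr_ge0 ?ltW.
rewrite [(width _ * _) ^+ 2]exprMn width_sqr sqr_sqrtr ?ltW//.
have -> : 3 * saddle n ^+ 3 / pi ^+ 2 * saddle n = 3 * (saddle n ^+ 2) ^+ 2 / pi ^+ 2 :> R by ring.
rewrite saddle_sqr [(Num.sqrt 3 * pi / _) ^+ 2]expr_div_n [(Num.sqrt 3 * pi) ^+ 2]exprMn sqr_sqrtr//; apply/eqP.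
by move: (pi : R) p0 => p p0; field; rewrite !gt_eqF.
Qed.

(** The expansion [sum_nlog_asymp] at the saddle point, where
    n t = pi^2 / (6 t). *)
Lemma fourier_scale_growth : fourier_scale n * growth n @[n --> \oo] --> Num.sqrt (2 * pi).
Proof.
have pp : 0 < 2 * pi :> R by rewrite mulr_gt0// pi_gt0.
have := cvg_expR_seq (cvgMl_seq (k := -1) (@log_gen_saddle_asymp R 0)).
have -> : expR (- 1 * - (ln (2 * pi) / 2)) = Num.sqrt (2 * pi) :> R.
  rewrite mulN1r opprK -[in RHS](lnK (x := 2 * pi)) ?posrE//.
  set l := ln _; have -> : expR l = expR (l / 2) ^+ 2 by rewrite expr2 -expRD; congr expR; field.
  by rewrite sqrtr_sqr ger0_norm ?expR_ge0.
move=> /cvg_eventually; apply; near=> n.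
have n0 : (0 < n)%N by near: n; exists 1%N.
have t0 := @saddle_gt0 R n n0; have w0 := @width_gt0 R n n0.
have nR : 0 < n%:R :> R by rewrite ltr0n.
have p0 := @pi_gt0 R; have s3 : 0 < Num.sqrt 3 :> R by rewrite sqrtr_gt0.
rewrite mul0r subr0 mulr1 -saddle_natr// /fourier_scale /growth.
have ws := sqrt_saddle_width n0; set q := Num.sqrt (saddle n) in ws.
have q0 : 0 < q by rewrite sqrtr_gt0.
have qE : expR (2^-1 * ln (saddle n)) = q.
  rewrite /q -[in RHS](lnK (x := saddle n)) ?posrE//.
  set l := ln _; have -> : expR l = expR (2^-1 * l) ^+ 2 by rewrite expr2 -expRD; congr expR; field.
  by rewrite sqrtr_sqr ger0_norm ?expR_ge0.
have -> : expR (-1 * (log_gen n (saddle n) - n%:R * saddle n - 2^-1 * ln (saddle n))) =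
    expR (- (n%:R * saddle n)) * expR (- log_gen n (saddle n)) * expR (2 * (n%:R * saddle n)) * q.
  by rewrite -qE -!expRD; congr expR; ring.
have wE : width n = Num.sqrt 3 * pi / (6 * n%:R) / q by rewrite -ws mulfK// gt_eqF.
rewrite {1}wE.
have s32 : Num.sqrt 3 ^+ 2 = 3 :> R by rewrite sqr_sqrtr.
transitivity (expR (- (n%:R * saddle n)) * expR (- log_gen n (saddle n)) * expR (2 * (n%:R * saddle n)) * q
   * (3 / Num.sqrt 3 ^+ 2)); last by rewrite s32 divff// mulr1.
move: (pi : R) p0 (Num.sqrt 3) s3 => p pp' s s0.
move: (expR (- log_gen _ _)) (expR (2 * _)) (expR (- (_ * _))) => e1 e2 e3; field.
by rewrite !gt_eqF.
Unshelve. all: by end_near. Qed.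

Lemma measurable_arc n : measurable (`[- (pi / width n), pi / width n]%classic : set mR).
Proof. exact: measurable_itv. Qed.

Lemma measurable_fourier_fun K t w (a : int) : 0 < t ->
  measurable_fun [set: mR] (fourier_fun K t w a : mR -> R).
Proof. by move=> t0; apply: continuous_measurable_fun; exact: fourier_fun_continuous. Qed.

Lemma near_saddle_small : \forall n \near \oo, (0 < n)%N /\ saddle n <= 2^-1 :> R.
Proof.
near=> n; split; first by near: n; exists 1%N.
by near: n; apply: (cvgr_le (0 : R) (@saddle_cvg0 R)); rewrite invr_gt0.
Unshelve. all: by end_near. Qed.

Lemma near_succ (P : nat -> Prop) : (\forall n \near \oo, P n) -> \forall n \near \oo, P n.+1.
Proof. by move=> [N _ NP]; exists N => // n /= Nn; apply: NP; exact: leqW. Qed.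

(** Dominated convergence: the limit is the integral of e^(- u^2 / 2). *)
Theorem local_limit : fourier_coef n (saddle n) (width n) n%:Z @[n --> \oo] --> (Num.sqrt (2 * pi) : R).
Proof.
have [C tC] := tilt_mod_le_cauchy.
rewrite -integral_gauss_half -(cvg_shiftS (fun n => fourier_coef n (saddle n) (width n) n%:Z)).
have p0 := @pi_gt0 R.
have sub1 n u : `[- (pi / width n), pi / width n]%classic u <-> `|u| <= pi / width n :> R.
  by rewrite /= in_itv/= ler_norml.
have C0 : 0 <= C.
  near (@nbhs nat _ \oo) => n.
  have [n0 n2] : (0 < n)%N /\ saddle n <= 2^-1 :> R by near: n; exact: near_saddle_small.
  have := tC n 0 n0 n2; rewrite normr0 expr0n/= addr0 invr1 mulr1 mulr0 => h.
  have /andP[h1 _] := tilt_mod_bounds n 0 (@saddle_gt0 R n n0).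
  by apply: le_trans (ltW h1) (h _); rewrite divr_ge0 ?(ltW p0)// ltW// width_gt0.
apply: (@dominated_convergence_moving R (fun n => `[- (pi / width n.+1), pi / width n.+1]%classic)
  (fun n => fourier_fun n.+1 (saddle n.+1) (width n.+1) n.+1%:Z) _ (fun u => C * (1 + u ^+ 2)^-1)).
- by move=> n; exact: measurable_arc.
- by move=> n; apply: measurable_fourier_fun; exact: saddle_gt0.
- exact: integrable_cauchy.
- by move=> u; rewrite mulr_ge0// invr_ge0 addr_ge0// sqr_ge0.
- move=> u; have := @fourier_fun_cvg R u; rewrite -(cvg_shiftS (fun n => fourier_fun n _ _ n%:Z u)).
  move=> /cvg_eventually; apply; near=> n.
  rewrite patchE ifT// inE; apply/sub1.
  rewrite ler_pdivlMr ?width_gt0//.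
  have : saddle n.+1 <= 2^-1 :> R.
    by near: n; apply: filterS (near_succ near_saddle_small) => n [].
  have : `|u| * width n.+1 < saddle n.+1 by near: n; exact: (near_succ (@near_width_lt R `|u|)).
  by have := @pi_ge2 R; lra.
- near=> n => u /sub1 uw.
  have [n0 n2] : (0 < n.+1)%N /\ saddle n.+1 <= 2^-1 :> R.
    by near: n; exact: (near_succ near_saddle_small).
  apply: le_trans (norm_fourier_fun_le _ _ _ _ (@saddle_gt0 R n.+1 n0)) _.
  exact: tC.
Unshelve. all: by end_near. Qed.

Lemma fourier_coef_scale n i : (0 < n)%N -> (i <= n)%N ->
  fourier_coef n (saddle n) (width n) (n - i)%N%:Z =
  fourier_scale n * expR (i%:R * saddle n) * (npart (n - i))%:R.
Proof.
move=> n0 ni; rewrite fourier_coefE ?saddle_gt0 ?width_gt0// npart_leE ?leq_subr//.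
rewrite /fourier_scale natrB//.
have -> : expR (- ((n%:R - i%:R) * saddle n)) = expR (- (n%:R * saddle n)) * expR (i%:R * saddle n) :> R.
  by rewrite -expRD; congr expR; ring.
ring.
Qed.

Lemma fourier_scale_gt0 n : (0 < n)%N -> 0 < fourier_scale n.
Proof.
by move=> n0; rewrite !mulr_gt0 ?invr_gt0 ?expR_gt0// ?width_gt0// pi_gt0.
Qed.

Lemma cvgV_seq (u : nat -> R) (l : R) : l != 0 ->
  u n @[n --> \oo] --> l -> (u n)^-1 @[n --> \oo] --> l^-1.
Proof. by move=> l0 ul; exact: cvgV. Qed.

Theorem npart_asymp : (npart n)%:R / growth n @[n --> \oo] --> (1 : R).
Proof.
have s0 : Num.sqrt (2 * pi) != 0 :> R by rewrite gt_eqF// sqrtr_gt0 mulr_gt0// pi_gt0.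
have := cvgM_seq local_limit (cvgV_seq s0 fourier_scale_growth).
rewrite divff// => /cvg_eventually; apply; near=> n.
have n0 : (0 < n)%N by near: n; exists 1%N.
have := @fourier_coef_scale n 0 n0 (leq0n n); rewrite subn0 mul0r expR0 mulr1 => ->.
have := fourier_scale_gt0 n0; have := growth_gt0 n0.
move: (growth n) (fourier_scale n) => g f g0 f0; field.
by rewrite !gt_eqF.
Unshelve. all: by end_near. Qed.

(** The majorant of [tilt_mod_le_cauchy] bounds the integrals of all
    frequencies at once. *)
Theorem npart_tilted_le : exists C : R, \forall n \near \oo, forall i, (i <= n)%N ->
  (npart (n - i))%:R <= C * (expR (- (i%:R * saddle n)) * growth n).
Proof.
have [C tC] := tilt_mod_le_cauchy.
exists (\int[mu]_u (C * (1 + u ^+ 2)^-1)); near=> n => i ni.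
have [n0 n2] : (0 < n)%N /\ saddle n <= 2^-1 :> R by near: n; exact: near_saddle_small.
have t0 := @saddle_gt0 R n n0; have p0 := @pi_gt0 R.
have f0 := fourier_scale_gt0 n0; have g0 := growth_gt0 n0.
have C0 : 0 <= C.
  have := tC n 0 n0 n2; rewrite normr0 expr0n/= addr0 invr1 mulr1 mulr0 => h.
  have /andP[h1 _] := tilt_mod_bounds n 0 t0.
  by apply: le_trans (ltW h1) (h _); rewrite divr_ge0 ?(ltW p0)// ltW// width_gt0.
have fg : 1 <= fourier_scale n * growth n.
  near: n; apply: (cvgr_ge _ fourier_scale_growth).
  rewrite -[ltLHS]sqrtr1 ltr_sqrt ?mulr_gt0 ?pi_gt0//.
  by have := @pi_ge2 R; lra.
have : fourier_coef n (saddle n) (width n) (n - i)%N%:Z <= \int[mu]_u (C * (1 + u ^+ 2)^-1).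
  rewrite /fourier_coef Rintegral_mkcond; apply: le_Rintegral => //.
  - rewrite -restrict_EFin; apply/(integrable_mkcond _ (measurable_arc n)).
    by apply: integrable_continuous_itv; exact: fourier_fun_continuous.
  - exact: integrable_cauchy.
  - move=> u _; rewrite patchE; case: ifPn => [|_]; last first.
      by rewrite mulr_ge0// invr_ge0 addr_ge0// sqr_ge0.
    rewrite inE /= in_itv/= -ler_norml => uw.
    apply: le_trans (ler_norm _) _; apply: le_trans (norm_fourier_fun_le _ _ _ _ t0) _.
    exact: tC.
rewrite fourier_coef_scale// => le.
have e0 : 0 < expR (i%:R * saddle n) :> R by exact: expR_gt0.
have p00 : 0 <= (npart (n - i))%:R :> R by [].
set B := \int[mu]_u _ in le *; rewrite expRN mulrA.
move: (expR _) (fourier_scale n) (growth n) ((npart _)%:R) f0 g0 fg e0 p00 le => e f g p f0 g0 fg e0 p00 le.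
rewrite mulrAC ler_pdivlMr//.
apply: (@le_trans _ _ (f * e * p * g)); last by rewrite ler_wpM2r// ltW.
have -> : f * e * p * g = (p * e) * (f * g) by ring.
by rewrite ler_peMr// mulr_ge0// ltW.
Unshelve. all: by end_near. Qed.

End Partition_asymptotics.

(** * Short increments and the first difference *)

Section Increments.
Context {R : realType}.
Implicit Types (x y t w u : R) (m : R) (K n i h : nat) (j : nat -> nat).

(** n saddle n = rate sqrt n, and growth n is of order e^(2 rate sqrt n) / n. *)
Definition rate : R := pi / Num.sqrt 6.

Lemma rate_gt0 : 0 < rate.
Proof. by rewrite divr_gt0 ?pi_gt0// sqrtr_gt0. Qed.

Lemma saddleE n : (0 < n)%N -> saddle n = rate / Num.sqrt n%:R.
Proof.
move=> n0; rewrite /saddle /rate sqrtrM ?divr_ge0 ?sqr_ge0// sqrtrV//.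
by rewrite sqrtrM ?sqr_ge0// sqrtrV// sqrtr_sqr ger0_norm// ltW// pi_gt0.
Qed.

Lemma natr_saddle n : (0 < n)%N -> n%:R * saddle n = rate * Num.sqrt n%:R.
Proof.
move=> n0; have q0 : 0 < Num.sqrt n%:R :> R by rewrite sqrtr_gt0 ltr0n.
rewrite saddleE// -{1}[n%:R]sqr_sqrtr//; move: (Num.sqrt n%:R) q0 => q q0; field.
by rewrite gt_eqF.
Qed.

Lemma near_sqrt_gt0 : \forall n \near \oo, 0 < Num.sqrt n%:R :> R.
Proof. by exists 1%N => // n /= n0; rewrite sqrtr_gt0 ltr0n. Qed.

Lemma cvg_inv_sqrt : (Num.sqrt n%:R)^-1 @[n --> \oo] --> (0 : R).
Proof.
have := cvg_sqrt_seq (@cvg_inv_natr R); rewrite sqrtr0 => /cvg_eventually; apply.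
by apply: nearW => n; rewrite sqrtrV.
Qed.

Section Shifted.
Variables (j : nat -> nat) (y : R).
Hypothesis jy : ((j n)%:R - n%:R) / Num.sqrt n%:R @[n --> \oo] --> y.

Lemma shift_ratio_cvg : (j n)%:R / n%:R @[n --> \oo] --> (1 : R).
Proof.
have := cvgD_seq (cvgM_seq jy cvg_inv_sqrt) (@cvg_cst_seq R 1).
rewrite mulr0 add0r => /cvg_eventually; apply; near=> n.
have q0 : 0 < Num.sqrt n%:R :> R by near: n; exact: near_sqrt_gt0.
have n0 : 0 < n%:R :> R by near: n; exact: nbhs_infty_gt0.
rewrite -mulrA -invfM -expr2 sqr_sqrtr//; field.
by rewrite gt_eqF.
Unshelve. all: by end_near. Qed.

Lemma shift_cvgy : j n @[n --> \oo] --> \oo.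
Proof.
apply/cvgnyPge => K; near=> n.
have h : 2^-1 <= (j n)%:R / n%:R :> R.
  by near: n; apply: (cvgr_ge _ shift_ratio_cvg); rewrite invf_lt1// ltr1n.
have n0 : 0 < n%:R :> R by near: n; exact: nbhs_infty_gt0.
rewrite ler_pdivlMr// in h.
have Kn : (2 * K <= n)%N by near: n; exists (2 * K)%N.
rewrite -(ler_nat R); move: Kn; rewrite -(ler_nat R) natrM; lra.
Unshelve. all: by end_near. Qed.

(** The increment of the square root is (j - n) / (sqrt j + sqrt n). *)
Lemma shift_sqrt_cvg : Num.sqrt (j n)%:R - Num.sqrt n%:R @[n --> \oo] --> y / 2.
Proof.
have r1 := cvg_sqrt_seq shift_ratio_cvg; rewrite sqrtr1 in r1.
have r2 := cvgD_seq r1 (@cvg_cst_seq R 1).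
have := cvgM_seq jy (cvgV_seq _ r2); rewrite -[1 + 1]/2 => /(_ _)/cvg_eventually; apply.
  by rewrite pnatr_eq0.
near=> n.
have q0 : 0 < Num.sqrt n%:R :> R by near: n; exact: near_sqrt_gt0.
have p0 : 0 <= Num.sqrt (j n)%:R :> R by rewrite sqrtr_ge0.
have qn : Num.sqrt n%:R ^+ 2 = n%:R :> R by rewrite sqr_sqrtr.
have pj : Num.sqrt (j n)%:R ^+ 2 = (j n)%:R :> R by rewrite sqr_sqrtr.
rewrite sqrtrM// sqrtrV//.
have -> : (j n)%:R - n%:R = Num.sqrt (j n)%:R ^+ 2 - Num.sqrt n%:R ^+ 2 :> R by rewrite qn pj.
move: (Num.sqrt (j n)%:R) (Num.sqrt n%:R) p0 q0 => p q p0 q0; field.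
by rewrite !gt_eqF//; lra.
Unshelve. all: by end_near. Qed.

Lemma growth_shift_cvg : growth (j n) / growth n @[n --> \oo] --> expR (rate * y).
Proof.
have e1 := cvg_expR_seq (cvgMl_seq (k := 2 * rate) shift_sqrt_cvg).
have one0 : 1 != 0 :> R by exact: oner_neq0.
have := cvgM_seq e1 (cvgV_seq one0 shift_ratio_cvg).
have -> : expR (2 * rate * (y / 2)) * 1^-1 = expR (rate * y).
  by rewrite invr1 mulr1; congr expR; field.
move=> /cvg_eventually; apply; near=> n.
have n0 : (0 < n)%N by near: n; exists 1%N.
have j0 : (0 < j n)%N by near: n; move/cvgnyPge : shift_cvgy; apply.
have -> : expR (2 * rate * (Num.sqrt (j n)%:R - Num.sqrt n%:R)) =
    expR (2 * ((j n)%:R * saddle (j n))) / expR (2 * (n%:R * saddle n)).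
  by rewrite -expRN -expRD !natr_saddle//; congr expR; ring.
have nR : 0 < n%:R :> R by rewrite ltr0n.
have jR : 0 < (j n)%:R :> R by rewrite ltr0n.
have s3 : 0 < Num.sqrt 3 :> R by rewrite sqrtr_gt0.
rewrite /growth; have := expR_gt0 (2 * ((j n)%:R * saddle (j n)) : R).
have := expR_gt0 (2 * (n%:R * saddle n) : R).
move: (expR _) (expR _) (Num.sqrt 3) s3 => a b s s0 a0 b0; field.
by rewrite !gt_eqF.
Unshelve. all: by end_near. Qed.

Lemma npart_shift_cvg : (npart (j n))%:R / growth n @[n --> \oo] --> expR (rate * y).
Proof.
have h : (npart (j n))%:R / growth (j n) @[n --> \oo] --> (1 : R).
  exact: (cvg_comp _ _ shift_cvgy (@npart_asymp R)).
have := cvgM_seq h growth_shift_cvg; rewrite mul1r => /cvg_eventually; apply; near=> n.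
have g0 : 0 < growth (j n) :> R.
  apply: growth_gt0; near: n; move/cvgnyPge : shift_cvgy; apply.
by rewrite mulrA divfK// gt_eqF.
Unshelve. all: by end_near. Qed.

End Shifted.

(** The bounds themselves only become sharp in a second limit. *)
Lemma squeeze_limits (u : nat -> R) (lo hi : nat -> R) (l : R) :
    lo k @[k --> \oo] --> l -> hi k @[k --> \oo] --> l ->
    (forall k, \forall n \near \oo, lo k - k.+1%:R^-1 <= u n <= hi k + k.+1%:R^-1) ->
  u n @[n --> \oo] --> l.
Proof.
move=> lol hil H; suff E (e : R) : 0 < e -> \forall n \near \oo, `|l - u n| <= e by exact/cvgrPdist_le.
move=> e0.
have h1 : \forall k \near \oo, k.+1%:R^-1 <= e / 2 :> R.
  have := @cvg_inv_natr R; rewrite -(cvg_shiftS (fun n : nat => n%:R^-1 : R)) => c.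
  by apply: (cvgr_le _ c); rewrite divr_gt0.
have e2 : 0 < e / 2 by rewrite divr_gt0.
have [k [k1 k2 k3]] : exists k, [/\ k.+1%:R^-1 <= e / 2, `|l - lo k| <= e / 2 & `|l - hi k| <= e / 2].
  near (@nbhs nat _ \oo) => k; exists k; split.
  - by near: k.
  - by near: k; move/cvgrPdist_le : lol; apply.
  - by near: k; move/cvgrPdist_le : hil; apply.
apply: filterS (H k) => n /andP[u1 u2].
move: k2 k3; rewrite !ler_norml => /andP[a1 a2] /andP[b1 b2].
move: (k.+1%:R^-1) (lo k) (hi k) (u n) k1 u1 u2 a1 a2 b1 b2 => v a b c k1 u1 u2 a1 a2 b1 b2.
by apply/andP; split; lra.
Unshelve. all: by end_near. Qed.

Lemma npartB_no1 n h : (npart (n + h) = npart n + \sum_(0 <= i < h) npart_no1 (n + i).+1)%N.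
Proof.
elim: h => [|h IH]; first by rewrite big_geq// !addn0.
by rewrite big_nat_recr//= addnS npartS IH addnA.
Qed.

Lemma no1_le_increment n h : (h * npart_no1 n <= npart (n.+1 + h) - npart n.+1)%N.
Proof.
rewrite npartB_no1 addKn -[X in (X * _)%N]subn0 -sum_nat_const_nat leq_sum// => i _.
by rewrite addSn -!addnS; exact: npart_no1_leD.
Qed.

(** Together with [no1_le_increment], this compares a value of npart_no1 with
    its sum over h consecutive indices; the shifts by 2 come from
    [npart_no1_leD]. *)
Lemma increment_le_no1 n h : (npart (n + h) - npart n <= h * npart_no1 (n + h).+2)%N.
Proof.
rewrite npartB_no1 addKn -[X in (X * _)%N]subn0 -sum_nat_const_nat !big_nat leq_sum// => i /andP[_ ih].
have -> : ((n + h).+2 = (n + i).+1 + (h - i).+1)%N by lia.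
by apply: npart_no1_leD; lia.
Qed.

(** A positive number of steps, equivalent to x sqrt n. *)
Definition steps (x : R) n := (Num.truncn (x * Num.sqrt n%:R)).+1.

Lemma steps_bounds x n : 0 <= x ->
  x * Num.sqrt n%:R <= (steps x n)%:R <= x * Num.sqrt n%:R + 1.
Proof.
move=> x0; have xs : 0 <= x * Num.sqrt n%:R by rewrite mulr_ge0// sqrtr_ge0.
by have /andP[h1 h2] := truncn_itv xs; rewrite /steps (ltW h2)/= -natr1 lerD2r.
Qed.

Lemma steps_cvg x : 0 <= x -> (steps x n)%:R / Num.sqrt n%:R @[n --> \oo] --> x.
Proof.
move=> x0; have h : x + (Num.sqrt n%:R)^-1 @[n --> \oo] --> x.
  by have := cvgD_seq (@cvg_cst_seq R x) cvg_inv_sqrt; rewrite addr0.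
apply: (squeeze_cvgr _ (@cvg_cst_seq R x) h); near=> n.
have q0 : 0 < Num.sqrt n%:R :> R by near: n; exact: near_sqrt_gt0.
have /andP[h1 h2] := steps_bounds n x0.
rewrite ler_pdivlMr// h1/= ler_pdivrMr// (le_trans h2)// mulrDl mulVf// gt_eqF//.
Unshelve. all: by end_near. Qed.

(** Averages of npart_no1 over e sqrt n indices on either side of j n bound its
    value; they are increments of npart, of limit
    (e^(rate (y + e)) - e^(rate y)) / e and
    (e^(rate y) - e^(rate (y - e))) / e. Both tend to the derivative with e. *)
Theorem no1_shift_cvg j y : ((j n)%:R - n%:R) / Num.sqrt n%:R @[n --> \oo] --> y ->
  (npart_no1 (j n))%:R * Num.sqrt n%:R / growth n @[n --> \oo] --> rate * expR (rate * y).
Proof.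
move=> jy; have c0 := rate_gt0.
have sh (a : nat) : ((j n + a)%:R - n%:R) / Num.sqrt n%:R @[n --> \oo] --> y.
  have := cvgD_seq jy (cvgMl_seq (k := a%:R) cvg_inv_sqrt).
  rewrite mulr0 addr0 => /cvg_eventually; apply; apply: nearW => n.
  by rewrite natrD; ring.
have vcvg : k.+1%:R^-1 @[k --> \oo] --> (0 : R).
  by have := @cvg_inv_natr R; rewrite -(cvg_shiftS (fun n : nat => n%:R^-1 : R)).
pose lo k := expR (rate * y) * (rate - rate ^+ 2 / 2 * k.+1%:R^-1).
pose hi k := expR (rate * y) * (rate * expR (rate * k.+1%:R^-1)).
apply: (@squeeze_limits _ lo hi).
- have := cvgMl_seq (k := expR (rate * y)) (cvgB_seq (@cvg_cst_seq R rate) (cvgMl_seq (k := rate ^+ 2 / 2) vcvg)).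
  by rewrite mulr0 subr0 (mulrC (expR _) rate).
- have := cvgMl_seq (k := expR (rate * y)) (cvgMl_seq (k := rate) (cvg_expR_seq (cvgMl_seq (k := rate) vcvg))).
  by rewrite mulr0 expR0 mulr1 (mulrC (expR _) rate).
move=> k; rewrite /lo /hi; have : 0 < k.+1%:R^-1 :> R by rewrite invr_gt0.
move: (k.+1%:R^-1 : R) => e e0.
have hc := steps_cvg (ltW e0).
have up : ((npart ((j n).+1 + steps e n))%:R / growth n - (npart (j n).+1)%:R / growth n)
   / ((steps e n)%:R / Num.sqrt n%:R) @[n --> \oo] --> (expR (rate * (y + e)) - expR (rate * y)) / e.
  apply: cvgM_seq; last by apply: cvgV_seq => //; rewrite gt_eqF.
  apply: cvgB_seq.
    apply: (@npart_shift_cvg (fun n => (j n).+1 + steps e n)%N).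
    have := cvgD_seq (sh 1) hc; move/cvg_eventually; apply; apply: nearW => n.
    by rewrite natrD addn1; ring.
  apply: (@npart_shift_cvg (fun n => (j n).+1)).
  by have := sh 1; move/cvg_eventually; apply; apply: nearW => n; rewrite addn1.
have j2 : \forall n \near \oo, (2 <= j n)%N by move/cvgnyPge : (shift_cvgy jy); apply.
have s2 : ((j n - 2)%:R - n%:R) / Num.sqrt n%:R @[n --> \oo] --> y.
  have := cvgB_seq jy (cvgMl_seq (k := 2) cvg_inv_sqrt); rewrite mulr0 subr0.
  move/cvg_eventually; apply; apply: filterS j2 => n j2; rewrite natrB//; ring.
have jbig : \forall n \near \oo, (2 + steps e n <= j n)%N.
  have h1 := shift_ratio_cvg s2; near=> n.
  have j2n : (2 <= j n)%N by near: n.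
  rewrite -leq_subRL//.
  have q0 : 0 < Num.sqrt n%:R :> R by near: n; exact: near_sqrt_gt0.
  have n0 : 0 < n%:R :> R by near: n; exact: nbhs_infty_gt0.
  have a1 : (steps e n)%:R / Num.sqrt n%:R <= e + 1.
    by near: n; apply: (cvgr_le _ hc); rewrite ltrDl.
  have a2 : 2^-1 <= (j n - 2)%:R / n%:R :> R.
    by near: n; apply: (cvgr_ge _ h1); rewrite invf_lt1// ltr1n.
  have a3 : (Num.sqrt n%:R)^-1 <= (2 * (e + 1))^-1 :> R.
    by near: n; apply: (cvgr_le _ cvg_inv_sqrt); rewrite invr_gt0 mulr_gt0// addr_gt0.
  rewrite -(ler_nat R); rewrite ler_pdivrMr// in a1; rewrite ler_pdivlMr// in a2.
  rewrite lef_pV2 ?posrE// ?mulr_gt0// ?addr_gt0// in a3.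
  have := sqr_sqrtr (ler0n R n); move: (Num.sqrt n%:R) a3 q0 a1 => q a3 q0 a1 qn.
  apply: (le_trans a1); apply: (le_trans _ a2); rewrite -qn; nra.
have dn : ((npart (j n - 2))%:R / growth n - (npart (j n - 2 - steps e n))%:R / growth n)
   / ((steps e n)%:R / Num.sqrt n%:R) @[n --> \oo] --> (expR (rate * y) - expR (rate * (y - e))) / e.
  apply: cvgM_seq; last by apply: cvgV_seq => //; rewrite gt_eqF.
  apply: cvgB_seq; first exact: npart_shift_cvg s2.
  apply: (@npart_shift_cvg (fun n => j n - 2 - steps e n)%N).
  have := cvgB_seq s2 hc; move/cvg_eventually; apply.
  by apply: filterS jbig => n jn; rewrite [(j n - 2 - _)%:R]natrB ?leq_subRL ?(leq_trans _ jn)//; ring.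
have near_up : \forall n \near \oo, ((npart ((j n).+1 + steps e n))%:R / growth n
    - (npart (j n).+1)%:R / growth n) / ((steps e n)%:R / Num.sqrt n%:R)
    <= (expR (rate * (y + e)) - expR (rate * y)) / e + e.
  by apply: (cvgr_le _ up); rewrite ltrDl.
have near_dn : \forall n \near \oo, (expR (rate * y) - expR (rate * (y - e))) / e - e <=
    ((npart (j n - 2))%:R / growth n - (npart (j n - 2 - steps e n))%:R / growth n)
    / ((steps e n)%:R / Num.sqrt n%:R).
  by apply: (cvgr_ge _ dn); rewrite gtrBl.
have E0 := expR_gt0 (rate * y); have ce : 0 <= rate * e by rewrite mulr_ge0// ltW.
near=> n.
have q0 : 0 < Num.sqrt n%:R :> R by near: n; exact: near_sqrt_gt0.
have g0 : 0 < growth n :> R by near: n; exact: near_growth_gt0.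
have st : 0 < (steps e n)%:R :> R by rewrite ltr0n.
have qg : 0 < Num.sqrt n%:R / growth n :> R by rewrite divr_gt0.
have sc (a b : R) : (a / growth n - b / growth n) / ((steps e n)%:R / Num.sqrt n%:R) =
    (a - b) / (steps e n)%:R * (Num.sqrt n%:R / growth n).
  move: (growth n) (Num.sqrt n%:R) g0 q0 st {qg} => g q g0 q0 st; field.
  by rewrite !gt_eqF.
apply/andP; split.
  apply: (@le_trans _ _ ((expR (rate * y) - expR (rate * (y - e))) / e - e)).
    have -> : expR (rate * (y - e)) = expR (rate * y) * expR (- (rate * e)).
      by rewrite -expRD; congr expR; ring.
    rewrite lerD2r ler_pdivlMr//.
    have := expRN_le1B ce; move: (expR (- _)) (expR (rate * y)) E0 => a b b0 h.
    have := ler_wpM2l (ltW b0) h; lra.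
  apply: (@le_trans _ _ (((npart (j n - 2))%:R / growth n - (npart (j n - 2 - steps e n))%:R / growth n)
    / ((steps e n)%:R / Num.sqrt n%:R))); first by near: n.
  have jn : (2 + steps e n <= j n)%N by near: n.
  have := increment_le_no1 (j n - 2 - steps e n) (steps e n).
  have -> : (j n - 2 - steps e n + steps e n = j n - 2)%N by lia.
  have -> : ((j n - 2).+2 = j n)%N by lia.
  rewrite leq_subLR -(ler_nat R) natrD natrM => h.
  by rewrite sc -[_ * Num.sqrt n%:R / _]mulrA ler_pM2r// ler_pdivrMr//; lra.
apply: (@le_trans _ _ ((expR (rate * (y + e)) - expR (rate * y)) / e + e)); last first.
  rewrite lerD2r ler_pdivrMr// mulrDr expRD.
  have e1 : expR (rate * e) - 1 <= rate * e * expR (rate * e).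
    have h : 1 - rate * e <= expR (- (rate * e)) by exact: expR_ge1Dx.
    have := ler_wpM2r (expR_ge0 (rate * e)) h; rewrite -expRD addNr expR0; lra.
  have := ler_wpM2l (ltW E0) e1; lra.
apply: (@le_trans _ _ (((npart ((j n).+1 + steps e n))%:R / growth n
    - (npart (j n).+1)%:R / growth n) / ((steps e n)%:R / Num.sqrt n%:R))); last by near: n.
have := no1_le_increment (j n) (steps e n).
rewrite leq_subRL; last by rewrite npartB_no1 leq_addr.
rewrite -(ler_nat R) natrD natrM => h.
by rewrite sc -[_ * Num.sqrt n%:R / _]mulrA ler_pM2r// ler_pdivlMr//; lra.
Unshelve. all: by end_near. Qed.

Fact subn3_addK n i h : (i <= n)%N -> (n + (3 + h) = (n - i).+3 + h + i)%N.
Proof. lia. Qed.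

Fact subn3_add n i h : (i <= n)%N -> (3 + h < i)%N -> ((n - i).+3 + h = n - (i - (3 + h)))%N.
Proof. lia. Qed.

Lemma npart_leD n h : (npart n <= npart (n + h))%N.
Proof. by rewrite npartB_no1 leq_addr. Qed.

(** An average over about sqrt n indices is at most npart at a slightly larger
    index, where [npart_tilted_le] applies, or [npart_shift_cvg] if that index
    exceeds n. Moving by sqrt n changes the exponential by a bounded factor. *)
Theorem no1_tilted_le : exists2 C : R, 0 <= C & \forall n \near \oo, forall i, (i <= n)%N ->
  (npart_no1 (n - i).+2)%:R * Num.sqrt n%:R / growth n <= C * expR (- (i%:R * saddle n)).
Proof.
have [C pC] := @npart_tilted_le R; have c0 := rate_gt0.
pose E := expR (rate * 1) + 1; have E0 : 0 <= E by rewrite addr_ge0// expR_ge0.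
exists ((`|C| + E) * expR (5 * rate)); first by rewrite mulr_ge0 ?expR_ge0// addr_ge0.
have up : (npart (n + (3 + steps 1 n)))%:R / growth n @[n --> \oo] --> expR (rate * 1).
  apply: (@npart_shift_cvg (fun n => n + (3 + steps 1 n))%N).
  have := cvgD_seq (cvgMl_seq (k := 3) cvg_inv_sqrt) (steps_cvg (@ler01 R)).
  rewrite mulr0 add0r => /cvg_eventually; apply; apply: nearW => n.
  by rewrite !natrD; ring.
have near_up : \forall n \near \oo, (npart (n + (3 + steps 1 n)))%:R / growth n <= E.
  by apply: (cvgr_le _ up); rewrite ltrDl.
near=> n => i ni.
have nu : (npart (n + (3 + steps 1 n)))%:R / growth n <= E by near: n.
have pCn : forall i, (i <= n)%N -> (npart (n - i))%:R <= C * (expR (- (i%:R * saddle n)) * growth n).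
  by near: n.
have n0 : (0 < n)%N by near: n; exists 1%N.
have q1 : 1 <= Num.sqrt n%:R :> R by rewrite -[leLHS]sqrtr1 ler_wsqrtr// ler1n.
have q0 : 0 < Num.sqrt n%:R :> R by lra.
have g0 : 0 < growth n :> R by exact: growth_gt0.
set h := steps 1 n; have st : 0 < h%:R :> R by rewrite ltr0n.
have /andP[h1 h2] := steps_bounds n (@ler01 R); rewrite -/h mul1r in h1 h2.
have ht : (3 + h)%:R * saddle n <= 5 * rate.
  rewrite saddleE// mulrA ler_pdivrMr// natrD.
  have : 3 + h%:R <= 5 * Num.sqrt n%:R :> R by lra.
  by move=> /(ler_wpM2r (ltW c0)); lra.
have b1 := no1_le_increment (n - i).+2 h.
have {b1}b2 : h%:R * (npart_no1 (n - i).+2)%:R <= (npart ((n - i).+3 + h))%:R :> R.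
  by rewrite -natrM ler_nat (leq_trans b1)// leq_subr.
apply: (@le_trans _ _ ((npart ((n - i).+3 + h))%:R / growth n)).
  rewrite ler_pM2r ?invr_gt0//; apply: le_trans b2.
  by rewrite mulrC ler_wpM2r.
have ee : 0 < expR (- (i%:R * saddle n)) :> R by exact: expR_gt0.
have [ih|ih] := leqP i (3 + h).
  have le1 : 1 <= expR (5 * rate) * expR (- (i%:R * saddle n)).
    rewrite -expRD -[leLHS]expR0 ler_expR; have : i%:R * saddle n <= (3 + h)%:R * saddle n :> R.
      by rewrite ler_wpM2r ?ler_nat// ltW// saddle_gt0.
    lra.
  apply: (@le_trans _ _ ((npart (n + (3 + h)))%:R / growth n)).
    rewrite ler_pM2r ?invr_gt0// ler_nat.
    rewrite (subn3_addK _ ni); exact: npart_leD.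
  apply: (le_trans nu).
  rewrite -mulrA; apply: (@le_trans _ _ (E * (expR (5 * rate) * expR (- (i%:R * saddle n))))).
    by rewrite ler_peMr.
  by rewrite ler_wpM2r ?mulr_ge0 ?expR_ge0// lerDr.
rewrite (subn3_add ni ih).
rewrite ler_pdivrMr//.
apply: (le_trans (pCn _ _)); first by rewrite (leq_trans (leq_subr _ _)).
rewrite mulrA ler_pM2r//.
have eB : expR (- ((i - (3 + h))%:R * saddle n)) <= expR (5 * rate) * expR (- (i%:R * saddle n)).
  by rewrite -expRD ler_expR natrB ?(ltnW ih)//; lra.
apply: (@le_trans _ _ (`|C| * expR (- ((i - (3 + h))%:R * saddle n)))).
  by rewrite ler_wpM2r ?expR_ge0// ler_norm.
apply: (@le_trans _ _ (`|C| * (expR (5 * rate) * expR (- (i%:R * saddle n))))).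
  by rewrite ler_wpM2l.
by rewrite -mulrA ler_wpM2r ?mulr_ge0 ?expR_ge0// lerDl.
Unshelve. all: by end_near. Qed.

End Increments.

(** * The Gamma function, and Riemann sums over quadratic cells *)

Section Gamma_function.
Context {R : realType}.
Implicit Types (x y t a b z : R) (n : nat).
Local Notation mu := (@lebesgue_measure R).
Local Notation mR := (measurableTypeR R).

Definition gamma_fun z t : R := t `^ z * expR (- t).

Lemma gamma_fun_ge0 z t : 0 <= gamma_fun z t.
Proof. by rewrite mulr_ge0 ?powR_ge0 ?expR_ge0. Qed.

Lemma gamma_fun_is_derive z t : 0 < t ->
  is_derive t 1 (gamma_fun z) (z * gamma_fun (z - 1) t - gamma_fun z t).
Proof.
move=> t0; have d1 := is_derive1_powR z t0.
have d2 : is_derive t 1 (fun t => expR (- t)) (- expR (- t)) by is_derive_ring.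
by apply: is_derive_eq; rewrite /GRing.scale/= /gamma_fun; ring.
Qed.

Lemma gamma_fun_continuous z t : 0 < t -> {for t, continuous (gamma_fun z)}.
Proof.
move=> t0; apply: differentiable_continuous; apply/derivable1_diffP.
by have [] := gamma_fun_is_derive z t0.
Qed.

Lemma measurable_gamma_fun z : measurable_fun [set: mR] (gamma_fun z : mR -> R).
Proof.
apply: measurable_funM; first exact: measurable_powR.
by apply: continuous_measurable_fun => x; apply: continuous_comp; [exact: opp_continuous|exact: continuous_expR].
Qed.

(** The left ends e^-n make the boundary terms geometric in n. *)
Definition exhaust n : interval R := `[expR (- n%:R), n.+1%:R].

Lemma exhaust_le n : expR (- n%:R) <= n.+1%:R :> R.
Proof. by rewrite (@le_trans _ _ 1) ?expR_le1 ?oppr_le0// ler1n. Qed.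

Lemma integrable_exhaust z n : mu.-integrable [set` exhaust n] (EFin \o gamma_fun z).
Proof.
apply: continuous_compact_integrable; first exact: segment_compact.
apply: continuous_in_subspaceT => x; rewrite inE/= in_itv/= => /andP[h _].
exact: gamma_fun_continuous (lt_le_trans (expR_gt0 _) h).
Qed.

Lemma bigcup_exhaust : \bigcup_n [set` exhaust n] = `]0, +oo[%classic :> set R.
Proof.
apply/seteqP; split => [x [n _]|x]; rewrite /= !in_itv/= andbT.
  by move=> /andP[h _]; rewrite (lt_le_trans (expR_gt0 _) h).
move=> x0; pose n := (Num.truncn (Num.max x (- ln x))).+1.
exists n => //=; rewrite in_itv/=.
have := truncnS_gt (Num.max x (- ln x)); rewrite -/n gt_max => /andP[h1 h2].
apply/andP; split; last by rewrite (le_trans (ltW h1))// ler_nat.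
by rewrite -[leRHS](lnK (x := x)) ?posrE// ler_expR lerNl ltW.
Qed.

(** Monotone convergence, in the extended reals: integrability near 0 and at
    infinity is not an issue. *)
Lemma gamma_exhaust_cvg z :
  (\int[mu]_(t in [set` exhaust n]) gamma_fun z t)%:E @[n --> \oo]
    --> (\int[mu]_(t in `]0%R, +oo[) (gamma_fun z t)%:E)%E.
Proof.
have fin n : (\int[mu]_(t in [set` exhaust n]) (gamma_fun z t)%:E)%E =
    (\int[mu]_(t in [set` exhaust n]) gamma_fun z t)%:E.
  by rewrite /Rintegral fineK//; apply: integrable_fin_num => //; exact: integrable_exhaust.
under eq_fun do rewrite -fin.
rewrite -bigcup_exhaust.
apply: (@ge0_nondecreasing_set_cvg_integral _ mR R (fun n => [set` exhaust n]) (EFin \o gamma_fun z) mu).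
- move=> n m nm; apply/subsetPset => x; rewrite /= !in_itv/= => /andP[h1 h2].
  rewrite (le_trans _ h1) ?ler_expR ?lerN2 ?ler_nat//=.
  by rewrite (le_trans h2)// ler_nat.
- by move=> n; exact: measurable_itv.
- by move=> n; apply/measurable_EFinP; apply: measurable_funTS; exact: measurable_gamma_fun.
- by move=> n x _; rewrite lee_fin gamma_fun_ge0.
Qed.

Lemma gamma_fun_boundary0 z : 0 < z -> gamma_fun z (expR (- n%:R)) @[n --> \oo] --> (0 : R).
Proof.
move=> z0; apply: (@squeeze_cvg0 _ _ (fun n => expR (- z) ^+ n)); last first.
  by apply: cvg_expr; rewrite ger0_norm ?expR_ge0// expR_lt1 oppr_lt0.
apply: nearW => n; rewrite ger0_norm ?gamma_fun_ge0// /gamma_fun.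
rewrite /powR gt_eqF ?expR_gt0// expRK -expRM_natl -[leRHS]mulr1 ler_pM ?expR_ge0//.
  by rewrite ler_expR le_eqVlt; apply/orP; left; apply/eqP; ring.
Qed.

Lemma gamma_fun_boundaryy z : gamma_fun z n.+1%:R @[n --> \oo] --> (0 : R).
Proof.
pose k := (Num.truncn z).+1.
have b0 : k.+1`!%:R * n.+1%:R^-1 @[n --> \oo] --> (0 : R).
  rewrite -[X in _ --> X](mulr0 (k.+1`!%:R)); apply: cvgMl_seq.
  by have := @cvg_inv_natr R; rewrite -(cvg_shiftS (fun n : nat => n%:R^-1 : R)).
apply: (@squeeze_cvg0 _ _ _ _ b0); apply: nearW => n.
have x0 : 0 < n.+1%:R :> R by rewrite ltr0n.
rewrite ger0_norm ?gamma_fun_ge0// /gamma_fun ler_pdivlMr//.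
have := @pow_expRN_le R n.+1%:R k.+1 (ltW x0); apply: le_trans.
rewrite exprSr mulrAC ler_wpM2r ?(ltW x0)// ler_wpM2r ?expR_ge0//.
rewrite -powR_mulrn ?(ltW x0)// ler_powR ?ler1n//.
by rewrite ltW// truncnS_gt.
Qed.

Lemma gamma_exhaust_parts z n :
  z * \int[mu]_(t in [set` exhaust n]) gamma_fun (z - 1) t
  - \int[mu]_(t in [set` exhaust n]) gamma_fun z t
  = gamma_fun z n.+1%:R - gamma_fun z (expR (- n%:R)).
Proof.
rewrite -RintegralZl//; last exact: integrable_exhaust.
rewrite -RintegralB//; last 2 first.
- have := @integrableZl _ _ R mu [set` exhaust n] (measurable_itv _) z _ (integrable_exhaust (z - 1) n).
  by apply: eq_integrable => // x _ /=; rewrite EFinM.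
- exact: integrable_exhaust.
apply: (@Rintegral_derive_in R (gamma_fun z)).
- exact: exhaust_le.
- move=> x /andP[h _]; have x0 := lt_le_trans (expR_gt0 _) h.
  by apply: cvgB; [apply: cvgMl_tmp|]; exact: gamma_fun_continuous.
- by move=> x /andP[h _]; apply: gamma_fun_is_derive; exact: lt_le_trans (expR_gt0 _) h.
Qed.

Lemma GammaE z : Gamma z = \int[mu]_(t in `]0, +oo[) gamma_fun (z - 1) t.
Proof. by []. Qed.

(** Integration by parts on the intervals of [bigcup_exhaust]; the boundary
    terms vanish in the limit. *)
Theorem Gamma_succ z : 0 < z -> Gamma (z + 1) = z * Gamma z.
Proof.
move=> z0; rewrite !GammaE addrK /Rintegral.
have c1 := @gamma_exhaust_cvg (z - 1); have c2 := @gamma_exhaust_cvg z.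
have b : (gamma_fun z n.+1%:R - gamma_fun z (expR (- n%:R)))%:E @[n --> \oo] --> 0%:E.
  apply: cvg_EFin; first exact: nearW.
  have := cvgB_seq (gamma_fun_boundaryy z) (gamma_fun_boundary0 z0).
  by rewrite subr0.
have e1 : (z%:E * (\int[mu]_(t in [set` exhaust n]) gamma_fun (z - 1) t)%:E)%E @[n --> \oo]
   --> (z%:E * \int[mu]_(t in `]0%R, +oo[) (gamma_fun (z - 1) t)%:E)%E by apply: cvgeZl c1.
have e2 : ((\int[mu]_(t in [set` exhaust n]) gamma_fun z t)%:E
    + (gamma_fun z n.+1%:R - gamma_fun z (expR (- n%:R)))%:E)%E @[n --> \oo]
   --> (\int[mu]_(t in `]0%R, +oo[) (gamma_fun z t)%:E + 0%:E)%E.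
  by apply: cvgeD => //; rewrite fin_num_adde_defl.
have E : (z%:E * \int[mu]_(t in `]0%R, +oo[) (gamma_fun (z - 1) t)%:E =
    \int[mu]_(t in `]0%R, +oo[) (gamma_fun z t)%:E)%E.
  rewrite -[RHS]adde0; apply: (cvg_unique _ e1) => //.
  rewrite (_ : (fun n => _) = (fun n => (\int[mu]_(t in [set` exhaust n]) gamma_fun z t)%:E
    + (gamma_fun z n.+1%:R - gamma_fun z (expR (- n%:R)))%:E)%E) //.
  by apply/funext => n; rewrite -EFinM -EFinD -gamma_exhaust_parts; congr EFin; ring.
rewrite -E; case: (\int[mu]_(t in `]0%R, +oo[) (gamma_fun (z - 1) t)%:E)%E => [r| |] //=.
  by rewrite gt0_muley ?lte_fin//= mulr0.
by rewrite gt0_muleNy ?lte_fin//= mulr0.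
Qed.

Theorem Gamma1 : Gamma 1 = 1 :> R.
Proof.
rewrite GammaE subrr /Rintegral.
have c := @gamma_exhaust_cvg 0.
have e : (expR (- expR (- n%:R)) - expR (- n.+1%:R))%:E @[n --> \oo] --> (1 : R)%:E.
  have z1 := @cvg_inv_natr R.
  have q1 : expR (-1) < 1 :> R by rewrite expR_lt1 oppr_lt0.
  have c0 : expR (- n%:R) @[n --> \oo] --> (0 : R).
    have : expR (- 1 : R) ^+ n @[n --> \oo] --> (0 : R) by apply: cvg_expr; rewrite ger0_norm ?expR_ge0.
    by move/cvg_eventually; apply; apply: nearW => n; rewrite -expRM_natl mulrN1.
  have c1 : expR (- n.+1%:R) @[n --> \oo] --> (0 : R).
    by move: c0; rewrite -(cvg_shiftS (fun n : nat => expR (- n%:R) : R)).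
  apply: cvg_EFin; first exact: nearW.
  have := cvgB_seq (cvg_expR_seq (cvgMl_seq (k := -1) c0)) c1.
  rewrite mulr0 expR0 subr0 => /cvg_eventually; apply.
  by apply: nearW => n; rewrite mulN1r.
rewrite (_ : (\int[mu]_(t in `]0%R, +oo[) (gamma_fun 0 t)%:E)%E = 1%:E)//.
apply: (cvg_unique _ c) => //.
rewrite (_ : (fun n => _) = (fun n => (expR (- expR (- n%:R)) - expR (- n.+1%:R))%:E))//.
apply/funext => n; congr EFin.
under eq_Rintegral do rewrite /gamma_fun powRr0 mul1r.
have D (t : R) : is_derive t 1 (fun t : R => - expR (- t)) (expR (- t)) by is_derive_ring.
have -> : expR (- expR (- n%:R)) - expR (- n.+1%:R) = - expR (- n.+1%:R) - - expR (- expR (- n%:R)) :> R.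
  by rewrite opprK addrC.
apply: (@Rintegral_derive_in R (fun t => - expR (- t)) (fun t => expR (- t))) => //.
- exact: exhaust_le.
- by move=> x _; apply: continuous_comp; [exact: opp_continuous|exact: continuous_expR].
Qed.

End Gamma_function.

Section Quadratic_steps.
Context {R : realType}.
Implicit Types (x d : R) (n j k N : nat) (c : nat -> R).
Local Notation mu := (@lebesgue_measure R).
Local Notation mR := (measurableTypeR R).

(** The cells ]d j^2, d (j + 1)^2]: when d j^2 is, up to o(1), a multiple of
    m^2 / sqrt n for m in an arithmetic progression, a sum over m is a Riemann
    sum in the variable in which the limit is the integrand of Gamma. *)
Definition in_cell d j x := d * j%:R ^+ 2 < x <= d * j.+1%:R ^+ 2.

Lemma cell_exists d x : 0 < d -> 0 < x -> exists j, in_cell d j x.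
Proof.
move=> d0 x0.
have ex : exists k, x <= d * k.+1%:R ^+ 2.
  exists (Num.truncn (x / d)).+1; rewrite mulrC -ler_pdivrMr// ltW//.
  apply: (lt_le_trans (truncnS_gt _)); apply: (@le_trans _ _ (Num.truncn (x / d)).+2%:R).
    by rewrite ler_nat.
  by rewrite ler_eXnr// ler1n.
exists (ex_minn ex); case: ex_minnP => -[|k] xk kmin; rewrite /in_cell xk andbT.
  by rewrite expr0n/= mulr0.
by rewrite ltNge; apply/negP => /kmin; rewrite ltnn.
Qed.

Lemma cell_le d j k x : 0 < d -> in_cell d j x -> in_cell d k x -> (j <= k)%N.
Proof.
move=> d0 /andP[h1 _] /andP[_ h2]; have := lt_le_trans h1 h2.
by rewrite ltr_pM2l// ltr_pXn2r ?nnegrE ?ler0n// ltr_nat.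
Qed.

Lemma cell_unique d j k x : 0 < d -> in_cell d j x -> in_cell d k x -> j = k.
Proof. by move=> d0 hj hk; apply/eqP; rewrite eqn_leq (cell_le d0 hj hk) (cell_le d0 hk hj). Qed.

Definition cell d j : set mR := `]d * j%:R ^+ 2, d * j.+1%:R ^+ 2]%classic.

Definition step_fun d N c (x : mR) : R := \sum_(0 <= j < N) c j * \1_(cell d j) x.

Lemma indic_cell d j x : \1_(cell d j) x = (in_cell d j x)%:R :> R.
Proof.
by rewrite indicE; congr (nat_of_bool _)%:R; apply/idP/idP; rewrite inE /cell /= in_itv.
Qed.

Lemma step_funE d N c j x : 0 < d -> in_cell d j x -> (forall k, (N <= k)%N -> c k = 0) ->
  step_fun d N c x = c j.
Proof.
move=> d0 hj cN; rewrite /step_fun.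
have z k : k != j -> c k * \1_(cell d k) x = 0.
  move=> kj; rewrite indic_cell; case: (boolP (in_cell d k x)) => hk; last by rewrite mulr0.
  by rewrite (cell_unique d0 hk hj) eqxx in kj.
have [jN|Nj] := ltnP j N.
  rewrite big_mkord (bigD1 (Ordinal jN))//= big1; last by move=> k; rewrite -val_eqE/=; exact: z.
  by rewrite addr0 indic_cell hj mulr1.
rewrite cN// big_nat big1// => k /andP[_ kN]; apply: z.
by rewrite neq_ltn (leq_trans kN Nj).
Qed.

Lemma step_fun_npos d N c x : 0 <= d -> x <= 0 -> step_fun d N c x = 0.
Proof.
move=> d0 x0; rewrite /step_fun big1// => k _; rewrite indic_cell /in_cell ltNge.
have -> : x <= d * k%:R ^+ 2 by rewrite (le_trans x0)// mulr_ge0// sqr_ge0.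
by rewrite mulr0.
Qed.

Lemma measurable_indic_cell d j : measurable_fun [set: mR] (\1_(cell d j) : mR -> R).
Proof. by apply: measurable_indic; exact: measurable_itv. Qed.

Lemma measurable_step_fun d N c : measurable_fun [set: mR] (step_fun d N c).
Proof.
apply: measurable_sum => j; apply: measurable_funM; first exact: measurable_cst.
exact: measurable_indic_cell.
Qed.

Lemma Rintegral_step_fun d N c : 0 <= d -> (forall j, 0 <= c j) ->
  \int[mu]_x step_fun d N c x = \sum_(0 <= j < N) c j * (d * (2 * j%:R + 1)).
Proof.
move=> d0 c0; rewrite /Rintegral /step_fun.
under eq_integral do rewrite -sumEFin.
rewrite (@ge0_integral_sum _ mR R mu setT measurableT _ (fun j x => (c j * \1_(cell d j) x)%:E)); last 2 first.
- move=> j; apply/measurable_EFinP; apply: measurable_funM; first exact: measurable_cst.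
  exact: measurable_indic_cell.
- by move=> j x _; rewrite lee_fin mulr_ge0// indic_cell.
have E j : (\int[mu]_x (c j * \1_(cell d j) x)%:E)%E = (c j * (d * (2 * j%:R + 1)))%:E.
  under eq_integral do rewrite EFinM.
  rewrite (@ge0_integralZl _ mR R mu setT measurableT (fun x => (\1_(cell d j) x)%:E)); last 3 first.
  - by apply/measurable_EFinP; exact: measurable_indic_cell.
  - by move=> x _; rewrite lee_fin indic_cell.
  - by rewrite lee_fin.
  rewrite (@integral_indic _ mR R mu setT measurableT); last exact: measurable_itv.
  rewrite setIT EFinM; congr (_ * _)%E.
  apply: (eq_trans (lebesgue_measure_itv `]d * j%:R ^+ 2, d * j.+1%:R ^+ 2])); rewrite /= lte_fin.
  have dj : d * j.+1%:R ^+ 2 - d * j%:R ^+ 2 = d * (2 * j%:R + 1) by rewrite -natr1; ring.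
  case: ifPn => [_|]; first by rewrite -dj EFinB.
  rewrite -leNgt => h; congr EFin; apply/eqP; rewrite eq_sym -dj eq_le subr_le0 h/= subr_ge0.
  by rewrite ler_wpM2l// lerXn2r ?nnegrE// ler_nat.
by rewrite (eq_bigr _ (fun j _ => E j)) sumEFin.
Qed.

(** The sum is the integral of a step function, so this is dominated
    convergence. Left-open cells keep the singular point 0 out. *)
Theorem step_sum_cvg (N : nat -> nat) (d : nat -> R) (c : nat -> nat -> R) (f G : R -> R) :
    (forall n, 0 <= d n) -> (\forall n \near \oo, 0 < d n) ->
    (forall n j, 0 <= c n j) -> (forall n j, (N n <= j)%N -> c n j = 0) ->
    mu.-integrable [set: mR] (EFin \o G) -> (forall x, 0 <= G x) ->
    (forall x, x <= 0 -> f x = 0) ->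
    (forall x (j : nat -> nat), 0 < x -> (\forall n \near \oo, in_cell (d n) (j n) x) ->
      c n (j n) @[n --> \oo] --> f x) ->
    (\forall n \near \oo, forall j x, 0 < x -> in_cell (d n) j x -> c n j <= G x) ->
  \sum_(0 <= j < N n) c n j * (d n * (2 * j%:R + 1)) @[n --> \oo] --> \int[mu]_x f x.
Proof.
move=> d0 dpos c0 cN iG G0 f0 cf cG.
have := @dominated_convergence_moving R (fun=> setT) (fun n => step_fun (d n) (N n) (c n)) f G.
move=> /(_ _ _ iG G0) h; under eq_fun do rewrite -Rintegral_step_fun//.
apply: h.
- by move=> _; exact: measurableT.
- by move=> n; exact: measurable_step_fun.
- move=> x; rewrite (_ : (fun n => _) = (fun n => step_fun (d n) (N n) (c n) x)); last first.
    by apply/funext => n; rewrite patchE in_setT.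
  have [x0|x0] := leP x 0.
    rewrite f0//; apply: (cvg_eventually (@cvg_cst_seq R 0)); apply: nearW => n.
    exact: step_fun_npos.
  have /choice[j jP] : forall n, exists j, 0 < d n -> in_cell (d n) j x.
    move=> n; have [dn|dn] := ltP 0 (d n); last by exists 0%N => ?.
    by have [j jn] := cell_exists dn x0; exists j.
  have jn : \forall n \near \oo, in_cell (d n) (j n) x by apply: filterS dpos => n /jP.
  apply: (cvg_eventually (cf x j x0 jn)); near=> n; apply: step_funE => //.
  + by near: n.
  + by near: n.
  + exact: cN.
- near=> n => x _; have dn : 0 < d n by near: n.
  have cGn : forall j x, 0 < x -> in_cell (d n) j x -> c n j <= G x by near: n.
  have [x0|x0] := leP x 0; first by rewrite step_fun_npos// normr0.
  have [j jn] := cell_exists dn x0.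
  by rewrite (step_funE dn jn (cN n)) ger0_norm//; exact: cGn jn.
Unshelve. all: by end_near. Qed.

End Quadratic_steps.

(** * The increments attached to a value of the mex *)

Section Mex_increments.
Local Open Scope nat_scope.
Variables (s : nat) (s_gt0 : 0 < s).
Implicit Types (A M r m n k N : nat).

(** The number of partitions of n of mex m. *)
Definition mex_incr n m := npart_mex s m.-1 n - npart_mex s m n.

(** Each block of M consecutive integers contains one term of the class. *)
Lemma sum_residue (F : nat -> nat) A M N : 0 < A -> A <= M ->
  \sum_(1 <= m < A + N * M | m == A %[mod M]) F m = \sum_(0 <= j < N) F (A + j * M).
Proof.
move=> A0 AM; have M0 : 0 < M by exact: leq_trans AM.
elim: N => [|N IH].
  rewrite addn0 [RHS]big_geq// big_nat_cond big1// => m /andP[/andP[m0 mA] /eqP mE].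
  move: mE; rewrite (modn_small (leq_trans mA AM)).
  have [->|AM'] := eqVneq A M; first by rewrite modnn => m0'; rewrite m0' in m0.
  by rewrite modn_small ?ltn_neqAle ?AM'// => mE; rewrite mE ltnn in mA.
rewrite big_nat_recr//= -IH (big_cat_nat (n := A + N * M))//=; last 2 first.
- by rewrite addn_gt0 A0.
- by rewrite leq_add2l mulSn leq_addl.
congr (_ + _).
rewrite big_ltn_cond; last by rewrite ltn_add2l ltn_pmul2r.
have E : A + N * M = A %[mod M] by rewrite addnC modnMDl.
rewrite E eqxx big_nat_cond big1 ?addn0// => m /andP[/andP[h1 h2] /eqP mE].
have : m - (A + N * M) = 0.
  have : (m - (A + N * M)) %% M = 0.
    apply/eqP; rewrite -/(dvdn M _) -eqn_mod_dvd ?(ltnW h1)//.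
    by rewrite mE E.
  by rewrite modn_small// ltn_subLR ?(ltnW h1)//; move: h2; rewrite mulSn; lia.
by lia.
Qed.

Lemma npart_mex_gt k n : n < k -> npart_mex s k n = 0.
Proof.
by move=> nk; rewrite /npart_mex leqNgt (leq_trans nk)// tri_geq.
Qed.

Lemma mex_incr_gt n m : n.+1 < m -> mex_incr n m = 0.
Proof. by case: m => // m nm; rewrite /mex_incr /= npart_mex_gt. Qed.

Lemma sigma_residue A M r n : 0 < A -> A <= M ->
  sigma s_gt0 M A r n = \sum_(0 <= j < n.+2) (A + j * M) ^ r * mex_incr n (A + j * M).
Proof.
move=> A0 AM; rewrite sigmaE -(sum_residue (fun m => m ^ r * mex_incr n m))//.
have M0 : 0 < M by exact: leq_trans AM.
rewrite [RHS](big_cat_nat (n := n.+2))//=; last first.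
  by rewrite (leq_trans _ (leq_addl _ _))// leq_pmulr.
rewrite [X in _ + X]big_nat_cond [X in _ + X]big1 ?addn0// => m /andP[/andP[h1 _] _].
by rewrite mex_incr_gt// muln0.
Qed.

Lemma npart0_le_no1 : npart 0 <= npart_no1 0.
Proof.
apply: fsubset_leq_card; apply/fsubsetP => p; rewrite in_fset_sep partitionsE => pP.
rewrite pP /=; apply/negP => /leq_sumn.
by move: pP; rewrite /is_partition => /and3P[_ _ /eqP->].
Qed.

(** npart n is the sum of npart_no1 over the indices up to n, each of which
    is at most the value at n.+2. *)
Lemma npart_le_no1 n : npart n <= n.+1 * npart_no1 n.+2.
Proof.
have := increment_le_no1 0 n; rewrite add0n leq_subLR => /leq_trans; apply.
rewrite mulSn leq_add2r (leq_trans npart0_le_no1)//.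
by have := @npart_no1_leD 0 n.+2 isT; rewrite add0n.
Qed.

(** The increment is a sum of s k.+1 consecutive values of npart_no1. When
    tri s k.+1 exceeds n there are fewer of them, and [npart_le_no1] applies. *)
Lemma mex_incr_le n k : tri s k <= n ->
  mex_incr n k.+1 <= s * k.+1 * npart_no1 (n - tri s k).+2.
Proof.
move=> kn; rewrite /mex_incr /= /npart_mex kn triS.
case: ifPn => [h|]; last first.
  rewrite -ltnNge subn0 => h; apply: (leq_trans (npart_le_no1 _)).
  by rewrite leq_mul2r; apply/orP; right; rewrite ltn_subLR.
have := increment_le_no1 (n - (tri s k + s * k.+1)) (s * k.+1).
by have -> : n - (tri s k + s * k.+1) + s * k.+1 = n - tri s k by lia.
Qed.

Lemma mex_incr_eq0 n k : n < tri s k -> mex_incr n k.+1 = 0.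
Proof. by move=> kn; rewrite /mex_incr /= /npart_mex leqNgt kn. Qed.

Lemma mex_incr_ge n k : (tri s k.+1).+1 <= n ->
  s * k.+1 * npart_no1 (n - (tri s k.+1).+1) <= mex_incr n k.+1.
Proof.
move=> kn; rewrite /mex_incr /= /npart_mex (ltnW kn).
have kn' : tri s k <= n by rewrite (leq_trans _ (ltnW kn))// triS leq_addr.
rewrite kn'.
have := no1_le_increment (n - (tri s k.+1).+1) (s * k.+1).
have -> : (n - (tri s k.+1).+1).+1 = n - tri s k.+1 by lia.
have -> : n - tri s k.+1 + s * k.+1 = n - tri s k by rewrite triS in kn *; lia.
by [].
Qed.

End Mex_increments.

Lemma natr_tri (R : realType) s k : (tri s k)%:R = s%:R * (k%:R * k.+1%:R) / 2 :> R.
Proof.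
have h : (k.+1 * k = 'C(k.+1, 2) * 2)%N.
  by have := mul_bin_diag k.+1 1; rewrite /= bin1 mulnC => ->; rewrite mulnC.
have : (k.+1 * k)%:R = ('C(k.+1, 2) * 2)%:R :> R by rewrite h.
rewrite /tri !natrM => E; rewrite (mulrC k%:R) E.
by field.
Qed.

(** * The sum over a residue class *)

Section Residue_sum.
Context {R : realType}.
Variables (s A M r : nat).
Hypotheses (s_gt0 : (0 < s)%N) (A_gt0 : (0 < A)%N) (A_le_M : (A <= M)%N).
Implicit Types (x y : R) (n j : nat).
Local Notation mu := (@lebesgue_measure R).
Local Notation mR := (measurableTypeR R).

(** The constant c for which e^(- c m^2 / sqrt n) describes the decay in m:
    lowering the argument of npart by s m^2 / 2 divides it by
    e^(saddle n s m^2 / 2). *)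
Definition curv : R := rate * s%:R / 2.
(** So that mesh n j^2 = curv (M j)^2 / sqrt n. *)
Definition mesh n : R := curv * M%:R ^+ 2 / Num.sqrt n%:R.
Definition root4 n : R := Num.sqrt (Num.sqrt n%:R).
Definition idx j := (A + j * M)%N.

(** The normalised term of index j of the sum, divided by the length of the
    cell number j. *)
Definition density n j : R :=
  ((idx j)%:R / root4 n) ^+ r * (mex_incr s n (idx j))%:R / growth n / (mesh n * (2 * j%:R + 1)).

Let M_gt0 : (0 < M)%N. Proof. exact: leq_trans A_le_M. Qed.
Let MR0 : 0 < M%:R :> R. Proof. by rewrite ltr0n. Qed.
Let sR0 : 0 < s%:R :> R. Proof. by rewrite ltr0n. Qed.

Lemma curv_gt0 : 0 < curv.
Proof. by rewrite divr_gt0// mulr_gt0 ?rate_gt0. Qed.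

Let k0 := curv_gt0.

Lemma mesh_ge0 n : 0 <= mesh n.
Proof. by rewrite divr_ge0 ?sqrtr_ge0// mulr_ge0 ?sqr_ge0// ltW. Qed.

Lemma mesh_gt0 n : (0 < n)%N -> 0 < mesh n.
Proof. by move=> n0; rewrite divr_gt0 ?sqrtr_gt0 ?ltr0n// mulr_gt0// exprn_gt0. Qed.

Lemma root4_gt0 n : (0 < n)%N -> 0 < root4 n.
Proof. by move=> n0; rewrite !sqrtr_gt0 ltr0n. Qed.

Lemma root4_sqr n : root4 n ^+ 2 = Num.sqrt n%:R.
Proof. by rewrite sqr_sqrtr// sqrtr_ge0. Qed.

Lemma cvg_inv_root4 : (root4 n)^-1 @[n --> \oo] --> (0 : R).
Proof.
have := cvg_sqrt_seq (@cvg_inv_sqrt R); rewrite sqrtr0 => /cvg_eventually; apply.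
by apply: nearW => n; rewrite sqrtrV// sqrtr_ge0.
Qed.

Lemma idxS j : exists2 k, idx j = k.+1 & (k = A.-1 + j * M)%N.
Proof. by exists (A.-1 + j * M)%N => //; rewrite /idx -addSn prednK. Qed.

Lemma density_ge0 n j : 0 <= density n j.
Proof.
have g0 : 0 <= growth n :> R.
  by rewrite divr_ge0 ?expR_ge0// mulr_ge0// mulr_ge0// sqrtr_ge0.
rewrite divr_ge0//; last by rewrite mulr_ge0 ?mesh_ge0// addr_ge0// mulr_ge0.
by rewrite divr_ge0// mulr_ge0// exprn_ge0// divr_ge0// sqrtr_ge0.
Qed.

Lemma density_eq0 n j : (n.+2 <= j)%N -> density n j = 0.
Proof.
move=> nj; rewrite /density mex_incr_gt ?mulr0 ?mul0r//.
by rewrite (leq_trans nj)// (leq_trans _ (leq_addl _ _))// leq_pmulr.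
Qed.

Lemma sum_density n : (0 < n)%N ->
  \sum_(0 <= j < n.+2) density n j * (mesh n * (2 * j%:R + 1)) =
  (sigma s_gt0 M A r n)%:R / (growth n * root4 n ^+ r).
Proof.
move=> n0; have d0 := mesh_gt0 n0; have g0 := @growth_gt0 R n n0; have x0 := root4_gt0 n0.
rewrite (@sigma_residue s s_gt0 A M r n A_gt0 A_le_M) raddf_sum/= mulr_suml.
apply: eq_bigr => j _; rewrite divfK; last first.
  by rewrite gt_eqF// mulr_gt0// ltr_wpDl// mulr_ge0.
rewrite natrM natrX expr_div_n -/(idx j).
have xr : root4 n ^+ r != 0 by rewrite gt_eqF// exprn_gt0.
by field; rewrite xr gt_eqF.
Qed.

Section Pointwise.
Variables (x : R) (j : nat -> nat).
Hypotheses (x_gt0 : 0 < x) (jx : \forall n \near \oo, in_cell (mesh n) (j n) x).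
Let xi := Num.sqrt (x / curv).

Let xi0 : 0 < xi. Proof. by rewrite sqrtr_gt0 divr_gt0. Qed.

(** Taking square roots, x is in the cell j of mesh n exactly when
    M j / root4 n < xi <= M (j + 1) / root4 n. *)
Lemma cell_ratio_cvg : (j n)%:R / root4 n @[n --> \oo] --> xi / M%:R.
Proof.
have lo : xi / M%:R - (root4 n)^-1 @[n --> \oo] --> xi / M%:R.
  by have := cvgB_seq (@cvg_cst_seq R (xi / M%:R)) cvg_inv_root4; rewrite subr0.
apply: (squeeze_cvgr _ lo (@cvg_cst_seq R (xi / M%:R))); near=> n.
have n0 : (0 < n)%N by near: n; exists 1%N.
have X0 := root4_gt0 n0.
have : in_cell (mesh n) (j n) x by near: n.
have E (a : R) : mesh n * a ^+ 2 = curv * (M%:R * a / root4 n) ^+ 2.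
  by rewrite /mesh -root4_sqr; field; rewrite gt_eqF.
have xk : 0 <= x / curv by rewrite divr_ge0// ltW.
have p0 (k : nat) : 0 <= M%:R * k%:R / root4 n by rewrite divr_ge0 ?mulr_ge0// ltW.
rewrite /in_cell !E -ltr_pdivlMl// -ler_pdivrMl// (mulrC curv^-1) -[x / curv]sqr_sqrtr// -/xi.
rewrite ltr_pXn2r ?nnegrE ?p0 ?(ltW xi0)// ler_pXn2r ?nnegrE ?p0 ?(ltW xi0)//.
rewrite -natr1 => /andP[h1 h2]; apply/andP; split.
  rewrite lerBlDr ler_pdivrMr//; apply: (le_trans h2).
  by rewrite le_eqVlt; apply/orP; left; apply/eqP; ring.
by rewrite ler_pdivlMr//; apply: (le_trans _ (ltW h1)); rewrite le_eqVlt; apply/orP; left; apply/eqP; ring.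
Unshelve. all: by end_near. Qed.

Lemma idx_ratio_cvg : (idx (j n))%:R / root4 n @[n --> \oo] --> xi.
Proof.
have := cvgD_seq (cvgMl_seq (k := A%:R) cvg_inv_root4) (cvgMl_seq (k := M%:R) cell_ratio_cvg).
have -> : A%:R * 0 + M%:R * (xi / M%:R) = xi by field; rewrite gt_eqF.
move/cvg_eventually; apply; apply: nearW => n.
by rewrite /idx natrD natrM; ring.
Qed.

Lemma tri_ratio_cvg (a b : nat) (k : nat -> nat) :
    (forall n, (k n + a)%N = (idx (j n) + b)%N) ->
  (tri s (k n))%:R / Num.sqrt n%:R @[n --> \oo] --> x / rate.
Proof.
move=> ka.
have kc (e : nat) : (k n + e)%:R / root4 n @[n --> \oo] --> xi.
  have := cvgD_seq idx_ratio_cvg (cvgMl_seq (k := b%:R - a%:R + e%:R) cvg_inv_root4).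
  rewrite mulr0 addr0 => /cvg_eventually; apply; apply: nearW => n.
  have : (k n)%:R + a%:R = (idx (j n))%:R + b%:R :> R by rewrite -!natrD ka.
  by move=> h; rewrite natrD -mulrDl; congr (_ / _); lra.
have := cvgMl_seq (k := s%:R / 2) (cvgM_seq (kc 0%N) (kc 1%N)).
have -> : s%:R / 2 * (xi * xi) = x / rate.
  rewrite -expr2 sqr_sqrtr; last by rewrite divr_ge0// ltW.
  rewrite /curv; have r0 := @rate_gt0 R; move: (rate : R) r0 => c c0; field.
  by rewrite !gt_eqF.
move/cvg_eventually; apply; near=> n.
have n0 : (0 < n)%N by near: n; exists 1%N.
rewrite natr_tri -root4_sqr addn0 addn1; have := root4_gt0 n0.
by move: (root4 n) => X X0; field; rewrite gt_eqF.
Unshelve. all: by end_near. Qed.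

Lemma no1_upper_cvg :
  (npart_no1 (n - tri s (idx (j n)).-1).+2)%:R * Num.sqrt n%:R / growth n
    @[n --> \oo] --> rate * expR (- x).
Proof.
have r0 := @rate_gt0 R.
have -> : - x = rate * - (x / rate) by rewrite mulrN mulrC divfK// gt_eqF.
have xr : 0 < x / rate by rewrite divr_gt0// rate_gt0.
have tc := @tri_ratio_cvg 1 0 (fun n => (idx (j n)).-1).
have {}tc : (tri s (idx (j n)).-1)%:R / Num.sqrt n%:R @[n --> \oo] --> x / rate.
  by apply: tc => n; rewrite addn1 addn0 prednK// addn_gt0 A_gt0.
have big : \forall n \near \oo, (tri s (idx (j n)).-1 <= n)%N.
  near=> n; have n0 : (0 < n)%N by near: n; exists 1%N.
  have q0 : 0 < Num.sqrt n%:R :> R by rewrite sqrtr_gt0 ltr0n.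
  have h1 : (tri s (idx (j n)).-1)%:R / Num.sqrt n%:R <= x / rate + 1.
    by near: n; apply: (cvgr_le _ tc); rewrite ltrDl.
  have h2 : (Num.sqrt n%:R)^-1 <= (x / rate + 1)^-1.
    by near: n; apply: (cvgr_le _ (@cvg_inv_sqrt R)); rewrite invr_gt0 addr_gt0.
  rewrite lef_pV2 ?posrE// ?addr_gt0// in h2.
  rewrite -(ler_nat R) -[leRHS]sqr_sqrtr// expr2.
  by rewrite ler_pdivrMr// in h1; apply: (le_trans h1); rewrite ler_wpM2r// ltW.
apply: (@no1_shift_cvg R (fun n => (n - tri s (idx (j n)).-1).+2)).
have := cvgB_seq (cvgMl_seq (k := 2) (@cvg_inv_sqrt R)) tc.
rewrite mulr0 sub0r => /cvg_eventually; apply; apply: filterS big => n big.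
by rewrite -addn2 natrD natrB//; ring.
Unshelve. all: by end_near. Qed.

Lemma near_tri_lt : \forall n \near \oo, ((tri s (idx (j n))).+1 <= n)%N.
Proof.
have tc := @tri_ratio_cvg 0 0 (fun n => idx (j n)) (fun=> erefl).
have xr : 0 < x / rate by rewrite divr_gt0// rate_gt0.
near=> n; have n0 : (0 < n)%N by near: n; exists 1%N.
have q0 : 0 < Num.sqrt n%:R :> R by rewrite sqrtr_gt0 ltr0n.
have h1 : (tri s (idx (j n)))%:R / Num.sqrt n%:R <= x / rate + 1.
  by near: n; apply: (cvgr_le _ tc); rewrite ltrDl.
have h2 : (Num.sqrt n%:R)^-1 < (x / rate + 1)^-1.
  by near: n; apply: (cvgr_lt _ (@cvg_inv_sqrt R)); rewrite invr_gt0 addr_gt0.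
rewrite ltf_pV2 ?posrE// ?addr_gt0// in h2.
rewrite -(ltr_nat R) -[ltRHS]sqr_sqrtr// expr2.
by rewrite ler_pdivrMr// in h1; apply: (le_lt_trans h1); rewrite ltr_pM2r.
Unshelve. all: by end_near. Qed.

Lemma no1_lower_cvg :
  (npart_no1 (n - (tri s (idx (j n))).+1))%:R * Num.sqrt n%:R / growth n
    @[n --> \oo] --> rate * expR (- x).
Proof.
have r0 := @rate_gt0 R.
have -> : - x = rate * - (x / rate) by rewrite mulrN mulrC divfK// gt_eqF.
have tc := @tri_ratio_cvg 0 0 (fun n => idx (j n)) (fun=> erefl).
apply: (@no1_shift_cvg R (fun n => n - (tri s (idx (j n))).+1)%N).
have := cvgB_seq (cvgMl_seq (k := -1) (@cvg_inv_sqrt R)) tc.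
rewrite mulr0 sub0r => /cvg_eventually; apply; apply: filterS near_tri_lt => n big.
by rewrite natrB// -natr1; ring.
Qed.

(** [mex_incr_ge] and [mex_incr_le] enclose the quotient between two values of
    npart_no1 at indices n - x sqrt n / rate + o(sqrt n). *)
Lemma mex_incr_cvg :
  (mex_incr s n (idx (j n)))%:R * Num.sqrt n%:R / growth n / (s%:R * (idx (j n))%:R)
    @[n --> \oo] --> rate * expR (- x).
Proof.
apply: (squeeze_cvgr _ no1_lower_cvg no1_upper_cvg); near=> n.
have n0 : (0 < n)%N by near: n; exists 1%N.
have q0 : 0 < Num.sqrt n%:R :> R by rewrite sqrtr_gt0 ltr0n.
have g0 := @growth_gt0 R n n0.
have : ((tri s (idx (j n))).+1 <= n)%N by near: n; exact: near_tri_lt.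
have [k -> _] := idxS (j n) => kn.
have lo := mex_incr_ge s_gt0 kn.
have kn' : (tri s k <= n)%N by rewrite (leq_trans _ (ltnW kn))// triS leq_addr.
have := mex_incr_le s_gt0 kn'; move: lo; rewrite -!(ler_nat R) !natrM /=.
have sk : 0 < s%:R * k.+1%:R :> R by rewrite mulr_gt0.
rewrite -!(mulrA _ (Num.sqrt n%:R)); have : 0 < Num.sqrt n%:R / growth n :> R by rewrite divr_gt0.
move: (_ / growth n) (s%:R * k.+1%:R) sk => w z z0 w0 h1 h2.
by rewrite ler_pdivlMr// ler_pdivrMr// !(mulrAC _ w z) !ler_pM2r// ![_ * z]mulrC h1.
Unshelve. all: by end_near. Qed.

(** 2 j + 1 is the length of the cell in units of the mesh. *)
Lemma odd_ratio_cvg : s%:R * (idx (j n))%:R / (curv * M%:R ^+ 2 * (2 * (j n)%:R + 1))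
  @[n --> \oo] --> (rate * M%:R)^-1.
Proof.
have o : (2 * (j n)%:R + 1) / root4 n @[n --> \oo] --> 2 * (xi / M%:R).
  have := cvgD_seq (cvgMl_seq (k := 2) cell_ratio_cvg) cvg_inv_root4.
  by rewrite addr0 => /cvg_eventually; apply; apply: nearW => n; ring.
have o0 : 2 * (xi / M%:R) != 0 by rewrite gt_eqF// mulr_gt0// divr_gt0.
have := cvgMl_seq (k := s%:R / (curv * M%:R ^+ 2)) (cvgM_seq idx_ratio_cvg (cvgV_seq o0 o)).
have -> : s%:R / (curv * M%:R ^+ 2) * (xi / (2 * (xi / M%:R))) = (rate * M%:R)^-1.
  rewrite /curv; have r0 := @rate_gt0 R; move: (rate : R) xi r0 xi0 => c y c0 y0; field.
  by rewrite !gt_eqF.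
move/cvg_eventually; apply; near=> n.
have n0 : (0 < n)%N by near: n; exists 1%N.
have jn0 : 0 < 2 * (j n)%:R + 1 :> R by rewrite ltr_wpDl// mulr_ge0.
have := root4_gt0 n0; move: (root4 n) (curv) k0 => X c c0 X0; field.
by rewrite !gt_eqF.
Unshelve. all: by end_near. Qed.

Lemma cvgX_seq (u : nat -> R) (l : R) k :
  u n @[n --> \oo] --> l -> u n ^+ k @[n --> \oo] --> l ^+ k.
Proof.
move=> ul; elim: k => [|k IH]; first by rewrite expr0; exact: cvg_cst.
by rewrite exprS; under eq_fun do rewrite exprS; exact: cvgM_seq.
Qed.

(** The product of the three limits above. *)
Lemma density_cvg : density n (j n) @[n --> \oo] --> xi ^+ r * expR (- x) / M%:R.
Proof.
have := cvgM_seq (cvgM_seq (cvgX_seq (k := r) idx_ratio_cvg) mex_incr_cvg) odd_ratio_cvg.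
have -> : xi ^+ r * (rate * expR (- x)) / (rate * M%:R) = xi ^+ r * expR (- x) / M%:R.
  have r0 := @rate_gt0 R; move: (rate : R) r0 (xi ^+ r) => c c0 y; field.
  by rewrite !gt_eqF.
move/cvg_eventually; apply; near=> n.
have n0 : (0 < n)%N by near: n; exists 1%N.
have q0 : 0 < Num.sqrt n%:R :> R by rewrite sqrtr_gt0 ltr0n.
have g0 := @growth_gt0 R n n0.
have i0 : 0 < (idx (j n))%:R :> R by rewrite ltr0n /idx addn_gt0 A_gt0.
have jn0 : 0 < 2 * (j n)%:R + 1 :> R by rewrite ltr_wpDl// mulr_ge0.
rewrite /density /mesh.
move: ((_ / root4 n) ^+ r) (growth n) (Num.sqrt n%:R) g0 q0 (curv) k0 => y g q g0 q0 c c0; field.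
by rewrite !gt_eqF.
Unshelve. all: by end_near. Qed.

End Pointwise.

(** A fraction of the exponential absorbs any power of 1 + y. *)
Lemma poly_expRN_le (k : nat) (y : R) : 0 <= y ->
  (1 + y) ^+ k * expR (- (y / 2)) * (1 + y ^+ 2) <= 2 ^+ k.+2 * k.+2`!%:R * expR 2^-1.
Proof.
move=> y0; have h0 : 0 <= (1 + y) / 2 by rewrite divr_ge0// addr_ge0.
have := @pow_expRN_le R _ k.+2 h0.
have -> : expR (- ((1 + y) / 2)) = expR (- (y / 2)) / expR 2^-1.
  by rewrite -expRN -expRD; congr expR; field.
have e0 := expR_gt0 (2^-1 : R); have e1 := expR_ge0 (- (y / 2)).
rewrite mulrA ler_pdivrMr// expr_div_n => h.
rewrite -[leRHS]mulrA -ler_pdivrMl ?exprn_gt0//; apply: le_trans h.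
have -> : (1 + y) ^+ k.+2 / 2 ^+ k.+2 * expR (- (y / 2)) =
  (2 ^+ k.+2)^-1 * ((1 + y) ^+ k * expR (- (y / 2)) * (1 + y) ^+ 2) by rewrite !exprS; ring.
rewrite ler_wpM2l ?invr_ge0 ?exprn_ge0// ler_wpM2l ?mulr_ge0 ?exprn_ge0 ?addr_ge0//.
by rewrite sqrrD expr1n mul1r; lra.
Qed.

(** [no1_tilted_le] gives e^(- mesh n j^2), because tri s m.-1 is at least
    s (M j)^2 / 2; on the cell j this is at most a constant times e^(- x / 2).
    The other factors are polynomial in x. *)
Lemma density_dominated : exists2 B : R, 0 <= B & \forall n \near \oo, forall j x,
  0 < x -> in_cell (mesh n) j x -> density n j <= B * (1 + x ^+ 2)^-1.
Proof.
have [C C0 bC] := @no1_tilted_le R.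
pose K := 1 + 2 / curv; have K0 : 0 <= K by rewrite addr_ge0// divr_ge0// ltW.
pose S := s%:R / (curv * M%:R); have S0 : 0 <= S by rewrite divr_ge0// mulr_ge0// ltW.
pose B := K ^+ r * (C * expR 1 * S) * (2 ^+ r.+2 * r.+2`!%:R * expR 2^-1).
have KS0 : 0 <= K ^+ r * (C * expR 1 * S).
  apply: mulr_ge0; first exact: exprn_ge0.
  by apply: mulr_ge0 => //; apply: mulr_ge0 => //; exact: expR_ge0.
have B0 : 0 <= B.
  apply: (mulr_ge0 KS0); apply: mulr_ge0 (expR_ge0 _); apply: mulr_ge0 (ler0n _ _).
  exact: exprn_ge0.
exists B => //.
have d1 : \forall n \near \oo, mesh n <= 1.
  have := cvgMl_seq (k := curv * M%:R ^+ 2) (@cvg_inv_sqrt R); rewrite mulr0 => h.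
  by apply: (cvgr_le _ h).
near=> n => j x x0 /andP[h1 h2].
have n0 : (0 < n)%N by near: n; exists 1%N.
have q0 : 0 < Num.sqrt n%:R :> R by rewrite sqrtr_gt0 ltr0n.
have g0 := @growth_gt0 R n n0; have X0 := root4_gt0 n0; have dn0 := mesh_gt0 n0.
have dn1 : mesh n <= 1 by near: n.
have bCn : forall i, (i <= n)%N ->
  (npart_no1 (n - i).+2)%:R * Num.sqrt n%:R / growth n <= C * expR (- (i%:R * saddle n)) by near: n.
have jx : x / 2 - 1 <= mesh n * j%:R ^+ 2.
  move: h2; rewrite -natr1; have : 0 <= mesh n * (j%:R - 1) ^+ 2 by rewrite mulr_ge0 ?sqr_ge0// ltW.
  by move: (mesh n) (j%:R : R) dn0 dn1 => d a d0 dle a1 h2; lra.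
have jn0 : 0 < 2 * j%:R + 1 :> R by rewrite ltr_wpDl// mulr_ge0.
have [k ik kE] := idxS j.
have kM : (j * M <= k)%N by rewrite kE leq_addl.
have i1 : (idx j)%:R <= M%:R * (j%:R + 1) :> R.
  by rewrite natr1 -natrM ler_nat /idx mulnS mulnC leq_add2r.
have e1 : expR (- (mesh n * j%:R ^+ 2)) <= expR 1 * expR (- (x / 2)).
  by rewrite -expRD ler_expR; lra.
have main : (mex_incr s n (idx j))%:R * Num.sqrt n%:R / growth n <=
    s%:R * (idx j)%:R * (C * (expR 1 * expR (- (x / 2)))).
  rewrite ik; have [kn|kn] := leqP (tri s k) n; last first.
    by rewrite mex_incr_eq0// !mul0r mulr_ge0// mulr_ge0// mulr_ge0 ?expR_ge0.
  have := mex_incr_le s_gt0 kn; rewrite -(ler_nat R) !natrM => le.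
  apply: (@le_trans _ _ (s%:R * k.+1%:R * ((npart_no1 (n - tri s k).+2)%:R * Num.sqrt n%:R / growth n))).
    by rewrite !mulrA ler_pM2r ?invr_gt0// ler_pM2r.
  rewrite ler_wpM2l ?mulr_ge0//; apply: (le_trans (bCn _ kn)); rewrite ler_wpM2l//.
  apply: le_trans e1; rewrite ler_expR lerN2 saddleE// natr_tri /mesh.
  have -> : curv * M%:R ^+ 2 / Num.sqrt n%:R * j%:R ^+ 2 =
    s%:R * ((M%:R * j%:R) ^+ 2) / 2 * (rate / Num.sqrt n%:R) by rewrite /curv; ring.
  have rq : 0 <= rate / Num.sqrt n%:R :> R.
    by apply: divr_ge0; [exact/ltW/rate_gt0|exact: ltW].
  apply: (ler_wpM2r rq); rewrite ler_pM2r ?invr_gt0// ler_pM2l//.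
  rewrite expr2 -natrM mulnC ler_pM ?ler_nat//.
  by rewrite (leq_trans kM).
have iX : (idx j)%:R / root4 n <= K * (1 + x).
  have a2 : ((idx j)%:R / root4 n) ^+ 2 <= 2 * (x + 1) / curv.
    rewrite expr_div_n root4_sqr.
    have : (idx j)%:R ^+ 2 <= (M%:R * (j%:R + 1)) ^+ 2 :> R.
      by rewrite lerXn2r ?nnegrE// mulr_ge0// addr_ge0.
    rewrite -(@ler_pM2r _ (Num.sqrt n%:R)^-1) ?invr_gt0// => /le_trans; apply.
    rewrite ler_pdivlMr//.
    have -> : (M%:R * (j%:R + 1)) ^+ 2 / Num.sqrt n%:R * curv = mesh n * (j%:R + 1) ^+ 2.
      by rewrite /mesh; ring.
    have : 0 <= mesh n * (j%:R - 1) ^+ 2 by rewrite mulr_ge0 ?sqr_ge0// ltW.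
    by move: (mesh n) (j%:R : R) h1 dn0 dn1 => d a hh d0 dle a1; lra.
  have : 0 <= ((idx j)%:R / root4 n - 1) ^+ 2 by exact: sqr_ge0.
  have x2 : 0 <= 2 / curv by rewrite divr_ge0// ltW.
  rewrite /K; move: a2; rewrite -[2 * (x + 1) / curv]mulrAC.
  move: (2 / curv) x2 ((idx j)%:R / root4 n) => c c0 a a2 a3.
  nra.
rewrite ler_pdivlMr; last by rewrite ltr_pwDl// sqr_ge0.
have dle : density n j <= (K * (1 + x)) ^+ r * (C * (expR 1 * expR (- (x / 2))) * S).
  have -> : density n j = ((idx j)%:R / root4 n) ^+ r *
     ((mex_incr s n (idx j))%:R * Num.sqrt n%:R / growth n / (curv * M%:R ^+ 2 * (2 * j%:R + 1))).
    rewrite /density /mesh.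
    move: ((_ / root4 n) ^+ r) (growth n) (Num.sqrt n%:R) g0 q0 (curv) k0 => y g q g0 q0 c c0; field.
    by rewrite !gt_eqF.
  apply: ler_pM.
  - by rewrite exprn_ge0// divr_ge0// ltW.
  - apply: divr_ge0; last by apply: mulr_ge0 (ltW jn0); apply: mulr_ge0 (sqr_ge0 _); exact: ltW.
    by apply: divr_ge0 (ltW g0); exact: mulr_ge0 (ler0n _ _) (ltW q0).
  - rewrite lerXn2r ?nnegrE// ?divr_ge0// ?(ltW X0)//.
    by rewrite mulr_ge0// addr_ge0// ltW.
  rewrite ler_pdivrMr; last by rewrite mulr_gt0// mulr_gt0// exprn_gt0.
  apply: (le_trans main).
  have -> : C * (expR 1 * expR (- (x / 2))) * S * (curv * M%:R ^+ 2 * (2 * j%:R + 1)) =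
     s%:R * (M%:R * (2 * j%:R + 1)) * (C * (expR 1 * expR (- (x / 2)))).
    rewrite /S; move: (curv) k0 (expR _) (expR _) => c c0 E1 E2; field.
    by rewrite !gt_eqF.
  rewrite ler_wpM2r ?mulr_ge0 ?expR_ge0// ler_wpM2l//.
  by apply: (le_trans i1); rewrite ler_wpM2l//; have : 0 <= j%:R :> R by []; lra.
apply: (le_trans (ler_wpM2r _ dle)); first by rewrite addr_ge0// sqr_ge0.
have -> : (K * (1 + x)) ^+ r * (C * (expR 1 * expR (- (x / 2))) * S) * (1 + x ^+ 2) =
  K ^+ r * (C * expR 1 * S) * ((1 + x) ^+ r * expR (- (x / 2)) * (1 + x ^+ 2)).
  by rewrite exprMn; ring.
by rewrite ler_wpM2l ?poly_expRN_le ?(ltW x0).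
Unshelve. all: by end_near. Qed.

End Residue_sum.

(** * The limit and its constants *)

Section Main.
Context {R : realType}.
Implicit Types (x z : R) (n : nat).
Local Notation mu := (@lebesgue_measure R).
Local Notation mR := (measurableTypeR R).

Lemma gamma_fun_decay z x : 0 <= z -> 0 < x ->
  gamma_fun z x <= 2 ^+ (Num.truncn z).+3 * (Num.truncn z).+3`!%:R * expR 2^-1 * (1 + x ^+ 2)^-1.
Proof.
move=> z0 x0; have D0 : 0 < 1 + x ^+ 2 by rewrite ltr_pwDl// sqr_ge0.
rewrite ler_pdivlMr//; apply: le_trans (poly_expRN_le (Num.truncn z).+1 (ltW x0)).
rewrite ler_pM2r// /gamma_fun ler_pM ?powR_ge0 ?expR_ge0//.
  rewrite -powR_mulrn; last by rewrite addr_ge0// ltW.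
  apply: (@le_trans _ _ ((1 + x) `^ z)).
    by rewrite ge0_ler_powR ?nnegrE ?addr_ge0 ?(ltW x0)// lerDr.
  by rewrite ler_powR ?lerDl ?(ltW x0)// ltW// truncnS_gt.
by rewrite ler_expR; lra.
Qed.

Lemma integrable_gamma_fun z : 0 <= z -> mu.-integrable `]0, +oo[%classic (EFin \o gamma_fun z).
Proof.
move=> z0; pose C : R := 2 ^+ (Num.truncn z).+3 * (Num.truncn z).+3`!%:R * expR 2^-1.
have mI : measurable (`]0, +oo[%classic : set mR) by exact: measurable_itv.
apply: (le_integrable mI _ _ (integrableS measurableT mI (@subsetT _ _) (integrable_cauchy C))).
  by apply/measurable_EFinP; apply: measurable_funTS; exact: measurable_gamma_fun.
move=> x; rewrite /= in_itv/= andbT => x0; rewrite lee_fin ger0_norm ?gamma_fun_ge0//.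
by apply: le_trans (gamma_fun_decay z0 x0) _; exact: ler_norm.
Qed.

(** The restriction to z >= 1 keeps the integrand bounded near 0. *)
Lemma Gamma_gt0 z : 1 <= z -> 0 < Gamma z.
Proof.
move=> z1; have z0 : 0 <= z - 1 by rewrite subr_ge0.
apply: (@lt_le_trans _ _ (expR (- 2))); first exact: expR_gt0.
have le12 : 1 <= 2 :> R by lra.
have D1 (x : R) : is_derive x 1 (fun x : R => expR (- 2) * x) (expR (- 2)) by is_derive_ring.
have := @Rintegral_derive_in R (fun x => expR (- 2) * x) (fun=> expR (- 2)) 1 2 le12.
have -> : expR (- 2) * 2 - expR (- 2) * 1 = expR (- 2) :> R by ring.
move=> <- //; last by move=> x _; exact: cvg_cst.
rewrite GammaE.
have m12 : measurable (`[1, 2]%classic : set mR) by exact: measurable_itv.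
have mI : measurable (`]0, +oo[%classic : set mR) by exact: measurable_itv.
apply: (@le_trans _ _ (\int[mu]_(x in `[1, 2]) gamma_fun (z - 1) x)).
  apply: le_Rintegral => //.
  - by apply: integrable_continuous_itv => x; exact: cvg_cst.
  - apply: (integrableS _ _ _ (integrable_gamma_fun z0)); [exact: measurable_itv|exact: measurable_itv|].
    by move=> x; rewrite /= !in_itv/= andbT => /andP[h _]; apply: lt_le_trans h.
  - move=> x; rewrite /= in_itv/= => /andP[x1 x2]; rewrite /gamma_fun.
    rewrite -[leLHS]mul1r ler_pM ?expR_ge0//; last by rewrite ler_expR lerN2.
    by have := ler_powR x1 z0; rewrite powRr0.
rewrite Rintegral_mkcond [leRHS]Rintegral_mkcond; apply: le_Rintegral => //.
- rewrite -restrict_EFin; apply/(integrable_mkcond _ m12).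
  apply: (integrableS _ _ _ (integrable_gamma_fun z0)); [exact: measurable_itv|exact: measurable_itv|].
  by move=> x; rewrite /= !in_itv/= andbT => /andP[h _]; apply: lt_le_trans h.
- rewrite -restrict_EFin; apply/(integrable_mkcond _ mI).
  exact: integrable_gamma_fun.
- move=> x _; rewrite !patchE; case: ifPn => [|_].
    rewrite inE/= in_itv/= => /andP[x1 _]; rewrite ifT// inE/= in_itv/= andbT.
    exact: lt_le_trans x1.
  by case: ifPn => // _; exact: gamma_fun_ge0.
Qed.

Variables (s A M r : nat).
Hypotheses (s_gt0 : (0 < s)%N) (A_gt0 : (0 < A)%N) (A_le_M : (A <= M)%N).

Definition limit_density x : R :=
  if x <= 0 then 0 else Num.sqrt (x / curv s) ^+ r * expR (- x) / M%:R.

Lemma limit_densityE x : limit_density x =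
  ((fun x => (curv s `^ (r%:R / 2))^-1 / M%:R * gamma_fun (r%:R / 2) x) \_ `]0, +oo[) x.
Proof.
rewrite patchE /limit_density; case: leP => x0.
  by rewrite ifF//; apply/negbTE; rewrite notin_setE/= in_itv/= andbT; apply/negP; rewrite -leNgt.
rewrite ifT; last by rewrite inE/= in_itv/= andbT.
have k0 := @curv_gt0 R s s_gt0.
have xk : 0 <= x / curv s by rewrite divr_ge0// ltW.
have -> : Num.sqrt (x / curv s) ^+ r = x `^ (r%:R / 2) / curv s `^ (r%:R / 2).
  rewrite -powR12_sqrt// -powR_mulrn ?powR_ge0// -powRrM mulrC -[r%:R * _]/(r%:R / 2).
  have -> : curv s `^ (r%:R / 2) = ((curv s)^-1 `^ (r%:R / 2))^-1 :> R.
    by rewrite -(powR_inv1 (ltW k0)) -powRrM mulN1r powRN invrK.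
  by rewrite invrK (mulrC 2^-1) powRM ?invr_ge0 ?(ltW x0) ?(ltW k0)// [LHS]mulrC.
by rewrite /gamma_fun; ring.
Qed.

Lemma Rintegral_limit_density :
  \int[mu]_x limit_density x = (curv s `^ (r%:R / 2))^-1 / M%:R * Gamma (r%:R / 2 + 1).
Proof.
rewrite (_ : limit_density = (fun x => (curv s `^ (r%:R / 2))^-1 / M%:R * gamma_fun (r%:R / 2) x) \_ `]0, +oo[).
  rewrite -Rintegral_mkcond RintegralZl//; first by rewrite GammaE addrK.
  by apply: integrable_gamma_fun; rewrite divr_ge0.
by apply/funext => x; exact: limit_densityE.
Qed.

(** The factor growth n root4 n ^+ r is the size of the terms; the sum over the
    class is the Riemann sum of [step_sum_cvg]. *)
Theorem sigma_asymp :
  (sigma s_gt0 M A r n)%:R / (growth n * root4 n ^+ r) @[n --> \oo] -->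
  ((curv s `^ (r%:R / 2))^-1 / M%:R * Gamma (r%:R / 2 + 1) : R).
Proof.
have [B B0 dB] := @density_dominated R s A M r s_gt0 A_gt0 A_le_M.
rewrite -Rintegral_limit_density.
have h : \sum_(0 <= j < n.+2) density s A M r n j * (mesh s M n * (2 * j%:R + 1)) @[n --> \oo]
    --> \int[mu]_x limit_density x.
  apply: (@step_sum_cvg R (fun n => n.+2) (mesh s M) (density s A M r) limit_density (fun x => B * (1 + x ^+ 2)^-1)).
  - by move=> n; exact: mesh_ge0.
  - by exists 1%N => // n /= n0; apply: (@mesh_gt0 R s A M).
  - by move=> n j; exact: density_ge0.
  - by move=> n j; exact: (@density_eq0 R s A M).
  - exact: integrable_cauchy.
  - by move=> x; rewrite mulr_ge0// invr_ge0 addr_ge0// sqr_ge0.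
  - by move=> x x0; rewrite /limit_density x0.
  - move=> x j x0 jx; rewrite /limit_density leNgt x0/=.
    exact: (@density_cvg R s A M r s_gt0 A_gt0 A_le_M x j x0 jx).
  - exact: dB.
apply: (cvg_eventually h); near=> n.
have n0 : (0 < n)%N by near: n; exists 1%N.
by rewrite (@sum_density R s A M r s_gt0 A_gt0 A_le_M n n0).
Unshelve. all: by end_near. Qed.

End Main.

Section Constants.
Context {R : realType}.

Lemma powR_ln (a y : R) : 0 < a -> a `^ y = expR (y * ln a).
Proof. by move=> a0; rewrite /powR gt_eqF. Qed.

Lemma sqrt_ln (a : R) : 0 < a -> Num.sqrt a = expR (ln a / 2).
Proof.
by move=> a0; rewrite -powR12_sqrt ?ltW// powR_ln// mulrC.
Qed.

(** The constants of the theorem are compared through the logarithms of 2, 3,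
    pi, s and n, in which all the exponents are linear. *)
Lemma expR_2ln2 : expR (2 * ln 2) = 2 ^+ 2 :> R.
Proof. by rewrite expRM_natl lnK ?posrE. Qed.

Lemma growthE n : (0 < n)%N ->
  growth n = expR (pi * Num.sqrt (2 * n%:R / 3)) * expR (- (2 * ln 2) - ln 3 / 2 - ln n%:R) :> R.
Proof.
move=> n0; have nR : 0 < n%:R :> R by rewrite ltr0n.
rewrite /growth natr_saddle// !expRD !expRN expR_2ln2.
rewrite -sqrt_ln// !lnK ?posrE//.
have -> : 2 * (rate * Num.sqrt n%:R) = pi * Num.sqrt (2 * n%:R / 3) :> R.
  rewrite /rate; have -> : 2 * n%:R / 3 = (2 / Num.sqrt 6) ^+ 2 * n%:R :> R.
    by rewrite expr_div_n sqr_sqrtr//; field.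
  rewrite sqrtrM ?sqr_ge0// sqrtr_sqr ger0_norm ?divr_ge0 ?sqrtr_ge0//.
  ring.
have s3 : 0 < Num.sqrt 3 :> R by rewrite sqrtr_gt0.
move: (expR _) (Num.sqrt 3) s3 => e q q0; field.
by rewrite !gt_eqF.
Qed.

Lemma root4E n : (0 < n)%N -> root4 n = expR (ln n%:R / 4) :> R.
Proof.
move=> n0; have nR : 0 < n%:R :> R by rewrite ltr0n.
rewrite /root4 sqrt_ln ?sqrtr_gt0// sqrt_ln// expRK; congr expR.
by field.
Qed.

Lemma curvE s : (0 < s)%N ->
  curv s = expR (ln pi + ln s%:R - 3 / 2 * ln 2 - ln 3 / 2) :> R.
Proof.
move=> s0; have sR : 0 < s%:R :> R by rewrite ltr0n.
have p0 := @pi_gt0 R.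
have ln6 : ln 6 = ln 2 + ln 3 :> R by rewrite -lnM ?posrE//; congr ln; ring.
rewrite /curv /rate sqrt_ln// ln6.
have -> : ln pi + ln s%:R - 3 / 2 * ln 2 - ln 3 / 2 =
  ln pi + ln s%:R - ((ln 2 + ln 3) / 2) - ln 2 :> R by field.
by rewrite !expRD !expRN !lnK ?posrE//; ring.
Qed.

End Constants.

Theorem theorem1p4 (R : realType) (A M r s : nat)
  (A_gt0 : (0 < A)%N) (A_le_M : (A <= M)%N) (s_gt0 : (0 < s)%N) :
  asymp_equiv
    (fun n : nat => (sigma s_gt0 M A r n)%:R : R)
    (fun n : nat =>
       if r == 0%N then
         2 ^- 2 * 3 `^ (- (1 / 2)) * M%:R^-1 * n%:R^-1
           * expR (pi * Num.sqrt (2 * n%:R / 3))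
       else
         2 `^ ((3 * r%:R - 12) / 4) * 3 `^ ((r%:R - 2) / 4)
           * pi `^ (- (r%:R / 2)) * M%:R^-1 * s%:R `^ (- (r%:R / 2))
           * r%:R * Gamma (r%:R / 2) * n%:R `^ ((r%:R - 4) / 4)
           * expR (pi * Num.sqrt (2 * n%:R / 3))).
Proof.
rewrite /asymp_equiv.
have MR : 0 < M%:R :> R by rewrite ltr0n (leq_trans A_gt0).
have sR : 0 < s%:R :> R by rewrite ltr0n.
have p0 := @pi_gt0 R; have k0 := @curv_gt0 R s s_gt0.
have := @sigma_asymp R s A M r s_gt0 A_gt0 A_le_M.
set L := (X in _ --> X) => sL.
have L0 : 0 < L.
  rewrite mulr_gt0// ?divr_gt0 ?invr_gt0 ?powR_gt0//.
  by apply: Gamma_gt0; rewrite lerDr divr_ge0.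
have L1 : L != 0 by rewrite gt_eqF.
have := cvgM_seq sL (@cvg_cst_seq R L^-1); rewrite divff// => /cvg_eventually; apply.
near=> n.
have n0 : (0 < n)%N by near: n; exists 1%N.
have nR : 0 < n%:R :> R by rewrite ltr0n.
rewrite -[RHS]mulrA -invfM; congr (_ / _).
rewrite growthE// root4E// /L; case: eqP => [->|/eqP r0].
  rewrite expr0 mul0r powRr0 add0r Gamma1 invr1 !mulr1 !mul1r.
  have -> : 2 ^- 2 = expR (- (2 * ln 2)) :> R by rewrite expRN expR_2ln2.
  have -> : n%:R^-1 = expR (- ln n%:R) :> R by rewrite expRN lnK.
  rewrite powR_ln// !expRD.
  have -> : - 2^-1 * ln 3 = - (ln 3 / 2) :> R by field.
  by ring.
have r2 : 0 < r%:R / 2 :> R by rewrite divr_gt0// ltr0n lt0n.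
rewrite Gamma_succ// curvE// (powR_ln _ (expR_gt0 _)) expRK -expRN -expRM_natl.
rewrite !powR_ln//.
have half : 2^-1 = expR (- ln 2) :> R by rewrite expRN lnK// posrE.
have key : expR ((3 * r%:R - 12) / 4 * ln 2) * expR ((r%:R - 2) / 4 * ln 3) * expR (- (r%:R / 2) * ln pi)
     * expR (- (r%:R / 2) * ln s%:R) * expR ((r%:R - 4) / 4 * ln n%:R) =
   expR (- (2 * ln 2) - ln 3 / 2 - ln n%:R) * expR (r%:R * (ln n%:R / 4))
     * expR (- (r%:R / 2 * (ln pi + ln s%:R - 3 / 2 * ln 2 - ln 3 / 2))) * 2^-1 :> R.
  rewrite [X in _ = _ * X]half -!expRD; congr expR.
  by move: (ln 2) (ln 3) (ln pi) (ln s%:R) (ln n%:R) => *; field.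
transitivity (expR ((3 * r%:R - 12) / 4 * ln 2) * expR ((r%:R - 2) / 4 * ln 3) * expR (- (r%:R / 2) * ln pi)
     * expR (- (r%:R / 2) * ln s%:R) * expR ((r%:R - 4) / 4 * ln n%:R)
   * (r%:R * Gamma (r%:R / 2) / M%:R * expR (pi * Num.sqrt (2 * n%:R / 3))) : R); first by ring.
by rewrite key; ring.
Unshelve. all: by end_near. Qed.
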